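(* Let $A=u\,\mathrm{Diag}(\{\lambda_i\}_{i\in\mathbb N})\,u^*\in\mathcal K(\mathcal H)^h$ with $u\in\mathcal U_c(\mathcal H)$ and $\{\lambda_i\}_{i\in\mathbb N}\subset\mathbb R$ such that $\lambda_i\neq\lambda_j$ for $i\neq j$, and let $b=\mathrm{Diag}(\{\lambda_i\}_{i\in\mathbb N})\in\mathcal O_A$. Let $Z\in\mathcal K(\mathcal H)^{ah}$ and suppose that there exists a diagonal operator $D_1\in\mathcal D(\mathcal B(\mathcal H)^{ah})$ such that $$\|[Z]\|_{\mathcal K(\mathcal H)^{ah}/\mathcal D(\mathcal K(\mathcal H)^{ah})}=\|Z+D_1\|$$ and $D_1$ is not compact. If there exists $\lambda\in i\mathbb R$ such that $\lim_{j\to\infty}(D_1)_{jj}=\lambda$, then the curve $$\chi(t)=e^{t(Z+D_1-\lambda I)}\,b\,e^{-t(Z+D_1-\lambda I)}$$ has minimal length among all the smooth curves in $\mathcal O_A$ joining $b$ with $\chi(t_0)$, for $t_0\in\left[\frac{\pi}{2\|Z\|},\frac{\pi}{2\|[Z]\|}\right]$.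
   Context: $\mathcal H$ is an infinite-dimensional separable complex Hilbert space with a fixed orthonormal basis $\{e_k\}_{k\in\mathbb N}$. $\mathcal B(\mathcal H)$, $\mathcal K(\mathcal H)$ are the bounded and compact operators, $\|\cdot\|$ is the operator norm, and the superscripts $h$, $ah$ denote Hermitian and anti-Hermitian elements. $T_{jj}=\langle Te_j,e_j\rangle$. $\mathrm{Diag}(\{d_n\})$ is the diagonal operator with entries $d_n$; $\mathcal D(\mathcal K(\mathcal H)^{ah})$ and $\mathcal D(\mathcal B(\mathcal H)^{ah})$ are the sets of operators in $\mathcal K(\mathcal H)^{ah}$, $\mathcal B(\mathcal H)^{ah}$ that are diagonal in the fixed basis. $\|[Z]\|=\|[Z]\|_{\mathcal K(\mathcal H)^{ah}/\mathcal D(\mathcal K(\mathcal H)^{ah})}=\inf_{D\in\mathcal D(\mathcal K(\mathcal H)^{ah})}\|Z+D\|$. $\mathcal U_c(\mathcal H)=\{u\in\mathcal B(\mathcal H): u \text{ unitary},\ u-I\in\mathcal K(\mathcal H)\}$ and $\mathcal O_A=\{uAu^*:u\in\mathcal U_c(\mathcal H)\}$. For $c\in\mathcal O_A$, $(T\mathcal O_A)_c=\{Yc-cY:Y\in\mathcal K(\mathcal H)^{ah}\}$, with the Finsler norm $\|x\|_c=\inf\{\|Y\|:Y\in\mathcal K(\mathcal H)^{ah},\ Yc-cY=x\}$. A smooth curve is a $C^1$ curve with non-vanishing derivative; the length of a (piecewise) smooth curve $\eta:[a_1,a_2]\to\mathcal O_A$ is $\mathrm L(\eta)=\int_{a_1}^{a_2}\|\eta'(t)\|_{\eta(t)}\,dt$.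 That $\chi$ has minimal length means $\mathrm L(\chi|_{[0,t_0]})\le\mathrm L(\eta)$ for every smooth curve $\eta$ in $\mathcal O_A$ joining $b$ with $\chi(t_0)$. *)

(* Defs.v *)
From HB Require Import structures.
From mathcomp Require Import all_boot all_order all_algebra.
From mathcomp Require Export sesquilinear complex.
From mathcomp Require Import all_classical all_reals all_analysis.

Set Implicit Arguments.
Unset Strict Implicit.
Unset Printing Implicit Defensive.

Import Order.TTheory GRing.Theory Num.Def Num.Theory.
Import numFieldNormedType.Exports.

Local Open Scope classical_set_scope.
Local Open Scope complex_scope.
Local Open Scope ring_scope.

Section BoundedOperators.
Variables (R : realType) (H : normedModType R[i]).

Record bop := Bop {
  bop_fun :> H -> H ;
  bop_linear : linear bop_fun ;
  bop_continuous : continuous bop_fun }.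

Lemma bopP (S T : bop) : (forall x, S x = T x) <-> S = T.
Proof.
split=> [|->//]; case: S T => [f fl fc] [g gl gc] /= fg.
have {}fg : f = g by apply/funext.
by case: _ / fg gl gc => gl gc; congr Bop; exact: Prop_irrelevance.
Qed.

HB.instance Definition _ := gen_eqMixin bop.
HB.instance Definition _ := gen_choiceMixin bop.

Lemma bopD (T : bop) x y : T (x + y) = T x + T y.
Proof. by have := bop_linear T 1 x y; rewrite !scale1r. Qed.

Lemma bop0 (T : bop) : T 0 = 0.
Proof. by apply: (addrI (T 0)); rewrite -bopD !addr0. Qed.

Lemma bopZ (T : bop) a x : T (a *: x) = a *: T x.
Proof. by have := bop_linear T a x 0; rewrite bop0 !addr0. Qed.

Lemma zero_linear : linear (fun _ : H => 0 : H).
Proof. by move=> a x y; rewrite scaler0 addr0. Qed.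
Lemma zero_continuous : continuous (fun _ : H => 0 : H).
Proof. by move=> x; exact: cvg_cst. Qed.
Definition bop_zero := Bop zero_linear zero_continuous.

Lemma add_linear (S T : bop) : linear (fun x => S x + T x).
Proof. by move=> a x y; rewrite !(bopD, bopZ) scalerDr addrACA. Qed.
Lemma add_cont (S T : bop) : continuous (fun x => S x + T x).
Proof. by move=> x; apply: cvgD; exact: bop_continuous. Qed.
Definition bop_add S T := Bop (@add_linear S T) (@add_cont S T).

Lemma scale_linear a (T : bop) : linear (fun x => a *: T x).
Proof.
by move=> c x y; rewrite bopD bopZ scalerDr !scalerA mulrC.
Qed.
Lemma scale_cont a (T : bop) : continuous (fun x => a *: T x).
Proof. by move=> x; apply: cvgZr; exact: bop_continuous. Qed.
Definition bop_scale a T := Bop (@scale_linear a T) (@scale_cont a T).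

Lemma one_linear : linear (fun x : H => x). Proof. by []. Qed.
Lemma one_cont : continuous (fun x : H => x).
Proof. by move=> x; exact: cvg_id. Qed.
Definition bop_one := Bop one_linear one_cont.

Lemma mul_linear (S T : bop) : linear (fun x => S (T x)).
Proof. by move=> a x y; rewrite !(bopD, bopZ). Qed.
Lemma mul_cont (S T : bop) : continuous (fun x => S (T x)).
Proof.
by move=> x; apply: (@continuous_comp _ _ _ T S); exact: bop_continuous.
Qed.
Definition bop_mul S T := Bop (@mul_linear S T) (@mul_cont S T).

Lemma bop_addA : associative bop_add.
Proof. by move=> S T U; apply/bopP => x /=; rewrite addrA. Qed.
Lemma bop_addC : commutative bop_add.
Proof. by move=> S T; apply/bopP => x /=; rewrite addrC. Qed.
Lemma bop_add0 : left_id bop_zero bop_add.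
Proof. by move=> S; apply/bopP => x /=; rewrite add0r. Qed.
Lemma bop_addN : left_inverse bop_zero (bop_scale (-1)) bop_add.
Proof. by move=> S; apply/bopP => x /=; rewrite scaleN1r addNr. Qed.
HB.instance Definition _ :=
  GRing.isZmodule.Build bop bop_addA bop_addC bop_add0 bop_addN.

Lemma bop_mulA : associative bop_mul.
Proof. by move=> S T U; exact/bopP. Qed.
Lemma bop_mul1l : left_id bop_one bop_mul.
Proof. by move=> S; exact/bopP. Qed.
Lemma bop_mul1r : right_id bop_one bop_mul.
Proof. by move=> S; exact/bopP. Qed.
Lemma bop_mulDl : left_distributive bop_mul (@GRing.add bop).
Proof. by move=> S T U; exact/bopP. Qed.
Lemma bop_mulDr : right_distributive bop_mul (@GRing.add bop).
Proof. by move=> S T U; apply/bopP => x /=; rewrite bopD. Qed.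
HB.instance Definition _ := GRing.Zmodule_isPzRing.Build bop
  bop_mulA bop_mul1l bop_mul1r bop_mulDl bop_mulDr.

(* Only real scalars act through *:, so that bop can be a normed module over R
   (curves have a real parameter and the operator norm is real-valued); for
   l : R[i] the operator l I is bop_scale l 1. *)
Definition bop_rscale (r : R) (T : bop) : bop := bop_scale r%:C T.
Lemma bop_rscaleA a b T :
  bop_rscale a (bop_rscale b T) = bop_rscale (a * b) T.
Proof. by apply/bopP => x /=; rewrite scalerA rmorphM. Qed.
Lemma bop_rscale1 : left_id 1 bop_rscale.
Proof. by move=> T; apply/bopP => x /=; rewrite scale1r. Qed.
Lemma bop_rscaleDr : right_distributive bop_rscale +%R.
Proof. by move=> a S T; apply/bopP => x /=; rewrite scalerDr. Qed.
Lemma bop_rscaleDl T : {morph bop_rscale^~ T : a b / a + b}.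
Proof. by move=> a b; apply/bopP => x /=; rewrite rmorphD scalerDl. Qed.
HB.instance Definition _ := GRing.Zmodule_isLmodule.Build R bop
  bop_rscaleA bop_rscale1 bop_rscaleDr bop_rscaleDl.

(* The norm of H takes its values in R[i]; it is real, so Re loses nothing. *)
Definition rnorm (x : H) : R := complex.Re `|x|.

Lemma rnormE x : `|x| = (rnorm x)%:C.
Proof.
by have /complex_realP[r xr] : `|x| \is Num.real by []; rewrite /rnorm xr.
Qed.

Lemma rnorm_le x y : (rnorm x <= rnorm y) = (`|x| <= `|y|).
Proof. by rewrite !rnormE lecR. Qed.

Definition opnorm (T : bop) : R :=
  sup [set rnorm (T x) | x in [set x | `|x| <= 1]].

Lemma rnorm_ge0 x : 0 <= rnorm x.
Proof. by rewrite -lecR -rnormE normr_ge0. Qed.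

Lemma rnormZ a x : rnorm (a *: x) = complex.Re `|a| * rnorm x.
Proof.
have /complex_realP[r ar] : `|a| \is Num.real by [].
by apply/complexI; rewrite -rnormE normrZ rnormE ar -rmorphM.
Qed.

Lemma rnormD x y : rnorm (x + y) <= rnorm x + rnorm y.
Proof. by rewrite -lecR rmorphD /= -!rnormE ler_normD. Qed.

Lemma opnorm_has_sup (T : bop) :
  has_sup [set rnorm (T x) | x in [set x | `|x| <= 1]].
Proof.
split; first by exists (rnorm (T 0)); exists 0; rewrite //= normr0 ler01.
pose Tl := GRing.isLinear.Build _ _ _ _ (T : H -> H) (bop_linear T).
pose f : {linear H -> H} := HB.pack (T : H -> H) Tl.
have /linear_bounded_continuous/bounded_funP/(_ 1)[M TM] : continuous f.
  exact: bop_continuous.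
exists (complex.Re M) => _ [x /= x1 <-].
have := TM x x1; rewrite [X in X <= _](rnormE (T x)).
by case: (M) => a b; rewrite lecE => /andP[].
Qed.

Lemma opnorm_ub (T : bop) x : `|x| <= 1 -> rnorm (T x) <= opnorm T.
Proof.
by move=> x1; apply: ub_le_sup; [exact: (opnorm_has_sup T).2|exists x].
Qed.

Lemma opnorm_le (T : bop) (M : R) :
  (forall x, `|x| <= 1 -> rnorm (T x) <= M) -> opnorm T <= M.
Proof.
move=> TM; apply: ge_sup; first exact: (opnorm_has_sup T).1.
by move=> _ [x /= x1 <-]; exact: TM.
Qed.

Lemma opnormD (S T : bop) : opnorm (S + T) <= opnorm S + opnorm T.
Proof.
apply: opnorm_le => x x1; apply: (le_trans (rnormD _ _)).
by apply: lerD; exact: opnorm_ub.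
Qed.

Lemma opnorm_ge0 (T : bop) : 0 <= opnorm T.
Proof.
by apply: (le_trans (rnorm_ge0 (T 0))); apply: opnorm_ub; rewrite normr0 ler01.
Qed.

Lemma opnormZ_le (r : R) (T : bop) : opnorm (r *: T) <= `|r| * opnorm T.
Proof.
apply: opnorm_le => x x1; rewrite [_ x]/(r%:C *: T x) rnormZ.
by rewrite normc_def /= expr0n addr0 sqrtr_sqr ler_wpM2l// opnorm_ub.
Qed.

Lemma opnormZ (r : R) (T : bop) : opnorm (r *: T) = `|r| * opnorm T.
Proof.
apply/eqP; rewrite eq_le opnormZ_le /=.
have [->|r0] := eqVneq r 0; first by rewrite normr0 mul0r opnorm_ge0.
rewrite -[T in leLHS]scale1r -(mulVf r0) -scalerA.
by rewrite -ler_pdivlMl ?normr_gt0// -normfV opnormZ_le.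
Qed.

Lemma opnorm_eq0 (T : bop) : opnorm T = 0 -> T = 0.
Proof.
move=> T0; apply/bopP => x; have [->|x0] := eqVneq x 0; first by rewrite !bop0.
have nx0 : `|x| != 0 by rewrite normr_eq0.
have : rnorm (T (`|x|^-1 *: x)) <= 0.
  by rewrite -T0 opnorm_ub// normrZ normfV normr_id mulVf.
rewrite -lecR -rnormE normr_le0 bopZ scaler_eq0 invr_eq0 (negPf nx0) /=.
by move/eqP.
Qed.

HB.instance Definition _ :=
  Lmodule_isNormed.Build R bop opnormD opnormZ opnorm_eq0.

Definition compact_op (T : bop) := precompact (T @` [set x | `|x| <= 1]).

(* Norm-convergent exponential series; the convergence (B(H) is complete) is
   not built into the definition. *)
Definition bexp (T : bop) : bop :=
  lim (series (fun n => (n`!%:R : R)^-1 *: T ^+ n) @ \oo).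

End BoundedOperators.

Section HilbertSpace.
Variables (R : realType) (H : completeNormedModType R[i]).
Variable dot : {dot H for (@conjC R[i])}.

Definition orthonormal_basis (e : nat -> H) :=
  (forall i j, dot (e i) (e j) = (i == j)%:R) /\
  (forall x, series (fun k => dot x (e k) *: e k) @ \oo --> x).

(* The adjoint exists (Riesz) and is unique when dot induces the norm of H, so
   the default value is never used. *)
Definition adj (T : bop H) : bop H :=
  xget 0 [set S : bop H | forall x y, dot (T x) y = dot x (S y)].

Definition hermitian_op (T : bop H) := adj T = T.
Definition antihermitian_op (T : bop H) := adj T = - T.

Definition unitary_op (u : bop H) := adj u * u = 1 /\ u * adj u = 1.

Definition Uc : set (bop H) := [set u | unitary_op u /\ compact_op (u - 1)].

Definition unitary_orbit (A : bop H) : set (bop H) :=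
  [set u * A * adj u | u in Uc].

(* T = Diag(d); a bounded T is determined by its values on the basis *)
Definition is_Diag (e : nat -> H) (d : nat -> R[i]) (T : bop H) :=
  forall k, T (e k) = d k *: e k.

Definition diagonal_op e (T : bop H) := exists d, is_Diag e d T.

Definition entry (e : nat -> H) (T : bop H) j : R[i] := dot (T (e j)) (e j).

Definition Kah : set (bop H) := [set T | compact_op T /\ antihermitian_op T].
Definition DBah e : set (bop H) :=
  [set T | antihermitian_op T /\ diagonal_op e T].
Definition DKah e : set (bop H) := [set T | Kah T /\ diagonal_op e T].

Definition quotient_norm e (Z : bop H) : R :=
  inf [set `|Z + D| | D in DKah e].

(* +oo when x is not a tangent vector at c, so the length of a curve is defined
   without assuming that its velocity is tangent to the orbit. *)
Definition finsler_norm (c x : bop H) : \bar R :=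
  ereal_inf [set `|Y|%:E | Y in [set Y | Kah Y /\ Y * c - c * Y = x]].

(* Derivative relative to [a1, a2], hence one-sided at the endpoints. *)
Definition velocity (a1 a2 : R) (eta : R -> bop H) (t : R) : bop H :=
  lim (((s - t)^-1 *: (eta s - eta t)) @[s --> within `[a1, a2] t^']).

Definition smooth_curve (M : set (bop H)) (a1 a2 : R) (eta : R -> bop H) :=
  [/\ a1 < a2,
      forall t, t \in `[a1, a2] -> M (eta t),
      forall t, t \in `[a1, a2] ->
        cvg (((s - t)^-1 *: (eta s - eta t)) @[s --> within `[a1, a2] t^']),
      {within `[a1, a2], continuous (velocity a1 a2 eta)} &
      forall t, t \in `[a1, a2] -> velocity a1 a2 eta t != 0].

Definition curve_length (a1 a2 : R) (eta : R -> bop H) : \bar R :=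
  \int[lebesgue_measure]_(t in `[a1, a2])
    finsler_norm (eta t) (velocity a1 a2 eta t).

Definition minimal_length (M : set (bop H)) (b : bop H) (chi : R -> bop H)
    (t0 : R) :=
  forall (a1 a2 : R) (eta : R -> bop H), smooth_curve M a1 a2 eta ->
    eta a1 = b -> eta a2 = chi t0 ->
    (curve_length 0 t0 chi <= curve_length a1 a2 eta)%E.

End HilbertSpace.

(* Main.v *)
From HB Require Import structures.
Require Import Defs.
From mathcomp Require Import all_boot all_order all_algebra.
From mathcomp Require Import sesquilinear complex.
From mathcomp Require Import all_classical all_reals all_analysis.
From mathcomp Require finmap.
From mathcomp Require Import ring lra.
Import Order.TTheory GRing.Theory Num.Def Num.Theory.
Import numFieldNormedType.Exports.
Set Implicit Arguments.
Unset Strict Implicit.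
Unset Printing Implicit Defensive.
Local Open Scope classical_set_scope.
Local Open Scope complex_scope.
Local Open Scope ring_scope.

(** The curve chi is shown to be calibrated by a smooth function on the orbit.

    Put V = Z + D1 and v = |V| = |[Z]|. Since D1 - l I is diagonal with entries
    tending to 0, it is compact, so Y = V - l I is a compact anti-Hermitian
    operator in the class of Z. All lifts e^{tY} (Y + D) e^{-tY}, D compact
    diagonal, of the velocity of chi are admissible, so chi has speed at most v
    and L(chi) <= t0 v (chi_length_le). It remains to bound below by t0 v the
    length of an arbitrary curve eta from b to chi(t0).

    Truncating to corners shows that bounded diagonals do no better than compact
    ones (quotient_norm_le), so V cannot be shortened by any diagonal operator.
    By convexity (separation) this yields, for every tolerance, a finite family
    of unit vectors x_i, weights a_i^2 of total mass 1 and signs s_i = 1 or -1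
    such that V x_i is nearly i s_i v x_i, while the signed masses
    sum_i a_i^2 s_i |<x_i, e_j>|^2 nearly vanish for each small j, as does
    sum_i a_i^2 s_i (extremal_family). In other words the direct sum xi of the
    a_i x_i satisfies V^2 xi ~ - v^2 xi, and V xi is nearly orthogonal to D xi for
    every diagonal D.

    Let S be the closure of the vectors D xi, D diagonal, in the direct sum. For
    c = U b U* in the orbit the subspace U S depends only on c, because the
    stabilizer of b is diagonal. With zeta = e^{t0 Y} xi, consider the squared cosine f(c) of the angle between the
    unit vector zeta and U S. At c = chi(t0) the angle is 0; at c = b it is nearly
    t0 v <= pi/2, since e^{t0 Y} turns xi by the angle t0 v away from S. When c
    moves with velocity [X, c], f changes at rate 2 Re <P zeta, X zeta> up to sign,
    with P the projection on U S, and X zeta is orthogonal to zeta in real part;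
    Cauchy-Schwarz for P and for 1 - P then gives |f'| <= 2 |X| sqrt (f (1 - f)),
    that is: the angle changes at speed at most |X| (cform_derivative). Integrating,
    L(eta) >= t0 v (angle_length).

    The eigenvalue projections of c need not depend smoothly on c (0 is a limit of
    eigenvalues and may itself be one). So P is replaced by a combination of
    polynomials in c that form a partition of unity on the common spectrum of the
    orbit (spectral_partition); only 0 <= P <= 1 is used in the estimate, and
    polynomials of a C^1 curve are C^1, with [X, -] acting as a derivation. *)

(** * Complex scalars, the real part of the inner product, operator norm *)

Section ComplexScalars.
Variable R : realType.
Implicit Types z w : R[i].

(** The norm of R[i] takes its values in R[i]; this is the same number in R. *)
Definition cabs z : R := complex.Re `|z|.

Lemma cabsE z : `|z| = (cabs z)%:C.
Proof. by rewrite /cabs normc_def. Qed.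

Lemma cabs_ge0 z : 0 <= cabs z.
Proof. by rewrite -ler0c -cabsE. Qed.

Lemma sqr_cabs z : cabs z ^+ 2 = complex.Re z ^+ 2 + complex.Im z ^+ 2.
Proof.
by apply: complexI; rewrite rmorphXn /= -cabsE add_Re2_Im2.
Qed.

Lemma cabsM z w : cabs (z * w) = cabs z * cabs w.
Proof. by apply: complexI; rewrite -cabsE normrM !cabsE rmorphM. Qed.

Lemma cabs_real (r : R) : cabs r%:C = `|r|.
Proof. by rewrite /cabs normc_def /= expr0n addr0 sqrtr_sqr. Qed.

Lemma Re_conjE z : complex.Re (conjC z) = complex.Re z.
Proof. by case: z. Qed.
Lemma Im_conjE z : complex.Im (conjC z) = - complex.Im z.
Proof. by case: z. Qed.

Lemma conjC_real (r : R) : conjC (r%:C) = r%:C :> R[i].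
Proof. exact: conjc_real. Qed.

Lemma Re_add z w : complex.Re (z + w) = complex.Re z + complex.Re w.
Proof. by case: z w => [a b] [c d]. Qed.
Lemma Re_opp z : complex.Re (- z) = - complex.Re z.
Proof. by case: z. Qed.
Lemma Im_add z w : complex.Im (z + w) = complex.Im z + complex.Im w.
Proof. by case: z w => [a b] [c d]. Qed.
Lemma Im_opp z : complex.Im (- z) = - complex.Im z.
Proof. by case: z. Qed.
Lemma Re_mul z w : complex.Re (z * w) =
  complex.Re z * complex.Re w - complex.Im z * complex.Im w.
Proof. by case: z w => [a b] [c d]. Qed.
Lemma Im_mul z w : complex.Im (z * w) =
  complex.Re z * complex.Im w + complex.Im z * complex.Re w.
Proof. by case: z w => [a b] [c d]. Qed.
Lemma Re_sum I (r : seq I) (P : pred I) (F : I -> R[i]) :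
  complex.Re (\sum_(i <- r | P i) F i) = \sum_(i <- r | P i) complex.Re (F i).
Proof. by apply: (big_morph _ Re_add). Qed.
Lemma Im_sum I (r : seq I) (P : pred I) (F : I -> R[i]) :
  complex.Im (\sum_(i <- r | P i) F i) = \sum_(i <- r | P i) complex.Im (F i).
Proof. by apply: (big_morph _ Im_add). Qed.

Lemma complex_eq z w :
  complex.Re z = complex.Re w -> complex.Im z = complex.Im w -> z = w.
Proof. by case: z w => [a b] [c d] /= -> ->. Qed.

End ComplexScalars.

Section RealInnerProduct.
Variables (R : realType) (H : completeNormedModType R[i]).
Variable dot : {dot H for (@conjC R[i])}.
Hypothesis dot_norm : forall x : H, dot x x = `|x| ^+ 2.
Implicit Types (x y z : H) (T : bop H).

(** H as a real Hilbert space: dot is recovered from its real part by [Im_dot],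
    and anti-Hermitian operators are skew for it. *)
Definition redot x y : R := complex.Re (dot x y).
Local Notation ip := redot.

Lemma dotDl x y z : dot (x + y) z = dot x z + dot y z.
Proof. exact: linearDl. Qed.
Lemma dotDr x y z : dot z (x + y) = dot z x + dot z y.
Proof. exact: linearDr. Qed.
Lemma dotZl a x y : dot (a *: x) y = a * dot x y.
Proof. by rewrite linearZl_LR. Qed.
Lemma dotZr a x y : dot x (a *: y) = conjC a * dot x y.
Proof. by rewrite linearZr_LR. Qed.
Lemma dotC x y : dot x y = conjC (dot y x).
Proof. by rewrite hermC /= expr0 mul1r. Qed.
Lemma dot_suml I (r : seq I) (F : I -> H) y :
  dot (\sum_(i <- r) F i) y = \sum_(i <- r) dot (F i) y.
Proof. by rewrite linear_sumlz. Qed.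
Lemma dot_sumr I (r : seq I) (F : I -> H) y :
  dot y (\sum_(i <- r) F i) = \sum_(i <- r) dot y (F i).
Proof. by rewrite linear_sumr. Qed.

Lemma Im_dot x y : complex.Im (dot x y) = ip x ('i *: y).
Proof. by rewrite /redot dotZr Re_mul Re_conjE Im_conjE /= mul0r mulN1r opprK add0r. Qed.

Lemma ipC x y : ip x y = ip y x.
Proof. by rewrite /redot dotC Re_conjE. Qed.
Lemma ipDl x y z : ip (x + y) z = ip x z + ip y z.
Proof. by rewrite /redot dotDl Re_add. Qed.
Lemma ipDr x y z : ip z (x + y) = ip z x + ip z y.
Proof. by rewrite /redot dotDr Re_add. Qed.
Lemma ipNl x y : ip (- x) y = - ip x y.
Proof. by rewrite /redot linearNl Re_opp. Qed.
Lemma ipNr x y : ip y (- x) = - ip y x.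
Proof. by rewrite /redot linearNr Re_opp. Qed.
Lemma ipBl x y z : ip (x - y) z = ip x z - ip y z.
Proof. by rewrite ipDl ipNl. Qed.
Lemma ipBr x y z : ip z (x - y) = ip z x - ip z y.
Proof. by rewrite ipDr ipNr. Qed.
Lemma ipZl (a : R) x y : ip (a%:C *: x) y = a * ip x y.
Proof. by rewrite /redot dotZl Re_mul /= mul0r subr0. Qed.
Lemma ipZr (a : R) x y : ip x (a%:C *: y) = a * ip x y.
Proof. by rewrite ipC ipZl ipC. Qed.
Lemma ip_suml I (r : seq I) (F : I -> H) y :
  ip (\sum_(i <- r) F i) y = \sum_(i <- r) ip (F i) y.
Proof. by rewrite /redot dot_suml Re_sum. Qed.
Lemma ip_sumr I (r : seq I) (F : I -> H) y :
  ip y (\sum_(i <- r) F i) = \sum_(i <- r) ip y (F i).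
Proof. by rewrite /redot dot_sumr Re_sum. Qed.
Lemma ip0l x : ip 0 x = 0. Proof. by rewrite /redot linear0l. Qed.
Lemma ip_norm x : ip x x = rnorm x ^+ 2.
Proof. by rewrite /redot dot_norm rnormE -rmorphXn. Qed.
Lemma dot_rnorm x : dot x x = (rnorm x ^+ 2)%:C.
Proof. by rewrite dot_norm rnormE -rmorphXn. Qed.

Lemma ip_ge0 x : 0 <= ip x x.
Proof. by rewrite ip_norm sqr_ge0. Qed.

Lemma rnorm0 : rnorm (0 : H) = 0. Proof. by rewrite /rnorm normr0. Qed.
Lemma rnormN x : rnorm (- x) = rnorm x. Proof. by rewrite /rnorm normrN. Qed.
Lemma rnormB x y : rnorm (x - y) = rnorm (y - x).
Proof. by rewrite -rnormN opprB. Qed.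
Lemma rnorm_eq0 x : rnorm x = 0 -> x = 0.
Proof. by move=> x0; apply/eqP; rewrite -normr_eq0 rnormE x0. Qed.
Lemma cnormZ (a : R[i]) x : rnorm (a *: x) = cabs a * rnorm x.
Proof. exact: rnormZ. Qed.
Lemma rnormZr (a : R) x : rnorm (a%:C *: x) = `|a| * rnorm x.
Proof. by rewrite cnormZ cabs_real. Qed.

Lemma ip_eq x y : (forall z, ip x z = ip y z) -> x = y.
Proof.
move=> xy; apply/eqP; rewrite -subr_eq0; apply/eqP/rnorm_eq0.
by apply/eqP; rewrite -sqrf_eq0 -ip_norm ipBl xy subrr.
Qed.

End RealInnerProduct.

Section CauchySchwarz.
Variables (R : realType).

(** The discriminant inequality in the form in which Cauchy-Schwarz is deduced
    from the positivity of a quadratic form along a line. *)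
Lemma quadratic_ge0 (a b c : R) : (forall t : R, 0 <= a + 2 * t * b + t ^+ 2 * c) ->
  0 <= c -> b ^+ 2 <= a * c.
Proof.
move=> H c0; have [c0'|c0'] := eqVneq c 0.
  have [->|b0] := eqVneq b 0; first by rewrite expr0n c0' mulr0.
  have := H (- (a + 1) / (2 * b)); rewrite c0' mulr0 addr0.
  have -> : 2 * (- (a + 1) / (2 * b)) * b = - (a + 1) by field.
  lra.
have := H (- b / c).
have -> : a + 2 * (- b / c) * b + (- b / c) ^+ 2 * c = (a * c - b ^+ 2) / c by field.
by rewrite pmulr_lge0 ?invr_gt0 ?lt_def ?c0'// subr_ge0.
Qed.

End CauchySchwarz.

Section CauchySchwarzH.
Variables (R : realType) (H : completeNormedModType R[i]).
Variable dot : {dot H for (@conjC R[i])}.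
Hypothesis dot_norm : forall x : H, dot x x = `|x| ^+ 2.
Implicit Types (x y z : H) (T : bop H).
Local Notation ip := (redot dot).

Lemma ip_CS x y : `|ip x y| <= rnorm x * rnorm y.
Proof.
rewrite -(@ler_pXn2r _ 2)// ?nnegrE ?mulr_ge0 ?rnorm_ge0// real_normK ?num_real//.
rewrite exprMn -!(ip_norm dot_norm); apply: quadratic_ge0; last exact: ip_ge0.
move=> t; have := ip_ge0 dot_norm (x + t%:C *: y).
rewrite ipDl !ipDr !ipZl !ipZr (ipC dot y x).
congr (_ <= _); ring.
Qed.

Lemma dot_CS x y : cabs (dot x y) <= rnorm x * rnorm y.
Proof.
set w := dot x y; have [w0|w0] := eqVneq (cabs w) 0.
  by rewrite w0 mulr_ge0// rnorm_ge0.
have wp : 0 < cabs w by rewrite lt_def w0 cabs_ge0.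
have : `|ip x (w *: y)| <= rnorm x * rnorm (w *: y) by exact: ip_CS.
rewrite cnormZ /redot dotZr -/w mulrC -sqr_normc cabsE -rmorphXn /=.
rewrite ger0_norm ?exprn_ge0 ?cabs_ge0// expr2 mulrCA ler_pM2l//.
Qed.

Lemma opnorm_bound T x : rnorm (T x) <= `|T| * rnorm x.
Proof.
have [x0|x0] := eqVneq (rnorm x) 0.
  by rewrite (rnorm_eq0 x0) bop0 rnorm0 mulr0.
have xp : 0 < rnorm x by rewrite lt_def x0 rnorm_ge0.
have : rnorm (T ((rnorm x)^-1%:C *: x)) <= `|T|.
  apply: opnorm_ub.
  by rewrite rnormE rnormZr gtr0_norm ?invr_gt0// mulVf// lecR.
by rewrite bopZ rnormZr gtr0_norm ?invr_gt0// mulrC ler_pdivrMr.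
Qed.

Lemma opnorm_le_bound T (M : R) : 0 <= M ->
  (forall x, rnorm (T x) <= M * rnorm x) -> `|T| <= M.
Proof.
move=> M0 TM; apply: opnorm_le => x.
rewrite rnormE lecR => x1; apply: le_trans (TM x) _.
by rewrite -[leRHS]mulr1 ler_wpM2l.
Qed.

Lemma opnormM (S T : bop H) : `|S * T| <= `|S| * `|T|.
Proof.
apply: opnorm_le_bound; first by rewrite mulr_ge0.
move=> x; apply: le_trans (opnorm_bound S (T x)) _.
by rewrite -mulrA ler_wpM2l// opnorm_bound.
Qed.

Lemma opnormX T n : `|T ^+ n.+1| <= `|T| ^+ n.+1.
Proof.
elim: n => [|n IH]; first by rewrite !expr1.
by rewrite exprS [leRHS]exprS (le_trans (opnormM _ _))// ler_wpM2l.
Qed.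

Lemma opnorm1 : `|1 : bop H| <= 1.
Proof. by apply: opnorm_le_bound => // x; rewrite mul1r. Qed.

Lemma opnormXn T n : `|T ^+ n| <= `|T| ^+ n.
Proof. by case: n => [|n]; [rewrite !expr0 opnorm1|exact: opnormX]. Qed.

Lemma bopE_D (S T : bop H) x : (S + T) x = S x + T x. Proof. by []. Qed.
Lemma bopE_N (S : bop H) x : (- S) x = - S x. Proof. by rewrite -[RHS]scaleN1r. Qed.
Lemma bopE_B (S T : bop H) x : (S - T) x = S x - T x.
Proof. by rewrite bopE_D bopE_N. Qed.
Lemma bopE_M (S T : bop H) x : (S * T) x = S (T x). Proof. by []. Qed.
Lemma bopE_Z (r : R) (S : bop H) x : (r *: S) x = r%:C *: S x. Proof. by []. Qed.
Lemma bopE_1 x : (1 : bop H) x = x. Proof. by []. Qed.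
Lemma bopE_0 x : (0 : bop H) x = 0. Proof. by []. Qed.
Lemma bopE_sum I (r : seq I) (F : I -> bop H) x :
  (\sum_(i <- r) F i) x = \sum_(i <- r) F i x.
Proof.
by elim/big_rec2: _ => // i y S _ <-.
Qed.
Lemma bopE_S (a : R[i]) (S : bop H) x : bop_scale a S x = a *: S x. Proof. by []. Qed.
Definition bopE := (bopE_D, bopE_N, bopE_M, bopE_Z, bopE_1, bopE_0).

Lemma bop_sum (T : bop H) I (r : seq I) (F : I -> H) :
  T (\sum_(i <- r) F i) = \sum_(i <- r) T (F i).
Proof.
by elim/big_rec2: _ => [|i y z _ <-]; [exact: bop0|rewrite bopD].
Qed.
Lemma bopN (T : bop H) x : T (- x) = - T x.
Proof. by rewrite -scaleN1r bopZ scaleN1r. Qed.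
Lemma bopB (T : bop H) x y : T (x - y) = T x - T y.
Proof. by rewrite bopD bopN. Qed.

Lemma bop_scalerAl (r : R) (S T : bop H) : r *: (S * T) = (r *: S) * T.
Proof. exact/bopP. Qed.
Lemma bop_scalerAr (r : R) (S T : bop H) : r *: (S * T) = S * (r *: T).
Proof. by apply/bopP => x; rewrite !bopE bopZ. Qed.

(** In sigma form, since operators are defined from it. *)
Lemma bounded_bop (f : H -> H) (M : R) : linear f ->
  (forall x, rnorm (f x) <= M * rnorm x) -> {T : bop H | forall x, T x = f x}.
Proof.
move=> fl fM.
have fc : continuous f.
  move=> x; apply/cvgrPdist_lt => e; rewrite ltcE /= => /andP[/eqP ei er].
  have -> : e = (complex.Re e)%:C by apply: complex_eq.
  move: (complex.Re e) er => {ei} {}e e0.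
  have M0 : 0 < `|M| + 1 by rewrite ltr_wpDl.
  near=> y.
  have -> : f x - f y = f (x - y).
    by rewrite addrC -[- f y]scaleN1r -fl scaleN1r addrC.
  rewrite rnormE ltcR; apply: le_lt_trans (fM _) _.
  apply: (@le_lt_trans _ _ ((`|M| + 1) * rnorm (x - y))).
    by rewrite ler_wpM2r ?rnorm_ge0// (le_trans (ler_norm M))// lerDl.
  rewrite -ltr_pdivlMl// -ltcR -rnormE.
  near: y; apply: cvgr_dist_lt => //.
  by rewrite ltcR mulr_gt0// invr_gt0.
by exists (Bop fl fc).
Unshelve. all: by end_near. Qed.

End CauchySchwarzH.

(** * Adjoints and compactness *)

Section Adjoints.
Variables (R : realType) (H : completeNormedModType R[i]).
Variable dot : {dot H for (@conjC R[i])}.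
Hypothesis dot_norm : forall x : H, dot x x = `|x| ^+ 2.
Implicit Types (x y z : H) (S T : bop H).

Lemma dot_eq x y : (forall z, dot z x = dot z y) -> x = y.
Proof.
move=> xy; apply: (ip_eq dot_norm) => z.
by rewrite ![redot dot _ z]ipC /redot xy.
Qed.

Lemma adj_unique T S : (forall x y, dot (T x) y = dot x (S y)) -> adj dot T = S.
Proof.
move=> TS; apply/bopP => y; apply: dot_eq => x.
rewrite -TS; symmetry.
exact: (@xgetI _ 0 [set S : bop H | forall x y, dot (T x) y = dot x (S y)] S TS).
Qed.

(** The default value of adj is 0, so an operator with nonzero adj has an
    adjoint; this is how antihermP and unitaryP find one. *)
Lemma adjP_or0 T :
  (forall x y, dot (T x) y = dot x (adj dot T y)) \/ adj dot T = 0.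
Proof. by rewrite /adj; case: xgetP => [S _ TS|_]; [left => x y; exact: TS|right]. Qed.

(** If T had no adjoint, adj T = - T would read 0 = - T, and 0 has an adjoint. *)
Lemma antihermP T :
  antihermitian_op dot T <-> forall x y, dot (T x) y = - dot x (T y).
Proof.
split=> [TT x y|TT].
  case: (adjP_or0 T) => [->|T0]; first by rewrite TT bopE_N linearNr.
  have -> : T = 0 by apply/eqP; rewrite -oppr_eq0 -TT T0.
  by rewrite !bopE_0 linear0l linear0r oppr0.
by apply: adj_unique => x y; rewrite TT bopE_N linearNr.
Qed.

Lemma antiherm_ip T : antihermitian_op dot T -> forall x y, redot dot (T x) y = - redot dot x (T y).
Proof. by move=> /antihermP TT x y; rewrite /redot TT Re_opp. Qed.

(** In a nonzero space the default value 0 of adj cannot invert u. *)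
Lemma unitaryP (u : bop H) (x0 : H) : x0 != 0 -> unitary_op dot u ->
  [/\ forall x y, dot (u x) (u y) = dot x y,
      forall x, adj dot u (u x) = x & forall x, u (adj dot u x) = x].
Proof.
move=> x00 [u1 u2]; case: (adjP_or0 u) => [uP|u0]; last first.
  move: u1 => /(congr1 (fun S : bop H => S x0)); rewrite u0 mul0r !bopE.
  by move=> e; rewrite -e eqxx in x00.
have uu x : adj dot u (u x) = x by rewrite -bopE_M u1.
split=> // [x y|x]; first by rewrite uP uu.
by rewrite -bopE_M u2.
Qed.

End Adjoints.

Section Compactness.
Variables (R : realType) (H : completeNormedModType R[i]).
Implicit Types (x y z : H) (S T : bop H).

(** The image of the unit ball has finite nets. This is the form in which
    compactness is produced and used; H being complete, it is equivalent to
    [compact_op]. *)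
Definition tb_op T := forall eps : R, 0 < eps ->
  exists s : seq H, forall x, rnorm x <= 1 ->
    exists2 y, y \in s & rnorm (T x - y) < eps.

Lemma ball_rnorm x (eps : R) : ball x eps%:C = [set y | rnorm (x - y) < eps].
Proof.
rewrite -ball_normE; apply/seteqP; split=> y /=; by rewrite rnormE ltcR.
Qed.

Lemma complex_gt0 (e : R[i]) : 0 < e -> exists2 r : R, 0 < r & e = r%:C.
Proof.
rewrite ltcE /= => /andP[/eqP ei er]; exists (complex.Re e) => //.
exact: complex_eq.
Qed.

Lemma cvg_rnormP (T : Type) (F : set_system T) (FF : Filter F) (f : T -> H) l :
  f @ F --> l <-> forall eps : R, 0 < eps -> \forall t \near F, rnorm (l - f t) < eps.
Proof.
split=> [/cvgrPdist_lt fl e e0|fl].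
  have := fl e%:C; rewrite ltcR => /(_ e0).
  by apply: filterS => t; rewrite rnormE ltcR.
apply/cvgrPdist_lt => _ /complex_gt0[e e0 ->].
by apply: filterS (fl _ e0) => t; rewrite rnormE ltcR.
Qed.

Lemma rnorm_le1 x : (`|x| <= 1) = (rnorm x <= 1).
Proof. by rewrite rnormE lecR. Qed.

Lemma compact_tb T : compact_op T -> tb_op T.
Proof.
rewrite /compact_op precompactE compact_cover => cT e e0.
have [] := @cT H setT (fun y => ball y e%:C).
- by move=> y _; apply: ball_open; rewrite ltcR.
- move=> y yT; exists y => //; apply: ballxx; by rewrite ltcR.
move=> D _ TD; exists (finmap.enum_fset D) => x x1.
have : closure (T @` [set x | `|x| <= 1]) (T x).
  by apply: subset_closure; exists x => //=; rewrite rnorm_le1.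
move=> /TD[y /= yD]; rewrite ball_rnorm /= => yT.
by exists y => //; rewrite rnormB.
Qed.

(** An ultrafilter on the closure of a set with finite nets contains a ball of
    every radius, hence is Cauchy. *)
Lemma tb_compact T : tb_op T -> compact_op T.
Proof.
move=> tbT; rewrite /compact_op precompactE compact_ultra => F UF FK.
have Fc : cauchy F.
  apply/cauchy_exP => _ /complex_gt0[e e0 ->].
  have e20 : 0 < e / 2 by rewrite divr_gt0.
  have [s sT] := tbT _ e20.
  have : F (\bigcup_(y in [set` s]) ball y e%:C).
    apply: filterS FK => z zK.
    have : nbhs z (ball z (e / 2)%:C) by apply: nbhsx_ballx; rewrite ltcR.
    move=> /zK[_ [[x /= x1 <-]]]; rewrite ball_rnorm /= => zx.
    rewrite rnorm_le1 in x1; have [y ys xy] := sT _ x1.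
    exists y => //; rewrite ball_rnorm /= rnormB.
    rewrite [e]splitr -(subrK (T x) z) -addrA.
    by apply: le_lt_trans (rnormD _ _) _; rewrite ltrD.
  elim: s {sT} => [|y s IH].
    by rewrite set_nil bigcup_set0 => /filter_not_empty.
  move=> FU; have [Fy|FC] := in_ultra_setVsetC (ball y e%:C) UF; first by exists y.
  apply: IH; apply: filterS (filterI FC FU) => z [zy [w]].
  by rewrite /= inE => /orP[/eqP-> //|ws] wz; exists w.
have /cauchy_cvg Fl := Fc.
exists (lim F); split; last exact: Fl.
have : closed (closure (T @` [set x | `|x| <= 1])) by exact: closed_closure.
move=> /closed_cvg cl.
apply: (@cl H F _ id) => //.
Qed.

Lemma tb_opD S T : tb_op S -> tb_op T -> tb_op (S + T).
Proof.
move=> tS tT e e0; have e20 : 0 < e / 2 by rewrite divr_gt0.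
have [s1 s1S] := tS _ e20; have [s2 s2T] := tT _ e20.
exists [seq y + z | y <- s1, z <- s2] => x x1.
have [y ys ye] := s1S _ x1; have [z zs ze] := s2T _ x1.
exists (y + z); first by apply/allpairsP; exists (y, z).
rewrite bopE opprD addrACA [e]splitr; apply: le_lt_trans (rnormD _ _) _.
by rewrite ltrD.
Qed.

Lemma tb_opMl S T : tb_op T -> tb_op (S * T).
Proof.
move=> tT e e0; have M0 : 0 < `|S| + 1 by rewrite ltr_wpDl.
have [s sT] := tT (e / (`|S| + 1)) (divr_gt0 e0 M0).
exists (map S s) => x /sT[y ys xy]; exists (S y); first exact: map_f.
rewrite bopE -bopB; apply: le_lt_trans (opnorm_bound _ _) _.
apply: le_lt_trans (_ : _ <= (`|S| + 1) * rnorm (T x - y)) _.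
  by rewrite ler_wpM2r ?rnorm_ge0// lerDl.
by rewrite mulrC -ltr_pdivlMr.
Qed.

Lemma tb_opMr S T : tb_op T -> tb_op (T * S).
Proof.
move=> tT e e0; have M0 : 0 < `|S| + 1 by rewrite ltr_wpDl.
have [s sT] := tT (e / (`|S| + 1)) (divr_gt0 e0 M0).
exists [seq (`|S| + 1)%:C *: y | y <- s] => x x1.
have : rnorm ((`|S| + 1)^-1%:C *: S x) <= 1.
  rewrite rnormZr gtr0_norm ?invr_gt0// mulrC ler_pdivrMr// mul1r.
  apply: le_trans (opnorm_bound _ _) _.
  by rewrite -[leRHS]mulr1 ler_pM ?rnorm_ge0// lerDl.
move=> /sT[y ys xy]; exists ((`|S| + 1)%:C *: y); first exact: map_f.
have -> : (T * S) x - (`|S| + 1)%:C *: y =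
    (`|S| + 1)%:C *: (T ((`|S| + 1)^-1%:C *: S x) - y).
  by rewrite bopZ scalerBr scalerA -rmorphM /= mulfV ?scale1r// lt0r_neq0.
by rewrite rnormZr gtr0_norm// mulrC -ltr_pdivlMr.
Qed.

Lemma tb_opZ (a : R[i]) T : tb_op T -> tb_op (bop_scale a T).
Proof.
move=> tT; have -> : bop_scale a T = bop_scale a 1 * T by exact/bopP.
exact: tb_opMl.
Qed.

Lemma tb_opN T : tb_op T -> tb_op (- T).
Proof. exact: tb_opZ. Qed.

Lemma real_net (M eps : R) : 0 < eps ->
  exists s : seq R, forall r, `|r| <= M -> exists2 a, a \in s & `|r - a| < eps.
Proof.
move=> e0; pose K := (truncn (M / eps)).+1.
pose s := [seq eps * k%:R | k <- iota 0 K.+1] : seq R.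
exists (s ++ [seq - a | a <- s]) => r rM.
pose k := truncn (`|r| / eps).
have r0 : 0 <= `|r| / eps by rewrite divr_ge0// ltW.
have /andP[k1 k2] := truncn_itv r0.
have ks : eps * k%:R \in s.
  apply: (map_f (fun k => eps * k%:R)); rewrite mem_iota leq0n add0n ltnS /=.
  by apply/leqW/le_truncn; rewrite ler_pM2r// invr_gt0.
have re : `| `|r| - eps * k%:R| < eps.
  rewrite ler_pdivlMr// in k1; rewrite ltr_pdivrMr// -natr1 mulrDl mul1r in k2.
  by rewrite mulrC ger0_norm ?subr_ge0// ltrBlDl.
have [r0'|r0'] := leP 0 r.
  by exists (eps * k%:R); rewrite ?mem_cat ?ks//; move: re; rewrite (ger0_norm r0').
exists (- (eps * k%:R)); first by rewrite mem_cat; apply/orP; right; apply/mapP; exists (eps * k%:R).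
by move: re; rewrite (ltr0_norm r0') -opprD normrN opprK.
Qed.

(** The image of the ball is a bounded part of the complex line through v, so
    nets for the real and imaginary parts of the coefficient suffice. *)
Lemma rank1_tb (T : bop H) (c : H -> R[i]) (M : R) (v : H) :
  (forall x, rnorm x <= 1 -> cabs (c x) <= M) -> (forall x, T x = c x *: v) ->
  tb_op T.
Proof.
move=> cM Tv e e0; have V0 : 0 < rnorm v + 1 by rewrite ltr_wpDl// rnorm_ge0.
have d0 : 0 < e / (2 * (rnorm v + 1)) by rewrite divr_gt0// mulr_gt0.
have [s sP] := real_net M d0.
exists [seq (a +i* b) *: v | a <- s, b <- s] => x /cM cx.
have [a as' ca] : exists2 a, a \in s & `|complex.Re (c x) - a| < e / (2 * (rnorm v + 1)).
  apply: sP; apply: le_trans cx; rewrite -lecR -cabsE; exact: normc_ge_Re.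
have [b bs cb] : exists2 b, b \in s & `|complex.Im (c x) - b| < e / (2 * (rnorm v + 1)).
  apply: sP; apply: le_trans cx; rewrite -(@ler_pXn2r _ 2)// ?nnegrE ?cabs_ge0//.
  by rewrite sqr_cabs real_normK ?num_real// lerDr sqr_ge0.
exists ((a +i* b) *: v); first by apply/allpairsP; exists (a, b).
have -> : T x - (a +i* b) *: v =
   (complex.Re (c x) - a)%:C *: v + ('i * (complex.Im (c x) - b)%:C) *: v.
  rewrite Tv -scalerBl -scalerDl; congr (_ *: _).
  by apply: complex_eq; rewrite /= ?(Re_add,Im_add,Re_opp,Im_opp,Re_mul,Im_mul) /=; ring.
apply: le_lt_trans (rnormD _ _) _.
have i1 : cabs ('i : R[i]) = 1.
  by rewrite /cabs normc_def /= expr0n expr1n add0r sqrtr1.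
rewrite !cnormZ cabsM i1 mul1r !cabs_real -mulrDl.
apply: (@le_lt_trans _ _ ((`|complex.Re (c x) - a| + `|complex.Im (c x) - b|) * (rnorm v + 1))).
  by rewrite ler_wpM2l ?addr_ge0// lerDl.
rewrite -ltr_pdivlMr//.
have -> : e / (rnorm v + 1) = e / (2 * (rnorm v + 1)) + e / (2 * (rnorm v + 1)).
  by field; rewrite gt_eqF.
by rewrite ltrD.
Qed.

Lemma tb_op0 : tb_op (0 : bop H).
Proof.
by move=> e e0; exists [:: 0] => x _; exists 0; rewrite ?mem_head// bopE subr0 rnorm0.
Qed.

Lemma tb_op_lim T : (forall eps : R, 0 < eps -> exists2 S, tb_op S & `|T - S| <= eps) ->
  tb_op T.
Proof.
move=> lT e e0; have e20 : 0 < e / 2 by rewrite divr_gt0.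
have [S tS TS] := lT _ e20; have [s sS] := tS _ e20.
exists s => x x1; have [y ys xy] := sS _ x1; exists y => //.
have -> : T x - y = (T - S) x + (S x - y) by rewrite !bopE addrA subrK.
rewrite [e]splitr; apply: le_lt_trans (rnormD _ _) _; rewrite ler_ltD//.
apply: le_trans (opnorm_bound _ _) _; apply: le_trans TS.
by rewrite -[leRHS]mulr1 ler_wpM2l.
Qed.

End Compactness.

(** * Projections on the basis and diagonal operators *)

Section Basis.
Variables (R : realType) (H : completeNormedModType R[i]).
Variable dot : {dot H for (@conjC R[i])}.
Hypothesis dot_norm : forall x : H, dot x x = `|x| ^+ 2.
Variable e : nat -> H.
Hypothesis he : orthonormal_basis dot e.
Implicit Types (x y z : H) (S T : bop H).
Local Notation ip := (redot dot).

Lemma dot_ee i j : dot (e i) (e j) = (i == j)%:R.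
Proof. exact: he.1. Qed.

Lemma rnorm_e i : rnorm (e i) = 1.
Proof.
apply/eqP; rewrite -(@eqrXn2 _ 2)// ?rnorm_ge0// expr1n -(ip_norm dot_norm).
by rewrite /redot dot_ee eqxx.
Qed.

Lemma e_neq0 i : e i != 0.
Proof. by apply/eqP => e0; have := rnorm_e i; rewrite e0 rnorm0 => /eqP; rewrite eq_sym oner_eq0. Qed.

(* First as a function: boundedness is needed to make it an element of bop. *)
Let proj_fun n x := \sum_(k < n) dot x (e k) *: e k.

Lemma dot_proj_fun n x y : dot (proj_fun n x) y = dot x (proj_fun n y).
Proof.
rewrite dot_suml dot_sumr; apply: eq_bigr => k _.
by rewrite dotZl dotZr [in RHS]mulrC -dotC.
Qed.

Lemma proj_fun_e n k : proj_fun n (e k) = if (k < n)%N then e k else 0.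
Proof.
rewrite /proj_fun; case: ifP => kn.
  rewrite (bigD1 (Ordinal kn))//= dot_ee eqxx scale1r big1 ?addr0// => i ik.
  rewrite dot_ee (_ : _ == _ = false) ?scale0r//.
  by apply: contraNF ik => /eqP ki; apply/eqP/val_inj.
rewrite big1// => i _; rewrite dot_ee (_ : _ == _ = false) ?scale0r//.
by apply: contraFF kn => /eqP->.
Qed.

Lemma proj_fun_linear n : linear (proj_fun n).
Proof.
move=> a x y; rewrite scaler_sumr -big_split; apply: eq_bigr => k _ /=.
by rewrite dotDl dotZl scalerDl scalerA.
Qed.

Lemma proj_funK n x : proj_fun n (proj_fun n x) = proj_fun n x.
Proof.
apply: (dot_eq dot_norm) => z; rewrite -dot_proj_fun.
rewrite {1}/proj_fun dot_suml [in RHS]dot_sumr; apply: eq_bigr => k _.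
by rewrite dotZl -dot_proj_fun proj_fun_e ltn_ord dotZr mulrC -dotC mulrC.
Qed.

Lemma proj_fun_bound n x : rnorm (proj_fun n x) <= 1 * rnorm x.
Proof.
rewrite mul1r; have [->|p0] := eqVneq (rnorm (proj_fun n x)) 0.
  exact: rnorm_ge0.
have pp : 0 < rnorm (proj_fun n x) by rewrite lt_def p0 rnorm_ge0.
rewrite -(ler_pM2l pp) -expr2 -(ip_norm dot_norm) /redot dot_proj_fun.
rewrite -dot_proj_fun dot_proj_fun proj_funK.
by apply: le_trans (ler_norm _) _; rewrite mulrC; apply: (ip_CS dot_norm).
Qed.

(** Orthogonal projection onto the span of the first [n] basis vectors. *)
Definition Pr n : bop H :=
  projT1 (bounded_bop (@proj_fun_linear n) (proj_fun_bound n)).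

Lemma PrE n x : Pr n x = \sum_(k < n) dot x (e k) *: e k.
Proof. exact: (projT2 (bounded_bop (@proj_fun_linear n) (proj_fun_bound n))). Qed.

Lemma dot_Pr n x y : dot (Pr n x) y = dot x (Pr n y).
Proof. by rewrite !PrE; exact: dot_proj_fun. Qed.

Lemma Pr_e n k : Pr n (e k) = if (k < n)%N then e k else 0.
Proof. by rewrite PrE; exact: proj_fun_e. Qed.

Lemma PrK n x : Pr n (Pr n x) = Pr n x.
Proof. by rewrite (PrE n (Pr n x)) (PrE n x); exact: proj_funK. Qed.

Lemma rnorm_Pr n x : rnorm (Pr n x) <= rnorm x.
Proof. by rewrite PrE -[leRHS]mul1r; exact: proj_fun_bound. Qed.

Lemma opnorm_Pr n : `|Pr n| <= 1.
Proof. by apply: opnorm_le_bound => // x; rewrite mul1r rnorm_Pr. Qed.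

Lemma Pr_pythagoras n x : rnorm x ^+ 2 = rnorm (Pr n x) ^+ 2 + rnorm (x - Pr n x) ^+ 2.
Proof.
rewrite -!(ip_norm dot_norm) ipBl !ipBr.
have -> : ip (Pr n x) x = ip (Pr n x) (Pr n x).
  by rewrite /redot -dot_Pr PrK.
have -> : ip x (Pr n x) = ip (Pr n x) (Pr n x).
  by rewrite [RHS]/redot dot_Pr PrK.
ring.
Qed.

Lemma rnorm_PrC n x : rnorm (x - Pr n x) <= rnorm x.
Proof.
rewrite -(@ler_pXn2r _ 2)// ?nnegrE ?rnorm_ge0//.
by rewrite [leRHS](Pr_pythagoras n) lerDr sqr_ge0.
Qed.

Lemma sqr_rnorm_Pr n x : rnorm (Pr n x) ^+ 2 = \sum_(k < n) cabs (dot x (e k)) ^+ 2.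
Proof.
apply: complexI; rewrite -(dot_rnorm dot_norm) dot_Pr PrK PrE dot_sumr rmorph_sum /=.
apply: eq_bigr => k _; rewrite dotZr rmorphXn /= -cabsE.
by rewrite mulrC sqr_normc.
Qed.

Lemma Pr_cvg x (eps : R) : 0 < eps -> exists N, forall n, (N <= n)%N -> rnorm (x - Pr n x) < eps.
Proof.
move=> e0; have /cvg_rnormP/(_ _ e0) [N _ NP] := he.2 x.
by exists N => n /NP; rewrite /series /= big_mkord PrE.
Qed.

Lemma Pr_mono n m x : (n <= m)%N -> rnorm (x - Pr m x) <= rnorm (x - Pr n x).
Proof.
move=> nm.
rewrite -(@ler_pXn2r _ 2)// ?nnegrE ?rnorm_ge0//.
have := Pr_pythagoras n x; rewrite {1}(Pr_pythagoras m).
suff : rnorm (Pr n x) ^+ 2 <= rnorm (Pr m x) ^+ 2 by lra.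
rewrite !sqr_rnorm_Pr (big_ord_widen m (fun k => cabs (dot x (e k)) ^+ 2) nm).
rewrite [leRHS](bigID (fun k : 'I_m => (k < n)%N)) /= lerDl sumr_ge0// => k _.
exact: sqr_ge0.
Qed.

(** [1 - Pr n] tends to 0 at each point of a finite net of the image, and has
    norm at most 1. *)
Lemma compact_tail T (eps : R) : compact_op T -> 0 < eps ->
  exists N, forall n, (N <= n)%N -> `|(1 - Pr n) * T| <= eps.
Proof.
move=> /compact_tb tT e0; have e20 : 0 < eps / 2 by rewrite divr_gt0.
have [s sT] := tT _ e20.
have [N NP] : exists N, forall y, y \in s -> rnorm (y - Pr N y) < eps / 2.
  elim: s {sT} => [|y s [N NP]]; first by exists 0%N.
  have [M MP] := Pr_cvg y e20; exists (maxn N M) => z.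
  rewrite inE => /orP[/eqP->|zs]; first by apply: MP; rewrite leq_maxr.
  by apply: le_lt_trans (NP _ zs); apply: Pr_mono; rewrite leq_maxl.
exists N => n Nn; apply: opnorm_le => x; rewrite rnorm_le1 => x1.
have [y ys xy] := sT _ x1.
have -> : ((1 - Pr n) * T) x = (1 - Pr n) (T x - y) + (y - Pr n y).
  by rewrite bopB !bopE_B !bopE [RHS]subrK.
rewrite [eps]splitr; apply: le_trans (rnormD _ _) _; apply: lerD.
  rewrite bopE_B bopE; apply: le_trans (rnorm_PrC _ _) _; exact: ltW.
by apply: le_trans (Pr_mono _ Nn) _; apply/ltW/NP.
Qed.

Lemma Pr_tb n : tb_op (Pr n).
Proof.
elim: n => [|n IH].
  have -> : Pr 0 = 0 by apply/bopP => x; rewrite PrE big_ord0.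
  exact: tb_op0.
have -> : Pr n.+1 = Pr n + (Pr n.+1 - Pr n) by rewrite addrC subrK.
apply: tb_opD => //.
apply: (@rank1_tb _ _ _ (fun x => dot x (e n)) 1 (e n)) => x.
  by move=> x1; apply: le_trans (dot_CS dot_norm _ _) _; rewrite rnorm_e mulr1.
by rewrite bopE_B !PrE big_ord_recr /= addrAC subrr add0r.
Qed.

(** A norm limit of finite-rank operators is compact. *)
Lemma compact_of_tail T : (forall eps : R, 0 < eps ->
    exists n, `|T - Pr n * T| <= eps) -> compact_op T.
Proof.
move=> lT; apply/tb_compact/tb_op_lim => eps e0; have [n Tn] := lT _ e0.
by exists (Pr n * T) => //; apply: tb_opMr; exact: Pr_tb.
Qed.

Lemma compactD S T : compact_op S -> compact_op T -> compact_op (S + T).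
Proof. by move=> /compact_tb S0 /compact_tb T0; apply/tb_compact/tb_opD. Qed.
Lemma compactN T : compact_op T -> compact_op (- T).
Proof. by move=> /compact_tb T0; apply/tb_compact/tb_opN. Qed.
Lemma compactMl S T : compact_op T -> compact_op (S * T).
Proof. by move=> /compact_tb T0; apply/tb_compact/tb_opMl. Qed.
Lemma compactMr S T : compact_op T -> compact_op (T * S).
Proof. by move=> /compact_tb T0; apply/tb_compact/tb_opMr. Qed.

Lemma basis_ext x y : (forall k, dot x (e k) = dot y (e k)) -> x = y.
Proof.
move=> xy; apply/eqP; rewrite -subr_eq0; apply/eqP/rnorm_eq0/eqP.
rewrite eq_le rnorm_ge0 andbT; apply/ler_addgt0Pl => eps e0; rewrite addr0.
have [N /(_ _ (leqnn N))] := Pr_cvg (x - y) e0.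
rewrite PrE big1 ?subr0; first exact: ltW.
by move=> k _; rewrite dotDl linearNl xy subrr scale0r.
Qed.

Section Diagonal.
Variables (d : nat -> R[i]) (T : bop H).
Hypothesis Td : is_Diag e d T.

(** T is prescribed on the basis only; its action on coordinates follows by
    truncation and continuity. *)
Lemma dot_Diag x k : dot (T x) (e k) = d k * dot x (e k).
Proof.
apply/eqP; rewrite -subr_eq0; apply/eqP.
suff: cabs (dot (T x) (e k) - d k * dot x (e k)) <= 0.
  by move=> h; apply/eqP; rewrite -normr_eq0 cabsE (le_anti (introT andP (conj h (cabs_ge0 _)))).
apply/ler_addgt0Pl => eps e0; rewrite addr0.
pose C := `|T| + cabs (d k) + 1.
have C0 : 0 < C by rewrite ltr_wpDl// addr_ge0// cabs_ge0.
have [N NP] := Pr_cvg x (divr_gt0 e0 C0).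
pose n := maxn N k.+1; have := NP n (leq_maxl _ _); set y := x - Pr n x => yn.
have kn : (k < n)%N by rewrite leq_max ltnSn orbT.
have -> : dot (T x) (e k) - d k * dot x (e k) = dot (T y) (e k) - d k * dot y (e k).
  have -> : x = Pr n x + y by rewrite addrC subrK.
  rewrite bopD !dotDl mulrDr.
  suff -> : dot (T (Pr n x)) (e k) = d k * dot (Pr n x) (e k) by ring.
  rewrite PrE bop_sum !dot_suml mulr_sumr; apply: eq_bigr => i _.
  rewrite bopZ Td !dotZl dot_ee; have [->|] := eqVneq (i : nat) k; first ring.
  by rewrite !mulr0.
apply: le_trans (_ : cabs (dot (T y) (e k)) + cabs (d k * dot y (e k)) <= _).
  by rewrite -lecR rmorphD /= -!cabsE ler_normB.
rewrite cabsM; apply: le_trans (_ : C * rnorm y <= _); last first.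
  by rewrite mulrC -ler_pdivlMr// ltW.
rewrite /C 2!mulrDl mul1r -[leLHS]addr0 lerD ?rnorm_ge0// lerD//.
  by apply: le_trans (dot_CS dot_norm _ _) _; rewrite rnorm_e mulr1 opnorm_bound.
rewrite ler_wpM2l ?cabs_ge0//.
by apply: le_trans (dot_CS dot_norm _ _) _; rewrite rnorm_e mulr1.
Qed.

Lemma Diag_le n x (M : R) : (forall k, cabs (d k) <= M \/ (k < n)%N) -> 0 <= M ->
  rnorm (T x - Pr n (T x)) <= M * rnorm (x - Pr n x).
Proof.
move=> dM M0.
suff fin m : rnorm (Pr m (T x - Pr n (T x))) <= M * rnorm (x - Pr n x).
  apply/ler_addgt0Pl => eps e0.
  have [N /(_ _ (leqnn N)) NP] := Pr_cvg (T x - Pr n (T x)) e0.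
  apply: le_trans (_ : rnorm ((T x - Pr n (T x)) - Pr N (T x - Pr n (T x))) +
     rnorm (Pr N (T x - Pr n (T x))) <= _).
    by apply: le_trans (rnormD _ _); rewrite subrK.
  by rewrite lerD// ltW.
apply: le_trans (_ : M * rnorm (Pr m (x - Pr n x)) <= _); last first.
  by rewrite ler_wpM2l// rnorm_Pr.
rewrite -(@ler_pXn2r _ 2)// ?nnegrE ?mulr_ge0 ?rnorm_ge0//.
rewrite exprMn !sqr_rnorm_Pr mulr_sumr; apply: ler_sum => k _.
rewrite -exprMn ler_pXn2r// ?nnegrE ?mulr_ge0 ?cabs_ge0//.
rewrite !dotDl !linearNl /= !dot_Pr Pr_e; case: ifP => kn.
  by rewrite !subrr /cabs normr0 mulr0.
rewrite !linear0r !subr0 dot_Diag cabsM ler_wpM2r ?cabs_ge0//.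
by case: (dM k) => //; rewrite kn.
Qed.

End Diagonal.

(** Positive on each truncation, hence positive by continuity. *)
Lemma Diag_ge0 T (d : nat -> R) x : is_Diag e (fun k => (d k)%:C) T ->
  (forall k, 0 <= d k) -> 0 <= ip (T x) x.
Proof.
move=> Td d0.
suff fin n : 0 <= ip (T (Pr n x)) (Pr n x).
  apply/ler_addgt0Pl => eps e0.
  pose C := 2 * `|T| * (rnorm x + 1) + 1.
  have C0 : 0 < C by rewrite ltr_wpDl// mulr_ge0 ?mulr_ge0 ?addr_ge0 ?rnorm_ge0.
  have [n /(_ _ (leqnn n)) NP] := Pr_cvg x (divr_gt0 e0 C0).
  have := fin n; set y := Pr n x in NP *.
  have -> : ip (T x) x = ip (T y) y + (ip (T (x - y)) x + ip (T y) (x - y)).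
    by rewrite bopB !(ipBl, ipBr); ring.
  have h1 : `|ip (T (x - y)) x| <= `|T| * (rnorm x + 1) * rnorm (x - y).
    apply: le_trans (ip_CS dot_norm _ _) _.
    rewrite mulrAC; apply: ler_pM; rewrite ?rnorm_ge0//; last by rewrite lerDl.
    exact: opnorm_bound.
  have h2 : `|ip (T y) (x - y)| <= `|T| * (rnorm x + 1) * rnorm (x - y).
    apply: le_trans (ip_CS dot_norm _ _) _; rewrite ler_wpM2r ?rnorm_ge0//.
    apply: le_trans (opnorm_bound _ _) _; rewrite ler_wpM2l//.
    by apply: le_trans (rnorm_Pr _ _) _; rewrite lerDl.
  have h3 : C * rnorm (x - y) <= eps by rewrite mulrC -ler_pdivlMr// ltW.
  rewrite /C mulrDl mul1r -!mulrA in h3.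
  have := rnorm_ge0 (x - y).
  move: h1 h2; rewrite !ler_norml -!mulrA => /andP[h1 _] /andP[h2 _]; lra.
rewrite (PrE n) bop_sum ip_suml sumr_ge0// => k _.
rewrite bopZ Td scalerA mulrC -scalerA ipZl mulr_ge0// ip_sumr.
rewrite (bigD1 k)//= big1 => [|i ik]; first by rewrite addr0 ip_ge0.
rewrite /redot dotZl dotZr dot_ee (_ : _ == _ = false) ?mulr0//.
by apply: contraNF ik => /eqP ki; apply/eqP/val_inj.
Qed.

End Basis.

(** * Difference quotients of operator-valued curves *)

Lemma cvg_ext (I : Type) (U : topologicalType) (G : set_system I) (f g : I -> U) (l : U) :
  (forall s, f s = g s) -> f s @[s --> G] --> l -> g s @[s --> G] --> l.
Proof. by move=> /funext ->. Qed.

Lemma cvg_squeeze0 (R : realType) (I : Type) (G : set_system I) (GF : Filter G)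
    (V : normedModType R) (f : I -> V) (b : I -> R) l :
  (forall s, `|f s - l| <= b s) -> b s @[s --> G] --> (0 : R) -> f s @[s --> G] --> l.
Proof.
move=> fb b0; apply/cvgrPdist_lt => e e0; have := b0; move=> /cvgrPdist_lt /(_ e e0).
apply: filterS => s; rewrite sub0r normrN distrC => be.
by apply: le_lt_trans (fb s) _; apply: le_lt_trans (ler_norm _) be.
Qed.

Section DifferenceQuotients.
Variables (R : realType).

(** Derivatives are expressed by the limit of the difference quotient along a
    filter G: the velocity of a curve on a closed interval is such a limit along
    a filter that is one-sided at the endpoints, and the same rules serve the
    punctured neighbourhoods. *)
Definition quot (V : normedModType R) (F : R -> V) (t s : R) : V :=
  (s - t)^-1 *: (F s - F t).

Lemma cvg_dnbhs_shift (t : R) : (h + t) @[h --> 0^'] --> t^'.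
Proof.
move=> A At; have {}At : \forall s \near t, s != t -> A s := At.
change (\forall h \near (0 : R), h != 0 -> A (h + t)).
rewrite (near_shift 0 t) /= subr0 in At.
apply: filterS At => h hA h0; apply: hA.
by rewrite -subr_eq0 addrK.
Qed.

Lemma cvg_dnbhs_unshift (t : R) : (s - t) @[s --> t^'] --> 0^'.
Proof.
move=> A At; have {}At : \forall h \near (0 : R), h != 0 -> A h := At.
change (\forall s \near t, s != t -> A (s - t)).
rewrite (near_shift t 0) /= sub0r in At.
apply: filterS At => h hA h0; apply: hA.
by rewrite subr_eq0.
Qed.

Lemma quot_is_derive (V : normedModType R) (F : R -> V) (t : R) (L : V) :
  quot F t s @[s --> t^'] --> L -> is_derive t 1 F L.
Proof.
move=> FL.
have dF : h^-1 *: ((F \o shift t) (h *: (1 : R)) - F t) @[h --> 0^'] --> L.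
  have := cvg_comp _ _ (@cvg_dnbhs_shift t) FL.
  apply: cvg_trans; apply: near_eq_cvg; near=> h.
  by rewrite /quot /= addrK [h *: 1]mulr1.
split; first by apply/cvg_ex; exists L.
exact: (@cvg_lim _ (@norm_hausdorff _ V) _ _ _ _ _ dF).
Unshelve. all: by end_near. Qed.

Lemma is_derive_quot (V : normedModType R) (F : R -> V) (t : R) (L : V) :
  is_derive t 1 F L -> quot F t s @[s --> t^'] --> L.
Proof.
move=> [/cvg_ex[L' FL'] FL].
have L'L : L' = L.
  rewrite -FL; symmetry; exact: (@cvg_lim _ (@norm_hausdorff _ V) _ _ _ _ _ FL').
rewrite -L'L; have := cvg_comp _ _ (@cvg_dnbhs_unshift t) FL'.
apply: cvg_trans; apply: near_eq_cvg; near=> s.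
by rewrite /quot /= [_ *: 1]mulr1 subrK.
Unshelve. all: by end_near. Qed.

Section Rules.
Variables (t : R) (G : set_system R).
Hypothesis (GF : Filter G) (Gt : G `=>` nbhs t) (Gn : \forall s \near G, s != t).

Lemma quot_continuous (V : normedModType R) (F : R -> V) (L : V) :
  quot F t s @[s --> G] --> L -> F s @[s --> G] --> F t.
Proof.
move=> FL; apply/subr_cvg0.
have : (s - t) *: quot F t s @[s --> G] --> (0 : R) *: L.
  apply: cvgZ => //; rewrite -(subrr t); apply: cvgB; last exact: cvg_cst.
  exact: Gt.
rewrite scale0r; apply: cvg_trans; apply: near_eq_cvg.
near=> s; rewrite /quot scalerA mulfV ?scale1r// subr_eq0.
by near: s.
Unshelve. all: by end_near. Qed.

Lemma quot_cst (V : normedModType R) (c : V) : quot (fun _ => c) t s @[s --> G] --> (0 : V).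
Proof.
under eq_fun do rewrite /quot subrr scaler0.
exact: cvg_cst.
Qed.

Lemma quotD (V : normedModType R) (F F' : R -> V) (L L' : V) :
  quot F t s @[s --> G] --> L -> quot F' t s @[s --> G] --> L' ->
  quot (fun s => F s + F' s) t s @[s --> G] --> L + L'.
Proof.
move=> FL FL'; apply: cvg_ext (cvgD FL FL') => s.
by rewrite /quot -scalerDr opprD addrACA.
Qed.

Lemma quotZ (V : normedModType R) (c : R) (F : R -> V) (L : V) :
  quot F t s @[s --> G] --> L ->
  quot (fun s => c *: F s) t s @[s --> G] --> c *: L.
Proof.
move=> FL; apply: cvg_ext (@cvgZl_tmp _ _ _ _ GF c _ _ FL) => s.
by rewrite /quot -scalerBr !scalerA mulrC.
Qed.

Lemma quotZv (V : normedModType R) (c : V) (f : R -> R) (l : R) :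
  quot f t s @[s --> G] --> l ->
  quot (fun s => f s *: c) t s @[s --> G] --> l *: c.
Proof.
move=> FL; apply: cvg_ext (@cvgZr_tmp _ _ _ _ GF _ _ c FL) => s.
by rewrite /quot -scalerBl scalerA.
Qed.

End Rules.

(** A vector-valued curve with vanishing derivative is constant: the distance
    to a fixed value is a real function with vanishing derivative. *)
Lemma quot0_cst (V : normedModType R) (F : R -> V) :
  (forall t, quot F t s @[s --> t^'] --> (0 : V)) -> forall t u, F t = F u.
Proof.
move=> F0 t u; apply/eqP; rewrite -subr_eq0 -normr_eq0; apply/eqP.
have d0 (x : R) : is_derive x 1 (fun s => `|F s - F u| : R) 0.
  apply: quot_is_derive.
  have := cvg_norm (F0 x); rewrite normr0 => h; apply: (cvg_squeeze0 _ _ (h _)) => s.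
  rewrite subr0 /quot !normrZ ler_wpM2l//.
  apply: le_trans (ler_dist_dist _ _) _.
  by rewrite opprB addrA subrK.
by rewrite (is_derive_0_is_cst t u d0) subrr normr0.
Qed.

End DifferenceQuotients.

Section OperatorLimits.
Variables (R : realType) (H : completeNormedModType R[i]).
Variable dot : {dot H for (@conjC R[i])}.
Hypothesis dot_norm : forall x : H, dot x x = `|x| ^+ 2.
Implicit Types (x y z : H) (S T : bop H).
Local Notation ip := (redot dot).

Lemma cvg_bopM (I : Type) (G : set_system I) (GF : Filter G) (f g : I -> bop H) S T :
  f s @[s --> G] --> S -> g s @[s --> G] --> T -> f s * g s @[s --> G] --> S * T.
Proof.
move=> fS gT.
pose b s := `|f s - S| * `|g s - T| + `|f s - S| * `|T| + `|S| * `|g s - T| : R.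
apply: (@cvg_squeeze0 _ _ _ _ _ _ b) => [s|].
  have -> : f s * g s - S * T = (f s - S) * (g s - T) + (f s - S) * T + S * (g s - T).
    by rewrite -mulrDr subrK mulrBl mulrBr addrA subrK.
  rewrite /b; apply: le_trans (ler_normD _ _) _; rewrite lerD ?opnormM//.
  by apply: le_trans (ler_normD _ _) _; rewrite lerD ?opnormM.
have f0 : `|f s - S| @[s --> G] --> (0 : R).
  by have /subr_cvg0/cvg_norm := fS; rewrite normr0.
have g0 : `|g s - T| @[s --> G] --> (0 : R).
  by have /subr_cvg0/cvg_norm := gT; rewrite normr0.
have := cvgD (cvgD (cvgM f0 g0) (cvgM f0 (@cvg_cst _ `|T| _ G GF))) (cvgM (@cvg_cst _ `|S| _ G GF) g0).
rewrite !mul0r mulr0 !addr0 => h; exact: h.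
Qed.

Lemma quotM (t : R) (G : set_system R) (GF : Filter G) (Gt : G `=>` nbhs t)
    (Gn : \forall s \near G, s != t) (A B : R -> bop H) (A' B' : bop H) :
  quot A t s @[s --> G] --> A' -> quot B t s @[s --> G] --> B' ->
  quot (fun s => A s * B s) t s @[s --> G] --> A' * B t + A t * B'.
Proof.
move=> AA' BB'; have Bt := quot_continuous GF Gt Gn BB'.
apply: cvg_ext (cvgD (cvg_bopM GF AA' Bt) (cvg_bopM GF (@cvg_cst _ (A t) _ G GF) BB')) => s.
rewrite /quot -bop_scalerAl -bop_scalerAr -scalerDr; congr (_ *: _).
by rewrite mulrBl mulrBr addrA subrK.
Qed.

Lemma cvg_bop_ip (I : Type) (G : set_system I) (GF : Filter G) (f : I -> bop H) T x y :
  f s @[s --> G] --> T -> ip (f s x) y @[s --> G] --> ip (T x) y.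
Proof.
move=> fT; apply: (@cvg_squeeze0 _ _ _ _ R _ (fun s => `|f s - T| * rnorm x * rnorm y)) => [s|].
  rewrite -ipBl -bopE_B; apply: le_trans (ip_CS dot_norm _ _) _.
  by rewrite ler_wpM2r ?rnorm_ge0// opnorm_bound.
have f0 : `|f s - T| @[s --> G] --> (0 : R).
  by have /subr_cvg0/cvg_norm := fT; rewrite normr0.
have := cvgM (cvgM f0 (@cvg_cst _ (rnorm x) _ G GF)) (@cvg_cst _ (rnorm y) _ G GF).
rewrite !mul0r => h; exact: h.
Qed.

Lemma quot_ip (t : R) (G : set_system R) (GF : Filter G) (A : R -> bop H) (A' : bop H) x y :
  quot A t s @[s --> G] --> A' ->
  quot (fun s => ip (A s x) y) t s @[s --> G] --> ip (A' x) y.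
Proof.
move=> AA'; apply: cvg_ext (@cvg_bop_ip _ _ GF _ _ x y AA') => s.
by rewrite /quot bopE_Z bopE_B ipZl ipBl.
Qed.

End OperatorLimits.

(** * Completeness and the exponential series *)

Section Completeness.
Variables (R : realType) (H : completeNormedModType R[i]).
Implicit Types (x y z : H) (S T : bop H).

(** Pointwise limits exist by completeness of H; the Cauchy bounds are uniform on
    the unit ball and pass to the limit. *)
Lemma bop_complete (F : set_system (bop H)) : ProperFilter F -> cauchy F -> cvg F.
Proof.
move=> PF /cauchyP Fc.
have near_x (eps : R) : 0 < eps -> exists T0 : bop H,
    \forall T \near F, forall x, rnorm ((T : bop H) x - T0 x) <= eps * rnorm x.
  move=> /Fc[T0 FT0]; exists T0; apply: filterS FT0 => T.
  rewrite -ball_normE /= => T0T x; rewrite rnormB -bopE_B.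
  by apply: le_trans (opnorm_bound _ _) _; rewrite ler_wpM2r ?rnorm_ge0// ltW.
pose L x := lim ((fun T : bop H => T x) @ F).
have FL x : (fun T : bop H => T x) @ F --> L x.
  have : cauchy ((fun T : bop H => T x) @ F).
    apply/cauchy_exP => _ /complex_gt0[eps e0 ->].
    have x1 : 0 < rnorm x + 1 by rewrite ltr_wpDl// rnorm_ge0.
    have [T0 hT] := near_x _ (divr_gt0 e0 x1).
    exists (T0 x); rewrite ball_rnorm; apply: filterS hT => T /= /(_ x).
    rewrite rnormB => /le_lt_trans; apply.
    by rewrite mulrAC ltr_pdivrMr// ltr_pM2l// ltrDl.
  by move/cauchy_cvg.
have approx eps T0 : (\forall T \near F, forall x, rnorm ((T : bop H) x - T0 x) <= eps * rnorm x) ->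
    forall x, rnorm (L x - T0 x) <= eps * rnorm x.
  move=> hT x; apply/ler_addgt0Pl => d d0.
  have /cvg_rnormP/(_ _ d0) FLx := FL x.
  have [T [h1 h2]] : exists T : bop H, rnorm (L x - T x) < d /\
      rnorm (T x - T0 x) <= eps * rnorm x.
    have FF : F (fun T : bop H => rnorm (L x - T x) < d /\
      rnorm (T x - T0 x) <= eps * rnorm x).
      by apply: filterS (filterI FLx hT) => T [? /(_ x)].
    by have [T] := filter_ex FF; exists T.
  rewrite -(subrK (T x) (L x)) -addrA.
  by apply: le_trans (rnormD _ _) _; rewrite lerD// ltW.
have Ll : linear L.
  move=> a x y; apply: (@cvg_lim _ (@norm_hausdorff _ H)).
  have -> : (fun T : bop H => T (a *: x + y)) = (fun T : bop H => a *: T x + T y).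
    by apply/funext => T; rewrite bopD bopZ.
  apply: cvgD; last exact: FL.
  by apply: cvgZ; [exact: cvg_cst|exact: FL].
have [T1 hT1] := near_x 1 ltr01.
have Lb x : rnorm (L x) <= (1 + `|T1|) * rnorm x.
  rewrite -(subrK (T1 x) (L x)) mulrDl; apply: le_trans (rnormD _ _) _.
  by apply: lerD; [exact: (approx _ _ hT1)|exact: opnorm_bound].
have [S SL] := bounded_bop Ll Lb.
apply/cvg_ex; exists S; apply/cvgrPdist_le => eps e0.
have e20 : 0 < eps / 2 by rewrite divr_gt0.
have [T0 hT] := near_x _ e20.
have hL := approx _ _ hT.
apply: filterS hT => T hT; apply: opnorm_le_bound => [|x]; first exact: ltW.
rewrite bopE_B SL -(subrK (T0 x) (L x)) -addrA [eps]splitr mulrDl.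
apply: le_trans (rnormD _ _) _; apply: lerD; first exact: hL.
rewrite rnormB; exact: hT.
Qed.

HB.instance Definition _ := Uniform_isComplete.Build (bop H) bop_complete.

End Completeness.

Lemma taylor_pow_step (R : comNzRingType) (t h : R) n : (t + h) ^+ n.+2 - t ^+ n.+2 - h * t ^+ n.+1 *+ n.+2 =
  (t + h) * ((t + h) ^+ n.+1 - t ^+ n.+1 - h * t ^+ n *+ n.+1) + h ^+ 2 * t ^+ n *+ n.+1.
Proof.
have [N E] : exists N : R, forall x, x *+ n.+1 = x * N.
  by exists n.+1%:R => x; rewrite mulr_natr.
rewrite [_ *+ n.+2]mulrSr !E !exprS; ring.
Qed.

Section Exponential.
Variables (R : realType) (H : completeNormedModType R[i]).
Variable dot : {dot H for (@conjC R[i])}.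
Hypothesis dot_norm : forall x : H, dot x x = `|x| ^+ 2.
Implicit Types (x y z : H) (S T Y : bop H).
Local Notation ip := (redot dot).

(** Partial sums over ordinals, for which shifting the index is simplest. *)
Definition bexp_sum Y n : bop H := \sum_(k < n) (k`!%:R : R)^-1 *: Y ^+ k.

Lemma bexp_cvg Y : bexp_sum Y n @[n --> \oo] --> bexp Y.
Proof.
have -> : bexp_sum Y = series (fun n => (n`!%:R : R)^-1 *: Y ^+ n).
  by apply/funext => n; rewrite /series /= big_mkord.
apply: (@normed_cvg R (bop H : completeNormedModType R)).
apply: series_le_cvg (is_cvg_series_exp_coeff `|Y|) => n.
- exact: normr_ge0.
- exact: exp_coeff_ge0.
- rewrite /exp_coeff /= normrZ ger0_norm ?invr_ge0// mulrC.
  by rewrite ler_wpM2r ?invr_ge0// opnormXn.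
Qed.

Lemma bop_expZ (r : R) Y n : (r *: Y) ^+ n = r ^+ n *: Y ^+ n.
Proof.
elim: n => [|n IH]; first by rewrite !expr0 scale1r.
by rewrite !exprS IH -bop_scalerAl -bop_scalerAr scalerA.
Qed.

Definition expR_sum (a : R) n : R := \sum_(k < n) (k`!%:R : R)^-1 * a ^+ k.

Lemma expR_sum_cvg (a : R) : expR_sum a n @[n --> \oo] --> expR a.
Proof.
have -> : expR_sum a = series (exp_coeff a).
  apply/funext => n; rewrite /series /= big_mkord; apply: eq_bigr => k _.
  by rewrite /exp_coeff /= mulrC.
exact: is_cvg_series_exp_coeff.
Qed.

(** The Taylor remainder of (t + h)^(n+1) is a polynomial in t and h with
    nonnegative coefficients, so it is dominated by its value at |t|, |h|. *)
Lemma taylor_pow (t h : R) n :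
  `|(t + h) ^+ n.+1 - t ^+ n.+1 - h * t ^+ n *+ n.+1| <=
  (`|t| + `|h|) ^+ n.+1 - `|t| ^+ n.+1 - `|h| * `|t| ^+ n *+ n.+1.
Proof.
elim: n => [|n IH].
  rewrite !expr1 !expr0 !mulr1 !mulr1n.
  have -> : t + h - t - h = 0 by ring.
  have -> : `|t| + `|h| - `|t| - `|h| = 0 by ring.
  by rewrite normr0.
rewrite !taylor_pow_step.
apply: le_trans (ler_normD _ _) _; apply: lerD.
  by rewrite normrM ler_pM// ler_normD.
by rewrite normrMn normrM !normrX.
Qed.

(** The remainder of the operator series is dominated by that of the real
    exponential, whose differentiability is known. *)
Lemma bexp_sum_taylor Y (t h : R) n :
  `|bexp_sum ((t + h) *: Y) n.+1 - bexp_sum (t *: Y) n.+1 - h *: (Y * bexp_sum (t *: Y) n)| <=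
  expR_sum ((`|t| + `|h|) * `|Y|) n.+1 - expR_sum (`|t| * `|Y|) n.+1
    - `|h| * (`|Y| * expR_sum (`|t| * `|Y|) n).
Proof.
have -> : bexp_sum ((t + h) *: Y) n.+1 - bexp_sum (t *: Y) n.+1 - h *: (Y * bexp_sum (t *: Y) n)
  = \sum_(k < n) ((k.+1)`!%:R : R)^-1 *: (((t + h) ^+ k.+1 - t ^+ k.+1 - h * t ^+ k *+ k.+1) *: Y ^+ k.+1).
  rewrite /bexp_sum !big_ord_recl !expr0 opprD addrACA subrr add0r.
  rewrite mulr_sumr scaler_sumr -!sumrB; apply: eq_bigr => k _.
  rewrite /bump /= ?add1n !bop_expZ !scalerBl !scalerBr; congr (_ - _).
  rewrite -bop_scalerAr -bop_scalerAr -exprS !scalerA; congr (_ *: _).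
  rewrite factS natrM -mulr_natr invfM.
  by field; rewrite nat1r !pnatr_eq0 -lt0n fact_gt0.
have -> : expR_sum ((`|t| + `|h|) * `|Y|) n.+1 - expR_sum (`|t| * `|Y|) n.+1
    - `|h| * (`|Y| * expR_sum (`|t| * `|Y|) n)
  = \sum_(k < n) ((k.+1)`!%:R : R)^-1 * (((`|t| + `|h|) ^+ k.+1 - `|t| ^+ k.+1 - `|h| * `|t| ^+ k *+ k.+1) * `|Y| ^+ k.+1).
  rewrite /expR_sum !big_ord_recl !expr0 opprD addrACA subrr add0r.
  rewrite !mulr_sumr -!sumrB; apply: eq_bigr => k _.
  rewrite /bump /= ?add1n !exprMn.
  rewrite factS natrM -[(`|h| * _) *+ _]mulr_natr invfM [`|Y| ^+ k.+1]exprS.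
  by field; rewrite nat1r !pnatr_eq0 -lt0n fact_gt0.
apply: le_trans (ler_norm_sum _ _ _) _; apply: ler_sum => k _.
rewrite !normrZ ger0_norm ?invr_ge0// ler_wpM2l ?invr_ge0//.
by rewrite ler_pM// ?taylor_pow// opnormX.
Qed.

End Exponential.
Arguments bexp_cvg {R H} Y.
Arguments expR_sum_cvg {R} a.

(** * The exponential as a one-parameter group *)

Section ExponentialCurves.
Variables (R : realType) (H : completeNormedModType R[i]).
Variable dot : {dot H for (@conjC R[i])}.
Hypothesis dot_norm : forall x : H, dot x x = `|x| ^+ 2.
Implicit Types (x y z : H) (S T Y : bop H).
Local Notation ip := (redot dot).

Lemma cvg_le (u v : nat -> R) (a b : R) :
  (forall n, u n <= v n) -> u n @[n --> \oo] --> a -> v n @[n --> \oo] --> b -> a <= b.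
Proof.
move=> uv ua vb; rewrite -subr_ge0.
apply: (cvgr_to_ge (cvgB vb ua)); apply: nearW => n.
by rewrite /= subr_ge0.
Qed.

Lemma bexp_taylor Y (t h : R) :
  `|bexp ((t + h) *: Y) - bexp (t *: Y) - h *: (Y * bexp (t *: Y))| <=
  expR ((`|t| + `|h|) * `|Y|) - expR (`|t| * `|Y|) - `|h| * (`|Y| * expR (`|t| * `|Y|)).
Proof.
apply: (cvg_le (bexp_sum_taylor Y t h)).
  apply: cvg_norm; apply: cvgB; first apply: cvgB.
  - by have := bexp_cvg ((t + h) *: Y); rewrite -cvg_shiftS.
  - by have := bexp_cvg (t *: Y); rewrite -cvg_shiftS.
  - apply: cvgZl_tmp; apply: cvg_bopM; [exact: cvg_cst|exact: bexp_cvg].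
apply: cvgB; first apply: cvgB.
- by have := expR_sum_cvg ((`|t| + `|h|) * `|Y|); rewrite -cvg_shiftS.
- by have := expR_sum_cvg (`|t| * `|Y|); rewrite -cvg_shiftS.
- apply: cvgM; first exact: cvg_cst.
  by apply: cvgM; [exact: cvg_cst|exact: expR_sum_cvg].
Qed.

Lemma bexp_taylor2 Y (t h : R) : `|h| * `|Y| <= 1 / 2 ->
  `|bexp ((t + h) *: Y) - bexp (t *: Y) - h *: (Y * bexp (t *: Y))| <=
  2 * expR (`|t| * `|Y|) * `|Y| ^+ 2 * `|h| ^+ 2.
Proof.
move=> hY; apply: le_trans (bexp_taylor Y t h) _.
rewrite mulrDl expRD; set E := expR _; set k := `|h| * `|Y| in hY *.
have E0 : 0 <= E by exact: expR_ge0.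
have k0 : 0 <= k by rewrite mulr_ge0.
have ek : expR k * (1 - k) <= 1.
  apply: le_trans (ler_wpM2l (expR_ge0 k) (expR_ge1Dx (- k))) _.
  by rewrite -expRD subrr expR0.
have ek1 : 1 + k <= expR k by exact: expR_ge1Dx.
have ek2 : expR k <= 2 by nra.
have : expR k - 1 - k <= 2 * k ^+ 2 by nra.
move=> /(ler_wpM2l E0); rewrite /k; congr (_ <= _); ring.
Qed.

Lemma quot_bexp Y (t : R) :
  quot (fun s => bexp (s *: Y)) t s @[s --> t^'] --> Y * bexp (t *: Y).
Proof.
apply/cvgrPdist_le => eps e0.
pose C := 2 * expR (`|t| * `|Y|) * `|Y| ^+ 2 + 1.
have C0 : 0 < C by rewrite ltr_wpDl// !mulr_ge0// expR_ge0.
have Y0 : 0 < `|Y| + 1 by rewrite ltr_wpDl.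
have d1 : 0 < (1 / 2) / (`|Y| + 1) by rewrite divr_gt0.
have d2 : 0 < eps / C by rewrite divr_gt0.
near=> s.
have st : s != t by near: s; exact: nbhs_dnbhs_neq.
have st0 : 0 < `|s - t| by rewrite normr_gt0 subr_eq0.
have h1 : `|s - t| < (1 / 2) / (`|Y| + 1).
  rewrite distrC; near: s; apply: nbhs_dnbhs.
  by apply: (@cvgr_dist_lt _ _ _ (nbhs t) _ id t) => //; exact: cvg_id.
have h2 : `|s - t| < eps / C.
  rewrite distrC; near: s; apply: nbhs_dnbhs.
  by apply: (@cvgr_dist_lt _ _ _ (nbhs t) _ id t) => //; exact: cvg_id.
have hY : `|s - t| * `|Y| <= 1 / 2.
  move: h1; rewrite ltr_pdivlMr// mulrDr mulr1 => h1; lra.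
have := bexp_taylor2 t hY; rewrite (_ : t + (s - t) = s) => [hB|]; last first.
  by rewrite addrC subrK.
rewrite distrC.
have -> : quot (fun s => bexp (s *: Y)) t s - Y * bexp (t *: Y) =
  (s - t)^-1 *: (bexp (s *: Y) - bexp (t *: Y) - (s - t) *: (Y * bexp (t *: Y))).
  by rewrite /quot [in RHS]scalerBr scalerA mulVf ?scale1r// subr_eq0.
rewrite normrZ normfV mulrC ler_pdivrMr//.
apply: le_trans hB _; rewrite expr2 mulrA ler_wpM2r//.
apply: le_trans (_ : C * `|s - t| <= _).
  by rewrite ler_wpM2r// lerDl.
by rewrite mulrC -ler_pdivlMr// ltW.
Unshelve. all: by end_near. Qed.

Lemma bexp_comm_gen Y T : T * Y = Y * T -> T * bexp Y = bexp Y * T.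
Proof.
move=> TY.
have hl : T * bexp_sum Y n @[n --> \oo] --> T * bexp Y.
  by apply: cvg_bopM; [exact: cvg_cst|exact: bexp_cvg].
have hr : bexp_sum Y n * T @[n --> \oo] --> bexp Y * T.
  by apply: cvg_bopM; [exact: bexp_cvg|exact: cvg_cst].
have TX n : T * Y ^+ n = Y ^+ n * T.
  elim: n => [|n IH]; first by rewrite !expr0 mulr1 mul1r.
  by rewrite exprS mulrA TY -mulrA IH mulrA.
apply: (@cvg_unique _ (@norm_hausdorff _ (bop H)) _ _ _ _ hl).
apply: cvg_ext hr => n; rewrite /bexp_sum mulr_suml mulr_sumr.
by apply: eq_bigr => k _; rewrite -bop_scalerAl -bop_scalerAr TX.
Qed.

Lemma bexp_comm Y T (t : R) : T * Y = Y * T -> T * bexp (t *: Y) = bexp (t *: Y) * T.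
Proof.
by move=> TY; apply: bexp_comm_gen; rewrite -bop_scalerAl -bop_scalerAr TY.
Qed.

Lemma bexp0 : bexp (0 : bop H) = 1.
Proof.
have h1 : bexp_sum (0 : bop H) n @[n --> \oo] --> (1 : bop H).
  rewrite -cvg_shiftS; apply: cvg_ext (@cvg_cst _ (1 : bop H) _ \oo _) => n /=.
  rewrite /bexp_sum big_ord_recl /= expr0 fact0 invr1 scale1r big1 ?addr0// => k _.
  by rewrite exprS mul0r scaler0.
exact: (@cvg_unique _ (@norm_hausdorff _ (bop H)) _ _ _ _ (bexp_cvg 0) h1).
Qed.

(** The product has derivative 0 and value 1 at 0. *)
Lemma bexpN Y (t : R) : bexp (- (t *: Y)) * bexp (t *: Y) = 1.
Proof.
pose F (s : R) := bexp (s *: (- Y)) * bexp (s *: Y).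
have -> : bexp (- (t *: Y)) * bexp (t *: Y) = F t by rewrite /F scalerN.
have <- : F 0 = 1 by rewrite /F !scale0r bexp0 mulr1.
apply: quot0_cst => s.
have Gn : \forall u \near s^', u != s by exact: nbhs_dnbhs_neq.
have := quotM _ (@nbhs_dnbhs R s) Gn (@quot_bexp (- Y) s) (@quot_bexp Y s).
rewrite mulrA -(@bexp_comm (- Y) Y) ?mulrN ?mulNr// addNr.
exact.
Qed.

Lemma bexpNr Y (t : R) : bexp (t *: Y) * bexp (- (t *: Y)) = 1.
Proof. by have := bexpN (- Y) t; rewrite scalerN opprK. Qed.

(** The partial sums satisfy it exactly, and both sides are continuous. *)
Lemma bexp_adj Y x y : (forall x y, ip (Y x) y = - ip x (Y y)) ->
  ip (bexp Y x) y = ip x (bexp (- Y) y).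
Proof.
move=> YA.
have hl := cvg_bop_ip dot_norm _ (bexp_cvg Y).
have hr := cvg_bop_ip dot_norm _ (bexp_cvg (- Y)).
have YX n u w : ip ((Y ^+ n) u) w = ip u (((- Y) ^+ n) w).
  elim: n u w => [//|n IH] u w.
  rewrite exprSr bopE_M IH [in RHS]exprS bopE_M bopE_N ipNr.
  by rewrite YA.
apply: (@cvg_unique _ (@Rhausdorff R) _ _ _ _ (hl _ x y)).
rewrite ipC; apply: cvg_ext (hr _ y x) => n.
rewrite /bexp_sum !bopE_sum !ip_suml; apply: eq_bigr => k _.
by rewrite !bopE_Z !ipZl YX [in RHS]ipC.
Qed.

End ExponentialCurves.
Arguments quot_bexp {R H} Y t.

(** * Exponentials of anti-Hermitian operators *)

Section UnitaryExponential.
Variables (R : realType) (H : completeNormedModType R[i]).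
Variable dot : {dot H for (@conjC R[i])}.
Hypothesis dot_norm : forall x : H, dot x x = `|x| ^+ 2.
Implicit Types (x y z : H) (S T : bop H).
Local Notation ip := (redot dot).

(** Both maps are complex linear, so the real part of dot determines dot. *)
Lemma dot_of_ip S T : (forall x y, ip (S x) y = ip x (T y)) ->
  forall x y, dot (S x) y = dot x (T y).
Proof.
move=> ST x y; apply: complex_eq; first exact: ST.
by rewrite !Im_dot ST bopZ.
Qed.

Variable Y : bop H.
Hypothesis Yah : antihermitian_op dot Y.

Lemma bexp_dot_adj (t : R) x y : dot (bexp (t *: Y) x) y = dot x (bexp (- (t *: Y)) y).
Proof.
apply: dot_of_ip => {}x {}y; apply: bexp_adj => // {}x {}y.
by rewrite !bopE_Z ipZl ipZr (antiherm_ip dot_norm Yah) mulrN.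
Qed.

Lemma bexp_dot (t : R) x y : dot (bexp (t *: Y) x) (bexp (t *: Y) y) = dot x y.
Proof. by rewrite bexp_dot_adj -bopE_M bexpN. Qed.

Lemma bexp_rnorm (t : R) x : rnorm (bexp (t *: Y) x) = rnorm x.
Proof.
apply/eqP; rewrite -(@eqrXn2 _ 2)// ?rnorm_ge0// -!(ip_norm dot_norm).
by rewrite /redot bexp_dot.
Qed.

Lemma bexpN_rnorm (t : R) x : rnorm (bexp (- (t *: Y)) x) = rnorm x.
Proof. by rewrite -[LHS](bexp_rnorm t) -bopE_M bexpNr. Qed.

Lemma cabs_phase (a : R) : cabs (cos a +i* sin a) = 1.
Proof.
apply/eqP; rewrite -(@eqrXn2 _ 2)// ?cabs_ge0// expr1n sqr_cabs /=.
by rewrite cos2Dsin2.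
Qed.

(** The curve s |-> e^{-sY} e^{i s theta} x starts at x, and its velocity has the
    constant norm |Y x - i theta x|. *)
Lemma bexp_near_eigen (theta t delta : R) x : 0 <= t ->
  rnorm (Y x - (0 +i* theta) *: x) <= delta ->
  rnorm (bexp (t *: Y) x - (cos (t * theta) +i* sin (t * theta)) *: x) <= t * delta.
Proof.
move=> t0 Yx.
pose J : bop H := bop_scale 'i 1.
pose C (s : R) : bop H := cos (s * theta) *: (1 : bop H) + sin (s * theta) *: J.
have CE s z : C s z = (cos (s * theta) +i* sin (s * theta)) *: z.
  rewrite /C bopE_D !bopE_Z /= scalerA -scalerDl; congr (_ *: _).
  by apply: complex_eq; rewrite ?(Re_add,Im_add,Re_mul,Im_mul) /=; ring.
(* C s is multiplication by the phase e^{i s theta}. *)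
pose G (s : R) := bexp (s *: (- Y)) * C s.
pose G' (s : R) := - (Y * bexp (s *: (- Y))) * C s + bexp (s *: (- Y)) * (theta *: (J * C s)).
have Gq s : quot G s u @[u --> s^'] --> G' s.
  have Gn : \forall u \near s^', u != s by exact: nbhs_dnbhs_neq.
  have hC : quot C s u @[u --> s^'] --> theta *: (J * C s).
    have -> : theta *: (J * C s) =
        (- sin (s * theta) * theta) *: (1 : bop H) + (cos (s * theta) * theta) *: J.
      apply/bopP => z; rewrite /C !(bopE_D, bopE_Z, bopE_M) /= !scalerDr !scalerA -!scalerDl.
      congr (_ *: _).
      by apply: complex_eq; rewrite ?(Re_add,Im_add,Re_mul,Im_mul,Re_opp,Im_opp) /=; ring.
    have dl : is_derive s 1 (fun u : R => u * theta) theta.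
      have := @is_deriveM R R id (fun=> theta) s 1 1 0 _ _.
      by move=> h; apply: is_derive_eq; rewrite /= scaler0 add0r [_ *: _]mulr1.
    apply: quotD.
      apply: quotZv; apply: is_derive_quot.
    apply: quotZv; apply: is_derive_quot.
  have := quotM _ (@nbhs_dnbhs R s) Gn (quot_bexp (- Y) s) hC.
  rewrite /G' -mulNr; exact.
have G'E s z : G' s z = bexp (s *: (- Y)) (C s ((0 +i* theta) *: z - Y z)).
  have YE : Y * bexp (s *: - Y) = bexp (s *: - Y) * Y.
    by apply: bexp_comm; rewrite mulrN mulNr.
  rewrite /G' YE -mulrN -mulrA -mulrDr bopE_M; congr (_ _).
  rewrite bopE_D bopE_M bopE_N bopE_Z bopE_M !CE bopZ /= !scalerA scalerBr addrC.
  rewrite !scalerA; congr (_ *: _ - _).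
  by apply: complex_eq; rewrite ?(Re_add,Im_add,Re_mul,Im_mul,Re_opp,Im_opp) /=; ring.
have G'b s : rnorm (G' s x) <= delta.
  rewrite G'E scalerN bexpN_rnorm CE cnormZ cabs_phase mul1r.
  by rewrite rnormB.
have G0 : G 0 = 1.
  rewrite /G /C !mul0r cos0 sin0 !scale0r bexp0 scale1r addr0 mulr1.
  by [].
have Gt y : `|ip (G t x - x) y| <= t * delta * rnorm y.
  pose phi (s : R) : R := ip (G s x) y.
  have dphi (s : R) : is_derive s 1 phi (ip (G' s x) y).
    by apply: quot_is_derive; exact: quot_ip.
  have [->|tn0] := eqVneq t 0.
    by rewrite G0 subrr ip0l normr0 !mul0r.
  have tp : 0 < t by rewrite lt_def tn0.
  have [|c _ hc] := @MVT R phi (fun s => ip (G' s x) y) 0 t tp (fun s _ => dphi s).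
    by apply: derivable_within_continuous => s _; exact: ex_derive.
  have -> : ip (G t x - x) y = ip (G' c x) y * (t - 0).
    by rewrite -hc /phi G0 ipBl.
  rewrite subr0 normrM (ger0_norm t0) mulrC -mulrA ler_wpM2l//.
  apply: le_trans (ip_CS dot_norm _ _) _.
  by rewrite ler_wpM2r ?rnorm_ge0.
have Gt' : rnorm (G t x - x) <= t * delta.
  have [->|g0] := eqVneq (rnorm (G t x - x)) 0.
    by rewrite mulr_ge0// (le_trans (rnorm_ge0 _) (G'b 0)).
  have gp : 0 < rnorm (G t x - x) by rewrite lt_def g0 rnorm_ge0.
  have := Gt (G t x - x); rewrite (ip_norm dot_norm) ger0_norm ?sqr_ge0// expr2.
  by rewrite ler_pM2r.
rewrite -CE rnormB.
have -> : C t x - bexp (t *: Y) x = bexp (t *: Y) (G t x - x).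
  by rewrite bopB /G bopE_M -[bexp (t *: Y) (bexp _ _)]bopE_M scalerN bexpNr.
by rewrite bexp_rnorm.
Qed.

Lemma quot_conj (b : bop H) (t : R) :
  quot (fun s => bexp (s *: Y) * b * bexp (- (s *: Y))) t s @[s --> t^'] -->
  Y * (bexp (t *: Y) * b * bexp (- (t *: Y))) - (bexp (t *: Y) * b * bexp (- (t *: Y))) * Y.
Proof.
have Gn : \forall u \near t^', u != t by exact: nbhs_dnbhs_neq.
have h1 := quotM _ (@nbhs_dnbhs R t) Gn (quot_bexp Y t) (quot_cst _ _ b).
have h2 := quotM _ (@nbhs_dnbhs R t) Gn (h1 _ _) (quot_bexp (- Y) t).
rewrite mulr0 addr0 in h2.
have -> : (fun s => bexp (s *: Y) * b * bexp (- (s *: Y))) =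
   (fun s => bexp (s *: Y) * b * bexp (s *: - Y)).
  by apply/funext => s; rewrite scalerN.
rewrite -!scalerN -mulrN -[_ * bexp (t *: - Y) * - Y]mulrA.
rewrite -[_ * - Y](@bexp_comm _ _ _ (- Y) t erefl) !mulrA.
by move: h2; rewrite !mulrA => h2; exact: (h2 _ _ _).
Qed.

End UnitaryExponential.

(** * Separation and the numerical radius *)

Section Separation.
Variables (R : realType) (T : Type) (n : nat) (g : T -> nat -> R) (t0 : T).
Hypothesis g1 : forall t j, `|g t j| <= 1.
Implicit Types (r : seq (R * T)).

(** The weights are squares p.1 ^+ 2, which makes them nonnegative by construction
    and provides the coefficients of the vectors built from them later. *)
Definition mean r j : R := \sum_(p <- r) p.1 ^+ 2 * g p.2 j.
Definition mass r : R := \sum_(p <- r) p.1 ^+ 2.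

Lemma mean_le1 r j : mass r = 1 -> `|mean r j| <= 1.
Proof.
move=> <-; apply: le_trans (ler_norm_sum _ _ _) _; apply: ler_sum => p _.
rewrite normrM ger0_norm ?sqr_ge0// -[leRHS]mulr1 ler_wpM2l// sqr_ge0//.
Qed.

Let N2 r : R := \sum_(j < n) mean r j ^+ 2.

Let mix (s : R) r t := (Num.sqrt s, t) :: [seq (Num.sqrt (1 - s) * p.1, p.2) | p <- r].

Lemma mean_mix s r t j : 0 <= s <= 1 ->
  mean (mix s r t) j = s * g t j + (1 - s) * mean r j.
Proof.
move=> /andP[s0 s1]; rewrite /mean big_cons big_map /= sqr_sqrtr// mulr_sumr.
congr (_ + _); apply: eq_bigr => p _.
by rewrite exprMn sqr_sqrtr ?subr_ge0// -mulrA.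
Qed.

Lemma mass_mix s r t : 0 <= s <= 1 -> mass r = 1 -> mass (mix s r t) = 1.
Proof.
move=> /andP[s0 s1] r1; rewrite /mass big_cons big_map /= sqr_sqrtr//.
have -> : \sum_(p <- r) (Num.sqrt (1 - s) * p.1) ^+ 2 = (1 - s) * mass r.
  rewrite mulr_sumr; apply: eq_bigr => p _.
  by rewrite exprMn sqr_sqrtr ?subr_ge0.
by rewrite r1; ring.
Qed.

(** Either the convex hull of the points g t comes close to the origin of R^n or a
    linear form is bounded below on it by a positive number: a point of nearly
    minimal norm in the hull gives such a form, since moving from it towards any
    generator cannot shorten it much. *)
Lemma separation (eps : R) : 0 < eps ->
  (exists r, mass r = 1 /\ forall j, (j < n)%N -> `|mean r j| <= eps) \/
  (exists (d : nat -> R) (theta : R), 0 < theta /\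
     forall t, theta <= \sum_(j < n) d j * g t j).
Proof.
move=> e0; pose A := [set N2 r | r in [set r | mass r = 1]].
have A0 : has_inf A.
  split.
    exists (N2 [:: (1, t0)]); exists [:: (1, t0)] => //=.
    by rewrite /mass big_seq1 /= expr1n.
  by exists 0 => _ [r _ <-]; apply: sumr_ge0 => j _; exact: sqr_ge0.
have N2n r : mass r = 1 -> N2 r <= n%:R.
  move=> r1; rewrite -[n in leRHS]card_ord -sumr_const; apply: ler_sum => j _.
  by rewrite -[leRHS](expr1n _ 2) -real_normK ?num_real// ler_pXn2r ?nnegrE//; exact: mean_le1.
have [me|em] := ltP (inf A) (eps ^+ 2).
  left; have /(inf_adherent) := A0; move/(_ (eps ^+ 2 - inf A)).
  rewrite subr_gt0 => /(_ me) [_ [r /= r1 <-]]; rewrite addrC subrK => rN.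
  exists r; split=> // j jn.
  rewrite -(@ler_pXn2r _ 2)// ?nnegrE ?(ltW e0)// real_normK ?num_real//.
  apply: ltW; apply: le_lt_trans rN.
  rewrite /N2 (bigD1 (Ordinal jn))//= lerDl sumr_ge0// => i _; exact: sqr_ge0.
right; set m := inf A in em.
have m0 : 0 < m by apply: lt_le_trans em; exact: exprn_gt0.
have mN r : mass r = 1 -> m <= N2 r.
  by move=> r1; apply: (ge_inf A0.2); exists r.
have mn : m <= n%:R by apply: le_trans (mN [:: (1, t0)] _) (N2n _ _); rewrite /mass big_seq1 /= expr1n.
(* The step s is so small that the quadratic term s^2 |g - mean|^2 <= 4 n s^2
   costs at most s m / 2. *)
pose s := m / (8 * n.+1%:R).
have n1 : 0 < n.+1%:R :> R by rewrite ltr0n.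
have s0 : 0 < s by rewrite divr_gt0// mulr_gt0.
have sE : s * (8 * n.+1%:R) = m by rewrite /s mulfVK// gt_eqF// mulr_gt0.
have nn1 : n.+1%:R = n%:R + 1 :> R by rewrite natr1.
have s1 : s <= 1 by rewrite /s ler_pdivrMr ?mulr_gt0// mul1r nn1; lra.
have /(inf_adherent) := A0; move/(_ (s * m / 2)).
have sm : 0 < s * m / 2 by rewrite divr_gt0// mulr_gt0.
move=> /(_ sm)[_ [r /= r1 <-]] rN.
exists (mean r), (m / 2); split; first by rewrite divr_gt0.
move=> t; have s01 : 0 <= s <= 1 by rewrite ltW.
have := mN (mix s r t) (mass_mix t s01 r1).
have -> : N2 (mix s r t) = N2 r + 2 * s * (\sum_(j < n) mean r j * g t j - N2 r)
    + s ^+ 2 * \sum_(j < n) (g t j - mean r j) ^+ 2.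
  rewrite /N2 -sumrB !mulr_sumr -!big_split /=; apply: eq_bigr => j _.
  by rewrite mean_mix//; ring.
have gd : \sum_(j < n) (g t j - mean r j) ^+ 2 <= 4 * n%:R.
  rewrite mulr_natr -[n in leRHS]card_ord -sumr_const; apply: ler_sum => j _.
  have := g1 t j; have := mean_le1 j r1; rewrite !ler_norml => /andP[? ?] /andP[? ?].
  by nra.
have := mN r r1; move: rN; rewrite -/m -/(N2 r); set D := \sum_(j < n) _ * _.
set N := N2 r; set G := \sum_(j < n) _ in gd *.
move=> h1 h2 h3.
have n0 : 0 <= n%:R :> R by exact: ler0n.
have h4 : s ^+ 2 * G <= s ^+ 2 * (4 * n%:R) by rewrite ler_wpM2l// sqr_ge0.
have h5 : s ^+ 2 * (8 * n.+1%:R) = s * m by rewrite -sE; ring.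
have h6 : s ^+ 2 * (4 * n%:R) <= s * m / 2.
  by rewrite nn1 in h5; have := sqr_ge0 s; nra.
have h7 : 0 <= s * (2 * (D - N) + m).
  by nra.
by rewrite (pmulr_rge0 _ s0) in h7; lra.
Qed.

End Separation.

Section NumericalRadius.
Variables (R : realType) (H : completeNormedModType R[i]).
Variable dot : {dot H for (@conjC R[i])}.
Hypothesis dot_norm : forall x : H, dot x x = `|x| ^+ 2.
Implicit Types (x y z : H) (S T B : bop H).
Local Notation ip := (redot dot).

Lemma ip_i x y : ip ('i *: x) y = - ip x ('i *: y).
Proof. by rewrite /redot dotZl dotZr !Re_mul Re_conjE Im_conjE /= !mul0r !mul1r; ring. Qed.

(** For an anti-Hermitian B, <Bx, x> is purely imaginary; this is its imaginary
    part. *)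
Definition qim B x : R := ip (B x) ('i *: x).

Lemma qimZ B (a : R) x : qim B (a%:C *: x) = a ^+ 2 * qim B x.
Proof.
by rewrite /qim bopZ ipZl scalerA ['i * _]mulrC -scalerA ipZr mulrA expr2.
Qed.

Lemma cabs_i : cabs ('i : R[i]) = 1.
Proof. by rewrite /cabs normc_def /= expr0n expr1n add0r sqrtr1. Qed.

(** By polarization and the parallelogram law, tested on the pair x, y with
    i y proportional to B x and |y| = |x|. *)
Lemma numerical_radius B (M : R) : antihermitian_op dot B -> 0 <= M ->
  (forall x, `|qim B x| <= M * rnorm x ^+ 2) -> `|B| <= M.
Proof.
move=> /(antiherm_ip dot_norm) BA M0 hM; apply: opnorm_le_bound => // x.
have [->|n0] := eqVneq (rnorm (B x)) 0; first by rewrite mulr_ge0// rnorm_ge0.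
have np : 0 < rnorm (B x) by rewrite lt_def n0 rnorm_ge0.
have [x0|r0] := eqVneq (rnorm x) 0.
  by move: n0; rewrite (rnorm_eq0 x0) bop0 rnorm0 eqxx.
have rp : 0 < rnorm x by rewrite lt_def r0 rnorm_ge0.
pose y := (rnorm x / rnorm (B x))%:C *: (- 'i *: B x).
have yn : rnorm y = rnorm x.
  rewrite rnormZr cnormZ -mulN1r cabsM cabs_i.
  have -> : cabs (-1 : R[i]) = 1 by rewrite /cabs normrN normr1.
  by rewrite !mul1r ger0_norm ?divr_ge0 ?rnorm_ge0// divfK.
have iy : 'i *: y = (rnorm x / rnorm (B x))%:C *: B x.
  rewrite /y !scalerA mulrC mulrA; congr (_ *: _).
  by apply: complex_eq; rewrite ?(Re_mul,Im_mul,Re_opp,Im_opp) /=; ring.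
have sxy : ip (B x) ('i *: y) = rnorm x * rnorm (B x).
  by rewrite iy ipZr (ip_norm dot_norm) expr2 mulrA divfK.
have syx : ip (B y) ('i *: x) = ip (B x) ('i *: y).
  by rewrite BA bopZ -ip_i ipC.
have pol : qim B (x + y) - qim B (x - y) = 4 * ip (B x) ('i *: y).
  by rewrite /qim !(bopD,bopN,scalerDr,scalerN,ipDl,ipDr,ipNl,ipNr) syx; ring.
have par : rnorm (x + y) ^+ 2 + rnorm (x - y) ^+ 2 = 4 * rnorm x ^+ 2.
  rewrite -!(ip_norm dot_norm) !(ipDl,ipDr,ipNl,ipNr).
  by have := ip_norm dot_norm y; rewrite yn -(ip_norm dot_norm) => ->; ring.
have := hM (x + y); have := hM (x - y); rewrite !ler_norml => /andP[h1 _] /andP[_ h2].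
have h3 : rnorm x * rnorm (B x) <= rnorm x * (M * rnorm x).
  have -> : rnorm x * (M * rnorm x) = M * (4 * rnorm x ^+ 2) / 4 by field.
  by rewrite -par -sxy; lra.
by rewrite ler_pM2l in h3.
Qed.

(** |S x|^2 = <x, T S x> <= |x| |T| |S x|. *)
Lemma opnorm_adj S T : (forall x y, ip (S x) y = ip x (T y)) -> `|S| <= `|T|.
Proof.
move=> ST; apply: opnorm_le_bound => // x.
have [->|n0] := eqVneq (rnorm (S x)) 0; first by rewrite mulr_ge0// rnorm_ge0.
have np : 0 < rnorm (S x) by rewrite lt_def n0 rnorm_ge0.
rewrite -(ler_pM2r np) -expr2 -(ip_norm dot_norm) ST.
apply: le_trans (ler_norm _) _; apply: le_trans (ip_CS dot_norm _ _) _.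
by rewrite mulrAC mulrC ler_wpM2r ?rnorm_ge0// opnorm_bound.
Qed.

End NumericalRadius.

(** * Minimality and extremal families *)

Section Minimality.
Variables (R : realType) (H : completeNormedModType R[i]).
Variable dot : {dot H for (@conjC R[i])}.
Hypothesis dot_norm : forall x : H, dot x x = `|x| ^+ 2.
Variable e : nat -> H.
Hypothesis he : orthonormal_basis dot e.
Implicit Types (x y z : H) (S T B : bop H).
Local Notation ip := (redot dot).
Local Notation Pr := (Pr dot_norm he).

Lemma antiherm_tail Z (n : nat) (eps : R) : antihermitian_op dot Z ->
  `|(1 - Pr n) * Z| <= eps -> `|Z * (1 - Pr n)| <= eps.
Proof.
move=> ZA Zn; apply: le_trans Zn; rewrite -[leRHS]normrN; apply: (opnorm_adj dot_norm) => x y.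
rewrite bopE_M (antiherm_ip dot_norm ZA) bopE_N bopE_M ipNr; congr (- _).
by rewrite !bopE_B !bopE_1 ipBl ipBr; congr (_ - _); rewrite /redot dot_Pr.
Qed.

Lemma DBah_trunc D n : DBah dot e D -> DKah dot e (Pr n * D * Pr n).
Proof.
move=> [DA [d Dd]]; split; first split.
- by apply/tb_compact/tb_opMl; exact: Pr_tb.
- apply/(antihermP dot_norm) => x y; rewrite !bopE_M dot_Pr.
  by rewrite (antihermP dot_norm _).1// dot_Pr.
exists (fun k => if (k < n)%N then d k else 0) => k.
rewrite !bopE_M Pr_e; case: ifP => kn; last by rewrite !bop0 scale0r.
by rewrite Dd bopZ Pr_e kn.
Qed.

(** Bounded diagonals do no better than compact ones, because the corner
    compressions of a compact operator converge to it in norm. *)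
Lemma quotient_norm_le Z D : Kah dot Z -> DBah dot e D ->
  quotient_norm dot e Z <= `|Z + D|.
Proof.
move=> [Zc ZA] DD; apply/ler_addgt0Pl => eps e0.
have e20 : 0 < eps / 2 by rewrite divr_gt0.
have [n /(_ _ (leqnn n)) Zn] := compact_tail dot_norm he Zc e20.
apply: le_trans (_ : `|Z + Pr n * D * Pr n| <= _).
  apply: ge_inf; last by exists (Pr n * D * Pr n) => //; exact: DBah_trunc.
  by exists 0 => _ [S _ <-].
have -> : Z + Pr n * D * Pr n =
  ((1 - Pr n) * Z + Pr n * (Z * (1 - Pr n))) + Pr n * (Z + D) * Pr n.
  rewrite !(mulrDl, mulrDr, mulrBl, mulrBr, mul1r, mulr1) !mulrA.
  by rewrite mulNr mulrN !addrA !subrK.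
apply: le_trans (ler_normD _ _) _; apply: lerD.
  apply: le_trans (ler_normD _ _) _; rewrite [eps]splitr; apply: lerD => //.
  apply: le_trans (opnormM _ _) _; rewrite -[leRHS]mul1r.
  by apply: ler_pM => //; [exact: opnorm_Pr|exact: antiherm_tail].
apply: le_trans (opnormM _ _) _; rewrite -[leRHS]mulr1; apply: ler_pM => //.
  apply: le_trans (opnormM _ _) _; rewrite -[leRHS]mul1r; apply: ler_pM => //.
  exact: opnorm_Pr.
exact: opnorm_Pr.
Qed.

(** Diagonal operator with entries d j + d n for j < n and d n beyond: the last
    coefficient multiplies the identity. *)
Definition diagR n (d : nat -> R) : bop H :=
  \sum_(j < n) d j *: (Pr j.+1 - Pr j) + d n *: (1 : bop H).

Lemma PrS_E j x : (Pr j.+1 - Pr j) x = dot x (e j) *: e j.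
Proof. by rewrite bopE_B !PrE big_ord_recr /= addrAC subrr add0r. Qed.

Lemma diagR_E n d x :
  diagR n d x = \sum_(j < n) (d j)%:C *: (dot x (e j) *: e j) + (d n)%:C *: x.
Proof.
rewrite /diagR bopE_D bopE_sum; congr (_ + _).
by apply: eq_bigr => j _; rewrite bopE_Z PrS_E.
Qed.

Lemma DBah_diagR n d (c : R) : DBah dot e (bop_scale (0 +i* c) (diagR n d)).
Proof.
split.
  apply/(antihermP dot_norm) => x y.
  have dS : dot (diagR n d x) y = dot x (diagR n d y).
    rewrite !diagR_E dotDl dotDr dot_suml dot_sumr; congr (_ + _).
      apply: eq_bigr => j _; rewrite !(dotZl,dotZr) -(dotC dot (e j) y).
      by rewrite conjC_real; ring.
    by rewrite dotZl dotZr; congr (_ * _); rewrite conjC_real.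
  rewrite !bopE_S dotZl dotZr dS -mulNr; congr (_ * _).
  by apply: complex_eq; rewrite ?(Re_opp,Im_opp,Re_conjE,Im_conjE) /= ?oppr0 ?opprK.
exists (fun k => (0 +i* c) * ((if (k < n)%N then d k else 0) + d n)%:C) => k.
rewrite bopE_S diagR_E -scalerA; congr (_ *: _).
rewrite rmorphD /= scalerDl; congr (_ + _).
case: ifP => kn.
  rewrite (bigD1 (Ordinal kn))//= (dot_ee he) eqxx scale1r big1 ?addr0// => i ik.
  rewrite (dot_ee he) (_ : _ == _ = false) ?scale0r ?scaler0//.
  by apply: contraNF ik => /eqP ki; apply/eqP/val_inj.
rewrite scale0r big1// => i _; rewrite (dot_ee he) (_ : _ == _ = false) ?scale0r ?scaler0//.
by apply: contraFF kn => /eqP->.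
Qed.

Lemma qim_diagR n d (c : R) x : qim dot (bop_scale (0 +i* c) (diagR n d)) x =
  c * (\sum_(j < n) d j * cabs (dot x (e j)) ^+ 2 + d n * rnorm x ^+ 2).
Proof.
rewrite /qim bopE_S.
have -> : (0 +i* c) *: diagR n d x = 'i *: (c%:C *: diagR n d x).
  rewrite scalerA; congr (_ *: _).
  by apply: complex_eq; rewrite ?(Re_mul,Im_mul) /=; ring.
rewrite ip_i scalerA -expr2.
have -> : ('i : R[i]) ^+ 2 = -1 by rewrite -[RHS](sqr_i R).
rewrite scaleN1r ipNr opprK ipZl; congr (_ * _).
rewrite diagR_E ipDl ip_suml ipZl (ip_norm dot_norm); congr (_ + _).
apply: eq_bigr => j _; rewrite ipZl; congr (_ * _).
by rewrite /redot dotZl (dotC dot (e j) x) -sqr_normc cabsE -rmorphXn.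
Qed.

Lemma qimD S T x : qim dot (S + T) x = qim dot S x + qim dot T x.
Proof. by rewrite /qim bopE_D ipDl. Qed.

Lemma qim_le S x : `|qim dot S x| <= `|S| * rnorm x ^+ 2.
Proof.
apply: le_trans (ip_CS dot_norm _ _) _; rewrite cnormZ cabs_i mul1r expr2 mulrA.
by rewrite ler_wpM2r ?rnorm_ge0// opnorm_bound.
Qed.

Definition extremal V (eps : R) (p : R * H) : Prop :=
  [/\ p.1 = 1 \/ p.1 = -1, rnorm p.2 = 1 & `|V| - eps <= p.1 * qim dot V p.2].

Section Family.
Variables (V : bop H).
Hypothesis VA : antihermitian_op dot V.
Hypothesis Vmin : forall D, DBah dot e D -> `|V| <= `|V + D|.

(** If the masses could not be balanced, a separating linear form d would produce a
    small diagonal operator that lowers |<V x, x>| on all extremal vectors and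
    changes it little on the others, against the minimality of |V|. *)
Lemma extremal_family n (eps delta : R) : 0 < eps -> eps < `|V| -> 0 < delta ->
  exists r : seq (R * {p : R * H | extremal V eps p}),
  [/\ \sum_(i <- r) i.1 ^+ 2 = 1,
      forall j, (j < n)%N -> `|\sum_(i <- r) i.1 ^+ 2 *
        ((sval i.2).1 * cabs (dot (sval i.2).2 (e j)) ^+ 2)| <= delta &
      `|\sum_(i <- r) i.1 ^+ 2 * (sval i.2).1| <= delta].
Proof.
move=> e0 eV d0; pose T := {p : R * H | extremal V eps p}.
pose g (t : T) j := if (j < n)%N then (sval t).1 * cabs (dot (sval t).2 (e j)) ^+ 2
  else (sval t).1.
have sgn1 (t : T) : `|(sval t).1| = 1.
  by case: (svalP t) => [[]-> _ _]; rewrite ?normrN normr1.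
have g1 t j : `|g t j| <= 1.
  rewrite /g; case: ifP => _; last by rewrite sgn1.
  rewrite normrM sgn1 mul1r ger0_norm ?sqr_ge0// -(expr1n _ 2) ler_pXn2r ?nnegrE ?cabs_ge0//.
  apply: le_trans (dot_CS dot_norm _ _) _.
  by rewrite (rnorm_e dot_norm he) mulr1; case: (svalP t) => _ ->.
have [t0] : exists t0 : T, True.
  apply: contrapT => noT.
  suff : `|V| <= `|V| - eps by lra.
  apply: (numerical_radius dot_norm VA); first by lra.
  move=> x; rewrite leNgt; apply/negP => hx; apply: noT.
  have [x0|x0] := eqVneq (rnorm x) 0.
    move: hx; rewrite (rnorm_eq0 x0) /qim bop0 ip0l rnorm0 expr0n normr0 mulr0.
    by rewrite ltxx.
  have xp : 0 < rnorm x by rewrite lt_def x0 rnorm_ge0.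
  pose y := (rnorm x)^-1%:C *: x; pose s : R := if 0 <= qim dot V x then 1 else -1.
  have sq : s * qim dot V x = `|qim dot V x|.
    rewrite /s; case: leP => h; first by rewrite mul1r ger0_norm.
    by rewrite mulN1r ltr0_norm.
  have E : extremal V eps (s, y).
    split=> /=.
    - by rewrite /s; case: ifP; [left|right].
    - by rewrite rnormZr gtr0_norm ?invr_gt0// mulVf.
    - rewrite qimZ mulrCA sq exprVn ler_pdivlMl ?exprn_gt0// mulrC.
      exact: ltW.
  by exists (exist _ _ E).
move=> _; have [[r [r1 rm]]|[d [theta [th0 dth]]]] := separation n.+1 t0 g1 d0.
  exists r; split=> // [j jn|].
    have := rm j; rewrite ltnS ltnW// /mean => /(_ isT).
    by under eq_bigr do rewrite /g jn.
  have := rm n (ltnSn n); rewrite /mean.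
  by under eq_bigr do rewrite /g ltnn.
exfalso.
pose q x := \sum_(j < n) d j * cabs (dot x (e j)) ^+ 2 + d n * rnorm x ^+ 2.
have dq (t : T) : theta <= (sval t).1 * q (sval t).2.
  have gn : g t n = (sval t).1 by rewrite /g ltnn.
  apply: le_trans (dth t) _; rewrite big_ord_recr /= gn /q mulrDr mulr_sumr.
  case: (svalP t) => _ -> _; rewrite expr1n mulr1 [_ * d n]mulrC lerD// ler_sum// => j _.
  by rewrite /g ltn_ord mulrCA.
pose K := \sum_(j < n.+1) `|d j| + 1.
have K0 : 0 < K by rewrite ltr_wpDl// sumr_ge0.
have qK x : rnorm x = 1 -> `|q x| <= K.
  move=> x1; rewrite /q /K x1 expr1n mulr1 big_ord_recr /=.
  apply: le_trans (ler_normD _ _) _; rewrite -addrA lerD ?lerDl//.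
  apply: le_trans (ler_norm_sum _ _ _) _; apply: ler_sum => j _.
  rewrite normrM (ger0_norm (sqr_ge0 _)) -[leRHS]mulr1 ler_wpM2l//.
  rewrite -(expr1n _ 2) ler_pXn2r ?nnegrE ?cabs_ge0//.
  by apply: le_trans (dot_CS dot_norm _ _) _; rewrite (rnorm_e dot_norm he) mulr1 x1.
(* Small enough for the vectors that are not extremal. *)
pose kap := eps / (2 * K).
have kap0 : 0 < kap by rewrite divr_gt0// mulr_gt0.
have kapK : kap * K = eps / 2 by rewrite /kap; field; rewrite gt_eqF.
pose D := bop_scale (0 +i* (- kap)) (diagR n d).
have DD : DBah dot e D by exact: DBah_diagR.
pose M := Num.max (`|V| - kap * theta) (`|V| - eps / 2).
have kth : 0 < kap * theta by rewrite mulr_gt0.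
have MV : M < `|V| by rewrite gt_max !ltrBlDr !ltrDl kth divr_gt0.
have M1 : `|V| - kap * theta <= M by rewrite le_max lexx.
have M2 : `|V| - eps / 2 <= M by rewrite le_max lexx orbT.
have M0 : 0 <= M by lra.
suff : `|V + D| <= M by have := Vmin DD; lra.
apply: (numerical_radius dot_norm) => //.
  apply/(antihermP dot_norm) => x y; rewrite !bopE_D dotDl dotDr.
  rewrite ((antihermP dot_norm _).1 VA) ((antihermP dot_norm _).1 DD.1).
  by rewrite opprD.
suff unit x : rnorm x = 1 -> `|qim dot (V + D) x| <= M.
  move=> x; have [x0|x0] := eqVneq (rnorm x) 0.
    by rewrite (rnorm_eq0 x0) /qim bop0 ip0l rnorm0 expr0n normr0 mulr0.
  have xp : 0 < rnorm x by rewrite lt_def x0 rnorm_ge0.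
  have := unit ((rnorm x)^-1%:C *: x).
  rewrite rnormZr gtr0_norm ?invr_gt0// mulVf// => /(_ erefl).
  rewrite qimZ normrM ger0_norm ?sqr_ge0// exprVn mulrC ler_pdivrMr//.
  exact: exprn_gt0.
move=> x1; have := qK x x1.
rewrite qimD qim_diagR -/(q x); set h := qim dot V x => qx.
have kq : `|kap * q x| <= eps / 2.
  by rewrite normrM gtr0_norm// -kapK ler_pM2l.
have signed s : s = 1 \/ s = -1 -> `|V| - eps <= s * h -> `|h + - kap * q x| <= M.
  move=> s1 sh.
  have E : extremal V eps (s, x) by split.
  have hV : s * h <= `|V|.
    have := qim_le V x; rewrite x1 expr1n mulr1 -/h ler_norml => /andP[h1 h2].
    by case: s1 => ->; lra.
  have h3 : kap * theta <= s * (kap * q x).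
    by rewrite mulrCA ler_pM2l//; exact: (dq (exist _ _ E)).
  have h4 : s * (kap * q x) <= eps / 2.
    by move: kq; rewrite ler_norml => /andP[h1 h2]; case: s1 => ->; lra.
  by rewrite ler_norml; case: s1 => s1; rewrite s1 in sh h3 h4 hV; apply/andP; split; lra.
have [hp|hp] := leP (`|V| - eps) h; first by apply: (signed 1); [left|rewrite mul1r].
have [hn|hn] := leP (`|V| - eps) (- h).
  by apply: (signed (-1)); [right|rewrite mulN1r].
move: kq; rewrite !ler_norml => /andP[h1 h2]; apply/andP; split; lra.
Qed.

End Family.
End Minimality.

(** * Spectral polynomials *)

Section SpectralPolynomials.
Variables (R : realType) (lam : nat -> R).
Hypothesis lam_inj : forall i j, i <> j -> lam i <> lam j.
Hypothesis lam0 : forall eps : R, 0 < eps -> exists N, forall i, (N <= i)%N -> `|lam i| <= eps.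

(** A Lagrange factor vanishes at finitely many other spectral values, including
    all those of modulus more than |lam j| / 2; a high power of X / lam j makes
    the rest small. *)
Lemma peak_poly n j (eps : R) : 0 < eps -> lam j != 0 ->
  exists p : {poly R}, [/\ p.[lam j] = 1,
    forall i, (i < n)%N -> i != j -> p.[lam i] = 0 &
    forall i, i != j -> `|p.[lam i]| <= eps].
Proof.
move=> e0 lj0; have lj : 0 < `|lam j| by rewrite normr_gt0.
have [N NP] := lam0 (divr_gt0 lj (ltr0Sn R 1)).
pose m := maxn n N.
pose P := \prod_(i < m | i != j :> nat) ((lam j - lam i)^-1 *: ('X - (lam i)%:P)).
have ne i : i != j -> lam j - lam i != 0.
  by move=> ij; rewrite subr_eq0; apply/eqP; apply: lam_inj => ji; rewrite ji eqxx in ij.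
have PE x : P.[x] = \prod_(i < m | i != j :> nat) ((lam j - lam i)^-1 * (x - lam i)).
  by rewrite horner_prod; apply: eq_bigr => i _; rewrite !hornerE.
have Pj : P.[lam j] = 1.
  by rewrite PE big1// => i ij; rewrite mulVf// ne.
have P0 i : (i < m)%N -> i != j -> P.[lam i] = 0.
  by move=> im ij; rewrite PE (bigD1 (Ordinal im))//= subrr mulr0 mul0r.
pose C := \prod_(i < m | i != j :> nat) (`|lam j - lam i|^-1 * (`|lam j| + `|lam i|)).
have PC x : `|x| <= `|lam j| -> `|P.[x]| <= C.
  move=> xl; rewrite PE normr_prod; apply: ler_prod => i ij.
  rewrite normr_ge0 normrM normfV ler_wpM2l ?invr_ge0//.
  by apply: le_trans (ler_normB _ _) _; rewrite lerD2r.
pose M := truncn (C / eps).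
pose p := P * ('X * (lam j)^-1%:P) ^+ M.
have pE x : p.[x] = P.[x] * (x / lam j) ^+ M by rewrite /p hornerM horner_exp !hornerE.
exists p; split.
- by rewrite pE Pj divff// expr1n mulr1.
- by move=> i ni ij; rewrite pE P0 ?mul0r// (leq_trans ni)// leq_maxl.
move=> i ij; rewrite pE; have [im|mi] := ltnP i m.
  by rewrite P0// mul0r normr0 ltW.
have li : `|lam i| <= `|lam j| / 2 by apply: NP; rewrite (leq_trans _ mi)// leq_maxr.
have C0 : 0 <= C.
  by apply: prodr_ge0 => k _; rewrite mulr_ge0 ?invr_ge0// addr_ge0.
rewrite normrM normrX normrM normfV.
apply: le_trans (_ : C * (2^-1) ^+ M <= _).
  apply: ler_pM; rewrite ?exprn_ge0 ?mulr_ge0 ?invr_ge0//.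
    apply: PC; apply: le_trans li _; rewrite ler_pdivrMr//; lra.
  apply: lerXn2r; rewrite ?nnegrE ?mulr_ge0 ?invr_ge0//.
  by rewrite ler_pdivrMr// mulrC.
rewrite exprVn ler_pdivrMr ?exprn_gt0// mulrC -ler_pdivrMr//.
have /andP[_ h] := truncn_itv (divr_ge0 C0 (ltW e0)).
apply: le_trans (ltW h) _; rewrite -natrX ler_nat.
exact: ltn_expl.
Qed.

(** Squares of peak polynomials serve the nonzero values. If 0 is a spectral value,
    no polynomial isolates it from the values that accumulate there; the
    complement of the sum of the others takes its place. *)
Lemma spectral_partition n : exists psi : nat -> {poly R},
  [/\ forall i j, (i < n)%N -> (j < n)%N -> (psi j).[lam i] = (i == j)%:R,
      forall i j, (j < n)%N -> 0 <= (psi j).[lam i] &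
      forall i, \sum_(j < n) (psi j).[lam i] <= 1].
Proof.
have e0 : 0 < n.+1%:R^-1 :> R by rewrite invr_gt0 ltr0n.
have /choice[phi phiP] : forall j, exists p : {poly R}, lam j != 0 ->
    [/\ p.[lam j] = 1, forall i, (i < n)%N -> i != j -> p.[lam i] = 0 &
      forall i, i != j -> `|p.[lam i]| <= n.+1%:R^-1].
  move=> j; have [lj|lj] := eqVneq (lam j) 0; first by exists 0.
  by have [p pP] := peak_poly n e0 lj; exists p.
pose base j := phi j ^+ 2.
have baseE j x : (base j).[x] = (phi j).[x] ^+ 2 by rewrite horner_exp.
pose S := \sum_(l < n | lam l != 0) base l.
have SE x : S.[x] = \sum_(l < n | lam l != 0) (base l).[x] by rewrite horner_sum.
have base0 j x : 0 <= (base j).[x] by rewrite baseE sqr_ge0.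
have based i j : (i < n)%N -> lam j != 0 -> (base j).[lam i] = (i == j)%:R.
  move=> ni lj; have [p1 p2 p3] := phiP j lj; rewrite baseE.
  have [->|ij] := eqVneq i j; first by rewrite p1 expr1n.
  by rewrite p2// expr0n.
have S1 i : S.[lam i] <= 1.
  rewrite SE; have [ni|ni] := ltnP i n.
    have [li|li] := eqVneq (lam i) 0.
      rewrite big1// => l ll; rewrite based//.
      by case: eqP => // il; rewrite -il li eqxx in ll.
    rewrite (bigD1 (Ordinal ni))//= based// eqxx big1 ?addr0// => l /andP[ll il].
    rewrite based// (_ : _ == _ = false)//.
    by apply: contraNF il => /eqP h; apply/eqP/val_inj.
  apply: le_trans (_ : \sum_(l < n) n.+1%:R^-1 <= _).
    rewrite big_mkcond /=; apply: ler_sum => l _; case: ifP => ll; last exact: ltW.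
    have il : i != l by apply: contraTneq ni => ->; rewrite -ltnNge.
    have [_ _ /(_ i il) h] := phiP l ll.
    rewrite baseE -real_normK ?num_real//.
    apply: le_trans (_ : (n.+1%:R^-1) ^+ 2 <= _); first by apply: lerXn2r; rewrite ?nnegrE// ltW.
    by rewrite expr2 ler_piMl ?(ltW e0)// invf_le1 ?ltr0n// ler1n.
  rewrite sumr_const card_ord -[leLHS]mulr_natr mulrC ler_pdivrMr ?ltr0n// mul1r.
  by rewrite ler_nat.
pose psi j := if lam j == 0 then 1 - S else base j.
have psiE j x : (psi j).[x] = if lam j == 0 then 1 - S.[x] else (base j).[x].
  by rewrite /psi; case: ifP => _; rewrite ?hornerD ?hornerN ?hornerC.
exists psi; split.
- move=> i j ni nj; rewrite psiE; case: ifP => [/eqP lj|/negbT lj]; last exact: based.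
  rewrite SE; have [ij|ij] := eqVneq i j.
    rewrite big1 ?subr0// => l ll; rewrite based//.
    by case: eqP => // il; rewrite -il ij lj eqxx in ll.
  have li : lam i != 0.
    by apply/eqP => li; apply: (lam_inj (i := i) (j := j)); [apply/eqP|rewrite li lj].
  rewrite (bigD1 (Ordinal ni))//= based// eqxx big1 ?addr0 ?subrr// => l /andP[ll il].
  rewrite based// (_ : _ == _ = false)//.
  by apply: contraNF il => /eqP h; apply/eqP/val_inj.
- by move=> i j nj; rewrite psiE; case: ifP => // _; rewrite subr_ge0.
move=> i; under eq_bigr do rewrite psiE.
rewrite (bigID (fun j : 'I_n => lam j != 0)) /=.
have -> : \sum_(j < n | lam j != 0) (if lam j == 0 then 1 - S.[lam i] else (base j).[lam i]) = S.[lam i].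
  by rewrite SE; apply: eq_bigr => j /negbTE ->.
have [[j0 lj0]|no] := pselect (exists j : 'I_n, lam j = 0).
  rewrite (bigD1 j0) /=; last by rewrite lj0 eqxx.
  rewrite lj0 eqxx big1; first by rewrite addr0 addrC subrK.
  move=> j /andP[]; rewrite negbK => /eqP lj jj0; exfalso.
  apply: (lam_inj (i := j) (j := j0)); last by rewrite lj lj0.
  by move=> h; rewrite (val_inj h) eqxx in jj0.
rewrite [X in _ + X]big1 ?addr0// => j; rewrite negbK => /eqP lj; exfalso; apply: no.
by exists j.
Qed.

End SpectralPolynomials.

Section PolynomialCalculus.
Variables (R : realType) (H : completeNormedModType R[i]).
Variable dot : {dot H for (@conjC R[i])}.
Hypothesis dot_norm : forall x : H, dot x x = `|x| ^+ 2.
Implicit Types (x y z : H) (S T b c Y : bop H) (p : {poly R}).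
Local Notation ip := (redot dot).

Definition peval p c : bop H := \sum_(i < size p) p`_i *: c ^+ i.

Lemma peval_conj p c (U U' : bop H) : U' * U = 1 -> U * U' = 1 ->
  peval p (U * c * U') = U * peval p c * U'.
Proof.
move=> U1 U2; rewrite /peval mulr_sumr mulr_suml; apply: eq_bigr => i _.
rewrite -bop_scalerAr -bop_scalerAl; congr (_ *: _).
elim: (i : nat) => [|k IH]; first by rewrite !expr0 mulr1 U2.
by rewrite !exprS IH !mulrA -(mulrA (U * c)) U1 mulr1 -!mulrA.
Qed.

Lemma peval_Diag (e : nat -> H) (lam : nat -> R) p b :
  is_Diag e (fun k => (lam k)%:C) b -> is_Diag e (fun k => (p.[lam k])%:C) (peval p b).
Proof.
move=> bd k; rewrite /peval bopE_sum horner_coef rmorph_sum scaler_suml.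
apply: eq_bigr => i _; rewrite bopE_Z rmorphM rmorphXn /= -scalerA; congr (_ *: _).
elim: (i : nat) => [|j IH]; first by rewrite !expr0 scale1r.
by rewrite exprSr bopE_M bd bopZ IH scalerA -exprS.
Qed.

Lemma peval_sym p c : (forall x y, ip (c x) y = ip x (c y)) ->
  forall x y, ip (peval p c x) y = ip x (peval p c y).
Proof.
move=> cs x y; rewrite /peval !bopE_sum ip_suml ip_sumr; apply: eq_bigr => i _.
rewrite !bopE_Z ipZl ipZr; congr (_ * _).
elim: (i : nat) x y => [//|k IH] x y.
by rewrite exprSr bopE_M IH cs -bopE_M -exprS exprSr.
Qed.

(** The derivative of c ^+ n in the direction v. *)
Fixpoint dpow c (v : bop H) n : bop H :=
  if n is k.+1 then v * c ^+ k + c * dpow c v k else 0.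
Definition dpeval p c (v : bop H) : bop H := \sum_(i < size p) p`_i *: dpow c v i.

Lemma dpow_comm c Y n : dpow c (Y * c - c * Y) n = Y * c ^+ n - c ^+ n * Y.
Proof.
elim: n => [|n IH] /=; first by rewrite !expr0 mulr1 mul1r subrr.
by rewrite IH !exprS mulrBl mulrBr !mulrA addrA subrK.
Qed.

(** [Y, -] is a derivation. *)
Lemma dpeval_comm p c Y : dpeval p c (Y * c - c * Y) = Y * peval p c - peval p c * Y.
Proof.
rewrite /dpeval /peval mulr_sumr mulr_suml -sumrB; apply: eq_bigr => i _.
by rewrite dpow_comm scalerBr bop_scalerAr bop_scalerAl.
Qed.

Section Curves.
Variables (t : R) (G : set_system R).
Hypothesis (GF : Filter G) (Gt : G `=>` nbhs t) (Gn : \forall s \near G, s != t).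
Variables (eta : R -> bop H) (v : bop H).
Hypothesis eta_v : quot eta t s @[s --> G] --> v.

Lemma quot_pow n : quot (fun s => eta s ^+ n) t s @[s --> G] --> dpow (eta t) v n.
Proof.
elim: n => [|n IH] /=; first by apply: quot_cst.
have -> : (fun s => eta s ^+ n.+1) = (fun s => eta s * eta s ^+ n).
  by apply/funext => s; rewrite exprS.
exact: quotM.
Qed.

Lemma quot_sum (I : Type) (r : seq I) (F : I -> R -> bop H) (L : I -> bop H) :
  (forall i, quot (F i) t s @[s --> G] --> L i) ->
  quot (fun s => \sum_(i <- r) F i s) t s @[s --> G] --> \sum_(i <- r) L i.
Proof.
move=> FL; elim: r => [|i r IH].
  under [X in quot X]eq_fun do rewrite big_nil.
  by rewrite big_nil; exact: quot_cst.
under [X in quot X]eq_fun do rewrite big_cons.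
by rewrite big_cons; apply: quotD.
Qed.

Lemma quot_peval p : quot (fun s => peval p (eta s)) t s @[s --> G] --> dpeval p (eta t) v.
Proof.
by apply: quot_sum => i; apply: quotZ => //; exact: quot_pow.
Qed.

End Curves.

Lemma cvg_bopX (I : Type) (G : set_system I) (GF : Filter G) (f : I -> bop H) c n :
  f s @[s --> G] --> c -> f s ^+ n @[s --> G] --> c ^+ n.
Proof.
move=> fc; elim: n => [|n IH]; first by rewrite expr0; exact: cvg_cst.
rewrite exprS; apply: cvg_ext (cvg_bopM GF fc IH) => s.
by rewrite exprS.
Qed.

Lemma cvg_dpow (I : Type) (G : set_system I) (GF : Filter G) (f g : I -> bop H) c (v : bop H) n :
  f s @[s --> G] --> c -> g s @[s --> G] --> v ->
  dpow (f s) (g s) n @[s --> G] --> dpow c v n.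
Proof.
move=> fc gx; elim: n => [|n IH] /=; first exact: cvg_cst.
apply: cvgD; first by apply: cvg_bopM => //; exact: cvg_bopX.
exact: cvg_bopM.
Qed.

Lemma cvg_big_sum (V : normedModType R) (I J : Type) (G : set_system I) (GF : Filter G)
    (r : seq J) (F : J -> I -> V) (L : J -> V) :
  (forall j, F j s @[s --> G] --> L j) ->
  \sum_(j <- r) F j s @[s --> G] --> \sum_(j <- r) L j.
Proof.
move=> FL; elim: r => [|j r IH].
  by under eq_fun do rewrite big_nil; rewrite big_nil; exact: cvg_cst.
by under eq_fun do rewrite big_cons; rewrite big_cons; exact: cvgD.
Qed.

Lemma cvg_dpeval (I : Type) (G : set_system I) (GF : Filter G) (f g : I -> bop H) c (v : bop H) p :
  f s @[s --> G] --> c -> g s @[s --> G] --> v ->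
  dpeval p (f s) (g s) @[s --> G] --> dpeval p c v.
Proof.
move=> fc gx; apply: cvg_big_sum => i.
by apply: cvgZl_tmp; exact: cvg_dpow.
Qed.

End PolynomialCalculus.

(** * The compression form *)

(** A family (k l j) of coefficients, l in r, attaches to the index j a vector k_j
    of C^r. Let T = sum_j Q j (x) p_j on the sum of r copies of H, with p_j the
    orthogonal projection of C^r on the line of k_j. Then [cform] is the real part of
    <T x, y>; if 0 <= Q j and the Q j sum to at most 1, then 0 <= T <= 1. *)
Section CompressionForm.
Variables (R : realType) (H : completeNormedModType R[i]).
Variable dot : {dot H for (@conjC R[i])}.
Hypothesis dot_norm : forall x : H, dot x x = `|x| ^+ 2.
Local Notation ip := (redot dot).
Variables (I : Type) (r : seq I) (n : nat) (k : I -> nat -> R[i]).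
Implicit Types (x y z : I -> H).

Definition famdot x y : R := \sum_(l <- r) ip (x l) (y l).
Definition weight j : R := \sum_(l <- r) cabs (k l j) ^+ 2.
Definition kcontract j x : H := \sum_(l <- r) conjC (k l j) *: x l.
Definition cform (Q : nat -> bop H) x y : R :=
  \sum_(j < n) (weight j)^-1 * ip (Q j (kcontract j x)) (kcontract j y).

Lemma weight_ge0 j : 0 <= weight j.
Proof. by apply: sumr_ge0 => l _; exact: sqr_ge0. Qed.

Lemma kcontractD j x y : kcontract j (fun l => x l + y l) = kcontract j x + kcontract j y.
Proof. by rewrite -big_split; apply: eq_bigr => l _; rewrite scalerDr. Qed.
Lemma kcontractZ j (a : R) x : kcontract j (fun l => a%:C *: x l) = a%:C *: kcontract j x.
Proof.
rewrite scaler_sumr; apply: eq_bigr => l _.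
by rewrite !scalerA mulrC.
Qed.
Lemma kcontract_bop j (T : bop H) x : kcontract j (fun l => T (x l)) = T (kcontract j x).
Proof. by rewrite bop_sum; apply: eq_bigr => l _; rewrite bopZ. Qed.

Section Form.
Variable Q : nat -> bop H.
Hypothesis Qsym : forall j u w, ip (Q j u) w = ip u (Q j w).
Hypothesis Qpos : forall j u, (j < n)%N -> 0 <= ip (Q j u) u.
Hypothesis Qsum : forall u, \sum_(j < n) ip (Q j u) u <= ip u u.
Local Notation beta := (cform Q).

Lemma cform_ge0 x : 0 <= beta x x.
Proof.
apply: sumr_ge0 => j _; rewrite mulr_ge0 ?invr_ge0 ?weight_ge0//.
exact: Qpos.
Qed.

Lemma cform_quad x y (t : R) : beta (fun l => x l + t%:C *: y l) (fun l => x l + t%:C *: y l) =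
  beta x x + 2 * t * beta x y + t ^+ 2 * beta y y.
Proof.
rewrite /cform !mulr_sumr -!big_split /=; apply: eq_bigr => j _.
rewrite kcontractD kcontractZ bopD bopZ !(ipDl,ipDr,ipZl,ipZr).
have -> : ip (Q j (kcontract j y)) (kcontract j x) = ip (Q j (kcontract j x)) (kcontract j y).
  by rewrite Qsym ipC.
ring.
Qed.

Lemma famdot_quad x y (t : R) :
  famdot (fun l => x l + t%:C *: y l) (fun l => x l + t%:C *: y l) =
  famdot x x + 2 * t * famdot x y + t ^+ 2 * famdot y y.
Proof.
rewrite /famdot !mulr_sumr -!big_split /=; apply: eq_bigr => l _.
by rewrite !(ipDl,ipDr,ipZl,ipZr) (ipC dot (y l) (x l)); ring.
Qed.

(** The projection p_j does not increase the form of Q j: complete the square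
    around the component of the family along k_j. *)
Lemma kcontract_le j x : (j < n)%N ->
  (weight j)^-1 * ip (Q j (kcontract j x)) (kcontract j x) <=
  \sum_(l <- r) ip (Q j (x l)) (x l).
Proof.
move=> jn; set q := weight j; set W := kcontract j x.
have [q0|q0] := eqVneq q 0.
  by rewrite q0 invr0 mul0r sumr_ge0// => l _; exact: Qpos.
(* w is kept abstract, so that rewriting does not see through it. *)
have [w wE] : exists w, w = (q^-1)%:C *: W by exists ((q^-1)%:C *: W).
have : 0 <= \sum_(l <- r) ip (Q j (x l - k l j *: w)) (x l - k l j *: w).
  by apply: sumr_ge0 => l _; exact: Qpos.
have -> : \sum_(l <- r) ip (Q j (x l - k l j *: w)) (x l - k l j *: w) =
  \sum_(l <- r) ip (Q j (x l)) (x l) - 2 * ip (Q j W) w + q * ip (Q j w) w.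
  have -> : ip (Q j W) w = \sum_(l <- r) ip (Q j (x l)) (k l j *: w).
    rewrite /W /kcontract bop_sum ip_suml; apply: eq_bigr => l _.
    by rewrite bopZ /redot dotZl dotZr.
  rewrite /q /weight mulr_suml mulr_sumr -sumrB -big_split /=; apply: eq_bigr => l _.
  rewrite bopB !(ipBl, ipBr).
  have -> : ip (Q j (k l j *: w)) (x l) = ip (Q j (x l)) (k l j *: w).
    by rewrite Qsym ipC.
  have -> : ip (Q j (k l j *: w)) (k l j *: w) = cabs (k l j) ^+ 2 * ip (Q j w) w.
    rewrite bopZ /redot dotZl dotZr mulrA -sqr_normc cabsE -rmorphXn /=.
    by rewrite Re_mul /= mul0r subr0.
  ring.
rewrite wE bopZ !ipZl !ipZr => h.
have -> : q^-1 * ip (Q j W) W =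
  2 * (q^-1 * ip (Q j W) W) - q * (q^-1 * (q^-1 * ip (Q j W) W)).
  by field.
by rewrite -subr_ge0; move: h; congr (_ <= _); ring.
Qed.

Lemma cform_le x : beta x x <= famdot x x.
Proof.
apply: le_trans (_ : \sum_(j < n) \sum_(l <- r) ip (Q j (x l)) (x l) <= _).
  by apply: ler_sum => j _; exact: kcontract_le.
by rewrite exchange_big; apply: ler_sum => l _; exact: Qsum.
Qed.

Lemma cform_CS x y : beta x y ^+ 2 <= beta x x * beta y y.
Proof.
apply: quadratic_ge0; last exact: cform_ge0.
by move=> t; rewrite -cform_quad cform_ge0.
Qed.

(** Cauchy-Schwarz for the complementary form of 1 - T. *)
Lemma coform_CS x y : (famdot x y - beta x y) ^+ 2 <=
  (famdot x x - beta x x) * (famdot y y - beta y y).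
Proof.
apply: quadratic_ge0; last by rewrite subr_ge0 cform_le.
move=> t; have := cform_le (fun l => x l + t%:C *: y l).
by rewrite cform_quad famdot_quad -subr_ge0; congr (_ <= _); ring.
Qed.

(** As x and y are orthogonal, T and 1 - T have opposite entries at (x, y), so this
    entry is bounded by both Cauchy-Schwarz inequalities; weight them by 1 - <T x, x>
    and <T x, x> and add. *)
Lemma cform_orth x y : famdot x x = 1 -> famdot x y = 0 ->
  beta x y ^+ 2 <= beta x x * (1 - beta x x) * famdot y y.
Proof.
move=> x1 xy; have := cform_CS x y; have := coform_CS x y.
rewrite x1 xy sub0r sqrrN => h1 h2.
have := cform_ge0 x; have := cform_le x; rewrite x1 => h3 h4.
have -> : beta x y ^+ 2 = (1 - beta x x) * beta x y ^+ 2 + beta x x * beta x y ^+ 2 by ring.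
have -> : beta x x * (1 - beta x x) * famdot y y =
  (1 - beta x x) * (beta x x * beta y y) + beta x x * ((1 - beta x x) * (famdot y y - beta y y)) by ring.
by apply: lerD; apply: ler_wpM2l => //; rewrite subr_ge0.
Qed.

(** The derivative of <T x, x> when the Q j move with velocity [Y, Q j]: it is
    -2 <T x, Y x>, and Y x is orthogonal to x in real part. *)
Lemma cform_derivative (Y : bop H) x :
  (forall u w, ip (Y u) w = - ip u (Y w)) -> famdot x x = 1 ->
  (cform (fun j => Y * Q j - Q j * Y) x x) ^+ 2 <=
  4 * (beta x x * (1 - beta x x)) * `|Y| ^+ 2.
Proof.
move=> YA x1; pose y l := Y (x l).
have -> : cform (fun j => Y * Q j - Q j * Y) x x = - 2 * beta x y.
  rewrite /cform mulr_sumr; apply: eq_bigr => j _.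
  rewrite /y kcontract_bop bopE_B !bopE_M ipBl YA.
  have -> : ip (Q j (Y (kcontract j x))) (kcontract j x) =
      ip (Q j (kcontract j x)) (Y (kcontract j x)) by rewrite Qsym ipC.
  ring.
have xy : famdot x y = 0.
  rewrite /famdot big1// => l _; have := YA (x l) (x l); rewrite ipC /y.
  by lra.
have yy : famdot y y <= `|Y| ^+ 2.
  rewrite -[leRHS]mulr1 -x1 /famdot mulr_sumr; apply: ler_sum => l _.
  rewrite !(ip_norm dot_norm) -exprMn; apply: lerXn2r; rewrite ?nnegrE ?mulr_ge0 ?rnorm_ge0//.
  exact: opnorm_bound.
have := cform_orth x1 xy; set b := beta x x => h.
have b0 : 0 <= b * (1 - b) by rewrite mulr_ge0 ?cform_ge0// subr_ge0 -x1 cform_le.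
have h2 : beta x y ^+ 2 <= b * (1 - b) * `|Y| ^+ 2.
  by apply: le_trans h _; rewrite ler_wpM2l.
have -> : (- 2 * beta x y) ^+ 2 = 4 * beta x y ^+ 2 by ring.
by rewrite -mulrA ler_pM2l.
Qed.

Lemma cform_perturb x y (rho : R) : 0 <= rho ->
  famdot y y <= 1 -> famdot (fun l => x l - y l) (fun l => x l - y l) <= rho ^+ 2 ->
  beta y y - 2 * rho <= beta x x <= beta y y + 2 * rho + rho ^+ 2.
Proof.
move=> r0 y1; set d := fun l => x l - y l => dr.
have -> : beta x x = beta y y + 2 * beta y d + beta d d.
  have := cform_quad y d 1; rewrite mulr1 expr1n mul1r => <-.
  have -> : (fun l => y l + 1%:C *: d l) = x.
    by apply/funext => l; rewrite scale1r /d addrC subrK.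
  by [].
have dd := cform_le d; have d0 := cform_ge0 d.
have yy := cform_le y; have yy0 := cform_ge0 y.
have CS := cform_CS y d.
have : `|beta y d| <= rho.
  rewrite -(@ler_pXn2r _ 2)// ?nnegrE// real_normK ?num_real//.
  apply: le_trans CS _; rewrite -[leRHS]mul1r; apply: ler_pM => //.
    exact: le_trans yy y1.
  exact: le_trans dd dr.
rewrite ler_norml => /andP[h1 h2]; apply/andP; split; lra.
Qed.

End Form.
End CompressionForm.

(** * Angles and lengths *)

Section LowerIntegrals.
Variable R : realType.
Local Notation mu := (@lebesgue_measure R).
Local Open Scope ereal_scope.

(** The integral of a nonnegative function is a supremum over the simple functions
    below it, so no measurability is needed; the speed of a curve, an infimum over
    uncountably many lifts, comes without any. *)
Lemma ge0_integral_mono (D : set R) (f g : R -> \bar R) :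
  (forall x, D x -> 0 <= f x) -> (forall x, D x -> f x <= g x) ->
  \int[mu]_(x in D) f x <= \int[mu]_(x in D) g x.
Proof.
move=> f0 fg; have g0 x : D x -> 0 <= g x by move=> Dx; apply: le_trans (fg x Dx); exact: f0.
rewrite !ge0_integralE//; apply: le_ereal_sup => _ [h /= hf <-].
exists h => // x; apply: le_trans (hf x) _; rewrite /patch; case: ifP => // xD.
by apply: fg; rewrite inE in xD.
Qed.

Lemma integral_le_lower (D : set R) (f : R -> R) (g : R -> \bar R) :
  (forall x, D x -> 0 <= g x) -> (forall x, D x -> (f x)%:E <= g x) ->
  \int[mu]_(x in D) (f x)%:E <= \int[mu]_(x in D) g x.
Proof.
move=> g0 fg; rewrite integralE.
apply: le_trans (_ : \int[mu]_(x in D) (fun x => (f x)%:E)^\+ x <= _).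
  rewrite -[leRHS]sube0; apply: leeB => //; exact: integral_ge0.
apply: ge0_integral_mono => // x Dx.
by rewrite funeposE ge_max fg// g0.
Qed.

End LowerIntegrals.

Section AngleLength.
Variables (R : realType) (a1 a2 : R) (f f' : R -> R) (F : R -> \bar R).
Hypothesis a12 : a1 < a2.
Hypothesis f01 : forall t, t \in `[a1, a2] -> 0 <= f t <= 1.
Hypothesis fc : {within `[a1, a2], continuous f}.
Hypothesis fd : forall t, t \in `]a1, a2[ -> is_derive t 1 f (f' t).
Hypothesis fc' : {within `[a1, a2], continuous f'}.
Hypothesis F0 : forall t, t \in `[a1, a2] -> (0 <= F t)%E.
Hypothesis FP : forall t m, t \in `[a1, a2] ->
  (forall y, 0 <= y -> f' t ^+ 2 <= 4 * (f t * (1 - f t)) * y ^+ 2 -> m <= y) ->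
  (m%:E <= F t)%E.

(** If f = cos^2 of an angle, the angle is arccos (2 f - 1) / 2, and the hypothesis
    on f' says that F bounds its speed. The factor 1 - delta keeps arccos away from
    its singular endpoints and does not increase the speed. *)
Lemma angle_length (delta : R) : 0 < delta -> delta < 1 ->
  (((acos ((1 - delta) * (2 * f a1 - 1)) - acos ((1 - delta) * (2 * f a2 - 1))) / 2)%:E
   <= \int[lebesgue_measure]_(t in `[a1, a2]) F t)%E.
Proof.
move=> d0 d1.
pose u t := (1 - delta) * (2 * f t - 1).
have u1 t : t \in `[a1, a2] -> -1 < u t < 1.
  by move=> /f01 /andP[h1 h2]; rewrite /u; apply/andP; split; nra.
have uc : {within `[a1, a2], continuous u}.
  move=> t; apply: cvgM; first exact: cvg_cst.
  by apply: cvgB; [apply: cvgM; [exact: cvg_cst|exact: fc]|exact: cvg_cst].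
have s0 t : t \in `[a1, a2] -> 0 < 1 - u t ^+ 2.
  by move=> /u1 /andP[h1 h2]; nra.
pose Phi t := - (acos (u t) / 2).
pose phi t := (1 - delta) * f' t * (Num.sqrt (1 - u t ^+ 2))^-1.
have Phic : {within `[a1, a2], continuous Phi}.
  apply: (subspace_continuousP _ _).2 => t tab.
  apply: cvgN; apply: cvgM; last exact: cvg_cst.
  have ut := (subspace_continuousP _ _).1 uc t tab.
  apply: continuous_cvg => //; apply: continuous_acos; exact: u1.
have phic : {within `[a1, a2], continuous phi}.
  apply: (subspace_continuousP _ _).2 => t tab.
  have ut := (subspace_continuousP _ _).1 uc t tab.
  have ft := (subspace_continuousP _ _).1 fc' t tab.
  apply: cvgM; first by apply: cvgM; [exact: cvg_cst|exact: ft].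
  apply: cvgV; first by rewrite sqrtr_eq0 -ltNge s0.
  apply: continuous_cvg; first exact: sqrt_continuous.
  by apply: cvgB; [exact: cvg_cst|exact: (cvgM ut ut)].
have Phid t : t \in `]a1, a2[ -> is_derive t 1 Phi (phi t).
  move=> tab; have tab' : t \in `[a1, a2] by apply: subset_itv_oo_cc.
  have d_f := fd tab.
  have du : is_derive t 1 u (2 * (1 - delta) * f' t).
    have -> : u = (2 * (1 - delta)) *: f + cst (- (1 - delta)).
      by apply/funext => s; rewrite /u /cst /= !fctE /= /GRing.scale /=; ring.
    by apply: is_derive_eq; rewrite subr0.
  have da := @is_derive1_comp R acos u t _ _ (is_derive1_acos (u1 _ tab')) du.
  have -> : Phi = (- (1 / 2)) *: (acos \o u).
    by apply/funext => s; rewrite /Phi /= !fctE /= /GRing.scale /=; ring.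
  by apply: is_derive_eq; rewrite /phi /GRing.scale /=; field; rewrite gt_eqF// sqrtr_gt0 s0.
have FTC : (\int[lebesgue_measure]_(t in `[a1, a2]) (phi t)%:E = (Phi a2)%:E - (Phi a1)%:E)%E.
  apply: continuous_FTC2 => //.
    have /continuous_within_itvP [] := Phic; first exact: a12.
    by move=> _ h1 h2; split=> // t /Phid [].
  by move=> t /Phid h; rewrite derive1E; case: h.
apply: le_trans (_ : (\int[lebesgue_measure]_(t in `[a1, a2]) (phi t)%:E <= _)%E).
  by rewrite FTC -EFinB lee_fin /Phi /u; lra.
apply: integral_le_lower => t /= tab; first exact: F0.
apply: FP => // y y0 hy.
have st := s0 t tab; have sq : 0 < Num.sqrt (1 - u t ^+ 2) by rewrite sqrtr_gt0.
rewrite /phi ler_pdivrMr//.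
have [neg|pos] := leP ((1 - delta) * f' t) 0.
  by apply: le_trans neg _; rewrite mulr_ge0// ltW.
rewrite -(@ler_pXn2r _ 2)// ?nnegrE ?(ltW pos) ?mulr_ge0 ?(ltW sq)//.
rewrite exprMn [leRHS]exprMn sqr_sqrtr ?(ltW st)//.
have /andP[f0 f1] := f01 tab.
apply: le_trans (_ : (1 - delta) ^+ 2 * (4 * (f t * (1 - f t)) * y ^+ 2) <= _).
  by rewrite ler_wpM2l// sqr_ge0.
have -> : (1 - delta) ^+ 2 * (4 * (f t * (1 - f t)) * y ^+ 2) =
  y ^+ 2 * ((1 - delta) ^+ 2 - u t ^+ 2) by rewrite /u; ring.
rewrite ler_wpM2l ?sqr_ge0// lerD2r.
by rewrite -[leRHS](expr1n _ 2); apply: lerXn2r; rewrite ?nnegrE; lra.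
Qed.

End AngleLength.

(** * Lower bound for the length of a curve *)

Section WithinLimits.
Variable R : realType.

Lemma within_dnbhs_sub (a1 a2 t : R) : within `[a1, a2] t^' `=>` nbhs t.
Proof.
move=> A At; change (\forall s \near t, s != t -> s \in `[a1, a2] -> A s).
by apply: filterS At => s As _ _.
Qed.

Lemma within_dnbhs_neq (a1 a2 t : R) : \forall s \near within `[a1, a2] t^', s != t.
Proof.
change (\forall s \near t, s != t -> s \in `[a1, a2] -> s != t).
by apply: (@nearW _ (nbhs t)) => s st _.
Qed.

Lemma cvg_within_dnbhs (V : normedModType R) (f : R -> V) (a1 a2 t : R) :
  f s @[s --> within `[a1, a2] t^'] --> f t ->
  f s @[s --> within `[a1, a2] (nbhs t)] --> f t.
Proof.
move=> ft A At; have := ft A At => {}ft.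
have {}ft : \forall s \near t, s != t -> s \in `[a1, a2] -> A (f s) := ft.
change (\forall s \near t, s \in `[a1, a2] -> A (f s)).
apply: filterS ft => s hs sab; have [->|st] := eqVneq s t; last exact: hs.
exact: nbhs_singleton At.
Qed.

Lemma within_interior (V : normedModType R) (f : R -> V) (a1 a2 t : R) (L : V) :
  t \in `]a1, a2[ ->
  f s @[s --> within `[a1, a2] t^'] --> L -> f s @[s --> t^'] --> L.
Proof.
move=> tab fL A AL; have := fL A AL => {}fL.
have {}fL : \forall s \near t, s != t -> s \in `[a1, a2] -> A (f s) := fL.
change (\forall s \near t, s != t -> A (f s)).
have : \forall s \near t, s \in `]a1, a2[ by exact: near_in_itvoo.
move=> tn; near=> s => st; have := near fL s; apply => //.
by apply: subset_itv_oo_cc; near: s.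
Unshelve. all: by end_near. Qed.

End WithinLimits.

Section CurveLowerBound.
Variables (R : realType) (H : completeNormedModType R[i]).
Variable dot : {dot H for (@conjC R[i])}.
Hypothesis dot_norm : forall x : H, dot x x = `|x| ^+ 2.
Variable e : nat -> H.
Hypothesis he : orthonormal_basis dot e.
Local Notation ip := (redot dot).

(** U' stands for the adjoint of U, so that the default value of [adj] does not
    interfere with compositions. *)
Definition unitary_conj (b c : bop H) := exists U U' : bop H,
  [/\ U' * U = 1, U * U' = 1, forall x y, ip (U x) y = ip x (U' y) & c = U * b * U'].

Lemma orbit_unitary_conj (A u b c : bop H) : Uc dot u -> A = u * b * adj dot u ->
  unitary_orbit dot A c -> unitary_conj b c.
Proof.
move=> [uu _] -> [w [wu _] <-].
have [u1 _ _] := unitaryP (e_neq0 dot_norm he 0) uu.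
have [w1 _ _] := unitaryP (e_neq0 dot_norm he 0) wu.
case: uu => u2 u3; case: wu => w2 w3.
exists (w * u), (adj dot u * adj dot w); split.
- by rewrite -mulrA (mulrA _ w) w2 mul1r.
- by rewrite -mulrA (mulrA u) u3 mul1r.
- move=> x y; rewrite !bopE_M.
  have w4 z : w (adj dot w z) = z by rewrite -bopE_M w3.
  have u4 z : u (adj dot u z) = z by rewrite -bopE_M u3.
  by rewrite /redot -{1}(w4 y) w1 -{1}(u4 (adj dot w y)) u1.
- by rewrite !mulrA.
Qed.

(** Exact on truncations, hence true by continuity. *)
Lemma Diag_real_sym (b : bop H) (lam : nat -> R) : is_Diag e (fun k => (lam k)%:C) b ->
  forall x y, ip (b x) y = ip x (b y).
Proof.
move=> bd x y; apply/eqP; rewrite -subr_eq0 -normr_eq0; apply/eqP.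
apply/eqP; rewrite eq_le normr_ge0 andbT; apply/ler_addgt0Pl => eps e0; rewrite addr0.
pose C := 2 * `|b| * rnorm x + 1.
have C0 : 0 < C by rewrite ltr_wpDl// !mulr_ge0// rnorm_ge0.
have [n /(_ _ (leqnn n)) NP] := Pr_cvg dot_norm he y (divr_gt0 e0 C0).
set p := Pr dot_norm he n y in NP.
have pE : ip (b x) p = ip x (b p).
  rewrite /p PrE bop_sum !ip_sumr; apply: eq_bigr => k _.
  rewrite bopZ bd /redot !dotZr (dot_Diag dot_norm he bd).
  by rewrite conjC_real.
have -> : ip (b x) y - ip x (b y) = ip (b x) (y - p) - ip x (b (y - p)).
  by rewrite bopB !ipBr pE; ring.
have h1 : `|ip (b x) (y - p)| <= `|b| * rnorm x * rnorm (y - p).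
  apply: le_trans (ip_CS dot_norm _ _) _.
  by rewrite ler_wpM2r ?rnorm_ge0// opnorm_bound.
have h2 : `|ip x (b (y - p))| <= `|b| * rnorm x * rnorm (y - p).
  apply: le_trans (ip_CS dot_norm _ _) _; rewrite -mulrA mulrCA.
  by rewrite ler_wpM2l ?rnorm_ge0// opnorm_bound.
have h3 : C * rnorm (y - p) <= eps by rewrite mulrC -ler_pdivlMr// ltW.
have h4 := rnorm_ge0 (y - p).
apply: le_trans (ler_normB _ _) _; rewrite /C in h3; lra.
Qed.

Variables (b : bop H) (lam : nat -> R).
Hypothesis b_Diag : is_Diag e (fun k => (lam k)%:C) b.
Variables (n : nat) (psi : nat -> {poly R}).
Hypothesis psi_ge0 : forall i j, (j < n)%N -> 0 <= (psi j).[lam i].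
Hypothesis psi_le1 : forall i, \sum_(j < n) (psi j).[lam i] <= 1.

Section Conjugate.
Variables (c : bop H).
Hypothesis bc : unitary_conj b c.
Local Notation Q := (fun j => peval (psi j) c).

Lemma conj_sym x y : ip (c x) y = ip x (c y).
Proof.
have [U [U' [_ _ UU ->]]] := bc.
by rewrite !bopE_M UU (Diag_real_sym b_Diag) [RHS]ipC UU ipC.
Qed.

Lemma spectral_sym j x y : ip (Q j x) y = ip x (Q j y).
Proof. by apply: peval_sym => {}x {}y; exact: conj_sym. Qed.

Lemma spectral_ge0 j x : (j < n)%N -> 0 <= ip (Q j x) x.
Proof.
move=> jn; have [U [U' [U1 U2 UU ->]]] := bc.
rewrite peval_conj// !bopE_M UU.
by apply: (Diag_ge0 dot_norm he _ (peval_Diag _ b_Diag)) => k; exact: psi_ge0.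
Qed.

Lemma spectral_le1 x : \sum_(j < n) ip (Q j x) x <= ip x x.
Proof.
have [U [U' [U1 U2 UU ->]]] := bc.
have -> : ip x x = ip (U' x) (U' x) by rewrite -UU -bopE_M U2.
under eq_bigr do rewrite peval_conj// !bopE_M UU.
move: (U' x) => {}x.
pose T : bop H := 1 - \sum_(j < n) peval (psi j) b.
have Td : is_Diag e (fun k => (1 - \sum_(j < n) (psi j).[lam k])%:C) T.
  move=> k; rewrite /T bopE_B bopE_sum rmorphB rmorph1 rmorph_sum /= scalerBl scale1r scaler_suml.
  congr (_ - _); apply: eq_bigr => j _; exact: (peval_Diag _ b_Diag).
have := Diag_ge0 dot_norm he x Td; rewrite /T bopE_B bopE_sum ipBl ip_suml subr_ge0; apply.
by move=> k; rewrite subr_ge0.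
Qed.

End Conjugate.

Variables (I : Type) (r : seq I) (k : I -> nat -> R[i]) (zeta : I -> H).
Hypothesis zeta1 : famdot dot r zeta zeta = 1.
(** Smoothed squared cosine of the angle between zeta and the subspace attached
    to c. *)
Definition overlap (c : bop H) : R := cform dot r n k (fun j => peval (psi j) c) zeta zeta.

Lemma overlap01 c : unitary_conj b c -> 0 <= overlap c <= 1.
Proof.
move=> bc; apply/andP; split.
  apply: cform_ge0 => // j u jn; exact: spectral_ge0.
rewrite -zeta1; apply: cform_le => //.
- by move=> j u w; exact: spectral_sym.
- by move=> j u jn; exact: spectral_ge0.
- by move=> u; exact: spectral_le1.
Qed.

Variables (M : set (bop H)) (a1 a2 : R) (eta : R -> bop H).
Hypothesis Mb : forall c, M c -> unitary_conj b c.
Hypothesis eta_smooth : smooth_curve M a1 a2 eta.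

Let v t := velocity a1 a2 eta t.
Let f t := overlap (eta t).
Let f' t := cform dot r n k (fun j => dpeval (psi j) (eta t) (v t)) zeta zeta.

Lemma quot_eta t : t \in `[a1, a2] ->
  quot eta t s @[s --> within `[a1, a2] t^'] --> v t.
Proof. by case: eta_smooth => _ _ h _ _ /h. Qed.

Lemma quot_real_sum (t : R) (G : set_system R) (GF : Filter G) (J : Type) (s : seq J)
    (F : J -> R -> R) (L : J -> R) :
  (forall i, quot (F i) t u @[u --> G] --> L i) ->
  quot (fun u => \sum_(i <- s) F i u) t u @[u --> G] --> \sum_(i <- s) L i.
Proof.
move=> FL; elim: s => [|i s IH].
  under [X in quot X]eq_fun do rewrite big_nil.
  by rewrite big_nil; exact: quot_cst.
under [X in quot X]eq_fun do rewrite big_cons.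
by rewrite big_cons; apply: quotD.
Qed.

Lemma quot_overlap t : t \in `[a1, a2] ->
  quot f t s @[s --> within `[a1, a2] t^'] --> f' t.
Proof.
move=> tab; apply: quot_real_sum => j.
apply: quotZ; apply: quot_ip => //; apply: quot_peval.
- exact: within_dnbhs_sub.
- exact: within_dnbhs_neq.
- exact: quot_eta.
Qed.

Lemma eta_continuous t : t \in `[a1, a2] ->
  eta s @[s --> within `[a1, a2] (nbhs t)] --> eta t.
Proof.
move=> tab; apply: cvg_within_dnbhs.
exact: (quot_continuous _ (@within_dnbhs_sub R a1 a2 t) (within_dnbhs_neq a1 a2 t) (quot_eta tab)).
Qed.

(** Each admissible lift Y of the velocity bounds the derivative of the overlap by
    [cform_derivative]; the Finsler norm is the infimum of the |Y|. *)
Lemma curve_length_ge (delta : R) : 0 < delta -> delta < 1 ->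
  (((acos ((1 - delta) * (2 * overlap (eta a1) - 1)) -
     acos ((1 - delta) * (2 * overlap (eta a2) - 1))) / 2)%:E
   <= curve_length dot a1 a2 eta)%E.
Proof.
case: (eta_smooth) => a12 etaM _ vc _ d0 d1.
apply: (@angle_length R a1 a2 f f') => //.
- by move=> t /etaM /Mb; exact: overlap01.
- apply: (subspace_continuousP _ _).2 => t tab.
  apply: cvg_within_dnbhs.
  exact: (quot_continuous _ (@within_dnbhs_sub R a1 a2 t) (within_dnbhs_neq a1 a2 t) (quot_overlap tab)).
- move=> t tab; apply: quot_is_derive; apply: (within_interior tab).
  by apply: quot_overlap; exact: subset_itv_oo_cc.
- apply: (subspace_continuousP _ _).2 => t tab.
  have vt := (subspace_continuousP _ _).1 vc t tab.
  apply: cvg_big_sum => j; apply: cvgM; first exact: cvg_cst.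
  apply: cvg_bop_ip => //; apply: cvg_dpeval => //; exact: eta_continuous.
- move=> t _; apply: le_ereal_inf_tmp => _ [Y _ <-].
  by rewrite lee_fin.
move=> t m tab hm; apply: le_ereal_inf_tmp => _ [Y [YK Yv] <-].
rewrite lee_fin; apply: hm => //.
have bc := Mb (etaM t tab).
have -> : f' t = cform dot r n k (fun j => Y * peval (psi j) (eta t) - peval (psi j) (eta t) * Y) zeta zeta.
  apply: eq_bigr => j _; congr (_ * _).
  by rewrite /v -Yv dpeval_comm.
apply: (cform_derivative dot_norm) => //.
- by move=> j u w; exact: spectral_sym.
- by move=> j u jn; exact: spectral_ge0.
- by move=> u; exact: spectral_le1.
- exact: antiherm_ip YK.2.
Qed.

End CurveLowerBound.

(** * Length of the exponential curve *)

Section Velocities.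
Variable R : realType.

Lemma within_dnbhs_proper (a1 a2 t : R) : a1 < a2 -> t \in `[a1, a2] ->
  ProperFilter (within `[a1, a2] t^').
Proof.
move=> a12 tab; apply: Build_ProperFilter => w0.
have {}w0 : \forall s \near t, s != t -> s \in `[a1, a2] -> False := w0.
move: tab; rewrite in_itv /= => /andP[t1 t2].
have [tl|tr] := ltP t a2.
  have : \forall s \near t^'+, False.
    near=> s; have st : t < s by near: s; exact: nbhs_right_gt.
    have sa : s < a2 by near: s; exact: nbhs_right_lt.
    have : s != t -> s \in `[a1, a2] -> False.
      by near: s; exact: (@cvg_within _ (nbhs t) _ _ _ w0).
    apply.
    - by rewrite gt_eqF.
    - by rewrite in_itv /= (le_trans t1 (ltW st)) ltW.
  exact: filter_not_empty.
have ta : a1 < t by apply: lt_le_trans tr.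
have : \forall s \near t^'-, False.
  near=> s; have st : s < t by near: s; exact: nbhs_left_lt.
  have sa : a1 < s by near: s; exact: nbhs_left_gt.
  have : s != t -> s \in `[a1, a2] -> False.
    by near: s; exact: (@cvg_within _ (nbhs t) _ _ _ w0).
  apply.
  - by rewrite lt_eqF.
  - by rewrite in_itv /= (ltW sa) (le_trans (ltW st) t2).
exact: filter_not_empty.
Unshelve. all: by end_near. Qed.

Lemma velocity_of_quot (H : completeNormedModType R[i]) (a1 a2 t : R) (eta : R -> bop H) L :
  a1 < a2 -> t \in `[a1, a2] -> quot eta t s @[s --> t^'] --> L ->
  velocity a1 a2 eta t = L.
Proof.
move=> a12 tab qL.
have PF := within_dnbhs_proper a12 tab.
apply: (@cvg_lim _ (@norm_hausdorff _ (bop H)) _ _ PF).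
exact: cvg_trans (cvg_app _ (cvg_within _)) qL.
Qed.

End Velocities.

Section ExponentialCurveLength.
Variables (R : realType) (H : completeNormedModType R[i]).
Variable dot : {dot H for (@conjC R[i])}.
Hypothesis dot_norm : forall x : H, dot x x = `|x| ^+ 2.
Variable e : nat -> H.
Hypothesis he : orthonormal_basis dot e.
Local Notation ip := (redot dot).

Lemma antihermD S T : antihermitian_op dot S -> antihermitian_op dot T ->
  antihermitian_op dot (S + T).
Proof.
move=> /(antihermP dot_norm) S1 /(antihermP dot_norm) T1; apply/(antihermP dot_norm) => x y.
by rewrite !bopE_D dotDl dotDr S1 T1 opprD.
Qed.

Lemma antihermN S : antihermitian_op dot S -> antihermitian_op dot (- S).
Proof.
move=> /(antihermP dot_norm) S1; apply/(antihermP dot_norm) => x y.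
by rewrite !bopE_N linearNl /= linearNr S1.
Qed.

Lemma antiherm_scalar (l : R[i]) : complex.Re l = 0 -> antihermitian_op dot (bop_scale l (1 : bop H)).
Proof.
move=> l0; apply/(antihermP dot_norm) => x y; rewrite !bopE_S !bopE_1 dotZl dotZr -mulNr.
congr (_ * _); apply: complex_eq; rewrite ?(Re_opp,Im_opp,Re_conjE,Im_conjE) ?opprK//.
by rewrite l0 oppr0.
Qed.

Lemma DKahB S T : DKah dot e S -> DKah dot e T -> DKah dot e (S - T).
Proof.
move=> [[Sc SA] [s Ss]] [[Tc TA] [t Tt]]; split; first split.
- by apply: compactD => //; exact: compactN.
- by apply: antihermD => //; exact: antihermN.
- by exists (fun k => s k - t k) => k; rewrite bopE_B Ss Tt scalerBl.
Qed.

(** Its entries tend to 0, so it is the norm limit of its truncations. *)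
Lemma diag_sub_limit D (l : R[i]) : DBah dot e D -> complex.Re l = 0 ->
  entry dot e D j @[j --> \oo] --> (l : R[i]^o) -> DKah dot e (D - bop_scale l 1).
Proof.
move=> [DA [d Dd]] l0 dl.
have Td : is_Diag e (fun k => d k - l) (D - bop_scale l 1).
  by move=> k; rewrite bopE_B bopE_S bopE_1 Dd scalerBl.
split; last by exists (fun k => d k - l).
split; last by apply: antihermD => //; apply/antihermN/antiherm_scalar.
apply: (compact_of_tail (dot_norm := dot_norm) (he := he)) => eps e0.
have epos : 0 < eps%:C :> R[i] by rewrite ltcR.
have [N _ NP] := (@cvgrPdist_lt R[i] R[i]^o _ \oo _ (entry dot e D) l).1 dl eps%:C epos.
exists N; apply: opnorm_le_bound => [|x]; first exact: ltW.
rewrite bopE_B bopE_M.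
apply: le_trans (Diag_le dot_norm he Td (n := N) _ (_ : forall k, cabs (d k - l) <= eps \/ (k < N)%N) (ltW e0)) _.
  move=> k; have [kN|Nk] := ltnP k N; [by right|left].
  have := NP k Nk; rewrite /= /entry Dd dotZl (dot_ee he) eqxx mulr1 distrC.
  by rewrite cabsE ltcR => /ltW.
by rewrite ler_wpM2l ?(ltW e0)// rnorm_PrC.
Qed.

(** Diagonal operators act by scalars on coordinates. *)
Lemma Diag_comm S T s t : is_Diag e s S -> is_Diag e t T -> S * T = T * S.
Proof.
move=> Ss Tt; apply/bopP => x; apply: (basis_ext dot_norm he) => k.
rewrite !bopE_M (dot_Diag dot_norm he Ss) (dot_Diag dot_norm he Tt).
by rewrite (dot_Diag dot_norm he Tt) (dot_Diag dot_norm he Ss) mulrCA.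
Qed.

Variables (b Y : bop H) (lam : nat -> R).
Hypothesis b_Diag : is_Diag e (fun k => (lam k)%:C) b.
Hypothesis Y_Kah : Kah dot Y.

Let chi (t : R) := bexp (t *: Y) * b * bexp (- (t *: Y)).

(** e^{tY} (Y + D) e^{-tY} is an admissible lift of the velocity: D commutes with b
    and Y with e^{tY}. *)
Lemma finsler_chi_le t0 t D : 0 < t0 -> t \in `[0, t0] -> DKah dot e D ->
  (finsler_norm dot (chi t) (velocity 0 t0 chi t) <= `|Y + D|%:E)%E.
Proof.
move=> t00 tab [[Dc DA] [d Dd]]; have [Yc YA] := Y_Kah.
set E := bexp (t *: Y); set E' := bexp (- (t *: Y)).
have E1 : E' * E = 1 by exact: bexpN.
have EY : Y * E = E * Y by exact: bexp_comm.
have EY' : Y * E' = E' * Y.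
  by rewrite /E' -scalerN; apply: bexp_comm; rewrite mulrN mulNr.
have Eadj u w : dot (E u) w = dot u (E' w) by exact: bexp_dot_adj.
rewrite (velocity_of_quot t00 tab (@quot_conj _ _ Y b t)).
pose X := E * (Y + D) * E'.
apply: le_trans (_ : `|X|%:E <= _)%E.
  apply: ereal_inf_lbound; exists X => //; split.
    split; first by apply: compactMr; apply: compactMl; exact: compactD.
    apply/(antihermP dot_norm) => x y; rewrite /X !bopE_M.
    rewrite Eadj.
    have /(antihermP dot_norm) -> : antihermitian_op dot (Y + D) by exact: antihermD.
    by congr (- _); rewrite (dotC dot) -/E' -Eadj -(dotC dot).
  have -> : X * chi t - chi t * X = E * ((Y + D) * b - b * (Y + D)) * E'.
    rewrite /X /chi -/E -/E' mulrBr mulrBl !mulrA.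
    by congr (_ - _); rewrite -(mulrA _ E' E) E1 mulr1.
  have -> : (Y + D) * b - b * (Y + D) = Y * b - b * Y.
    by rewrite mulrDl mulrDr (Diag_comm Dd b_Diag) opprD addrACA subrr addr0.
  by rewrite mulrBr mulrBl !mulrA -EY -(mulrA (E * b)) EY' !mulrA.
rewrite lee_fin; apply: opnorm_le_bound => // x.
by rewrite /X !bopE_M (bexp_rnorm dot_norm YA) -[rnorm x](bexpN_rnorm dot_norm YA t) opnorm_bound.
Qed.

Lemma chi_length_le t0 D : 0 < t0 -> DKah dot e D ->
  (curve_length dot 0 t0 chi <= (`|Y + D| * t0)%:E)%E.
Proof.
move=> t00 DD.
apply: le_trans (ge0_integral_mono (g := cst (`|Y + D|%:E)) _ _) _.
- by move=> t _; apply: le_ereal_inf_tmp => _ [S _ <-]; rewrite lee_fin.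
- by move=> t tab; exact: finsler_chi_le.
rewrite integral_cst//= lebesgue_measure_itv /= lte_fin t00 oppr0 adde0.
by rewrite EFinM.
Qed.

End ExponentialCurveLength.

(** * Evaluation of the overlap *)

Section Evaluation.
Variables (R : realType) (H : completeNormedModType R[i]).
Variable dot : {dot H for (@conjC R[i])}.
Hypothesis dot_norm : forall x : H, dot x x = `|x| ^+ 2.
Variable e : nat -> H.
Hypothesis he : orthonormal_basis dot e.
Local Notation ip := (redot dot).
Local Notation Pr := (Pr dot_norm he).
Variables (b : bop H) (lam : nat -> R).
Hypothesis b_Diag : is_Diag e (fun k => (lam k)%:C) b.
Variables (n : nat) (psi : nat -> {poly R}).
Hypothesis psi_delta : forall i j, (i < n)%N -> (j < n)%N -> (psi j).[lam i] = (i == j)%:R.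
Variables (I : Type) (r : seq I) (xi : I -> H).
Local Notation k := (fun i j => dot (xi i) (e j)).

Lemma peval_Pr j w : (j < n)%N -> peval (psi j) b (Pr n w) = dot w (e j) *: e j.
Proof.
move=> jn; rewrite PrE bop_sum (bigD1 (Ordinal jn))//= big1 ?addr0 => [|i ij].
  by rewrite bopZ (peval_Diag _ b_Diag) psi_delta// eqxx scale1r.
rewrite bopZ (peval_Diag _ b_Diag) psi_delta// (_ : _ == _ = false) ?scale0r ?scaler0//.
by apply: contraNF ij => /eqP h; apply/eqP/val_inj.
Qed.

(** On the span of the first n basis vectors, psi j (b) is the projection on e j. *)
Lemma cform_trunc (c : I -> R[i]) :
  cform dot r n k (fun j => peval (psi j) b)
    (fun i => c i *: Pr n (xi i)) (fun i => c i *: Pr n (xi i)) =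
  \sum_(j < n) (weight r k j)^-1 * cabs (\sum_(i <- r) c i * (cabs (k i j) ^+ 2)%:C) ^+ 2.
Proof.
pose y i := c i *: Pr n (xi i); apply: eq_bigr => j _; congr (_ * _).
have yE : kcontract r k j y = Pr n (\sum_(i <- r) conjC (k i j) *: (c i *: xi i)).
  by rewrite bop_sum; apply: eq_bigr => i _; rewrite /y !bopZ.
set w := \sum_(i <- r) _ in yE.
have wj : dot w (e j) = \sum_(i <- r) c i * (cabs (k i j) ^+ 2)%:C.
  rewrite dot_suml; apply: eq_bigr => i _; rewrite !dotZl mulrCA; congr (_ * _).
  by rewrite mulrC -sqr_normc cabsE -rmorphXn.
rewrite -/y yE peval_Pr// /redot dotZl -dot_Pr Pr_e ltn_ord (dotC dot (e j)) wj.
by rewrite -sqr_normc cabsE -rmorphXn.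
Qed.

Lemma sum_weight : \sum_(j < n) weight r k j = \sum_(i <- r) rnorm (Pr n (xi i)) ^+ 2.
Proof.
by rewrite exchange_big; apply: eq_bigr => i _; rewrite sqr_rnorm_Pr.
Qed.

Lemma cform_trunc1 :
  cform dot r n k (fun j => peval (psi j) b)
    (fun i => Pr n (xi i)) (fun i => Pr n (xi i)) = \sum_(j < n) weight r k j.
Proof.
have -> : (fun i => Pr n (xi i)) = fun i => 1 *: Pr n (xi i).
  by apply/funext => i; rewrite scale1r.
rewrite cform_trunc; apply: eq_bigr => j _.
have -> : \sum_(i <- r) 1 * (cabs (k i j) ^+ 2)%:C = (weight r k j)%:C.
  by rewrite rmorph_sum; apply: eq_bigr => i _; rewrite mul1r.
rewrite cabs_real ger0_norm ?weight_ge0// expr2.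
have [->|q0] := eqVneq (weight r k j) 0; first by rewrite mulr0 mulr0.
by rewrite mulrA mulVf// mul1r.
Qed.

Definition phase (x : R) : R[i] := cos x +i* sin x.

Lemma phaseD x y : phase (x + y) = phase x * phase y.
Proof. by rewrite /phase cosD sinD; apply: complex_eq => //=; rewrite ?(Re_mul,Im_mul) /=; ring. Qed.

Lemma cabs_phaseE x : cabs (phase x) = 1.
Proof. exact: cabs_phase. Qed.

(** The factor e^{i s theta} = cos theta + i s sin theta turns the j-th sum into
    cos theta * weight j + i sin theta * (signed weight j), and the signed weights
    are small. *)
Lemma cform_trunc_phase (s : I -> R) (theta mu delta : R) :
  (forall i, s i = 1 \/ s i = -1) ->
  (forall j, (j < n)%N -> `|\sum_(i <- r) s i * cabs (k i j) ^+ 2| <= delta) ->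
  \sum_(j < n) weight r k j <= 1 ->
  cform dot r n k (fun j => peval (psi j) b)
    (fun i => phase (s i * theta + mu) *: Pr n (xi i))
    (fun i => phase (s i * theta + mu) *: Pr n (xi i)) <= cos theta ^+ 2 + n%:R * delta.
Proof.
move=> s1 m_le q_le; rewrite cform_trunc.
apply: le_trans (_ : \sum_(j < n) (cos theta ^+ 2 * weight r k j + delta) <= _).
  apply: ler_sum => j _; set q := weight r k j.
  pose m := \sum_(i <- r) s i * cabs (k i j) ^+ 2.
  have -> : \sum_(i <- r) phase (s i * theta + mu) * (cabs (k i j) ^+ 2)%:C =
     phase mu * ((cos theta * q) +i* (sin theta * m)).
    have -> : (cos theta * q) +i* (sin theta * m) =
      \sum_(i <- r) phase (s i * theta) * (cabs (k i j) ^+ 2)%:C.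
      apply: complex_eq; rewrite /= ?Re_sum ?Im_sum mulr_sumr; apply: eq_bigr => i _.
        rewrite Re_mul /= mulr0 subr0; congr (_ * _).
        by case: (s1 i) => ->; rewrite ?mul1r// mulN1r cosN.
      rewrite Im_mul /= mulr0 add0r mulrA; congr (_ * _).
      by case: (s1 i) => ->; rewrite ?mul1r ?mulr1// mulN1r sinN mulrN1.
    rewrite mulr_sumr; apply: eq_bigr => i _.
    by rewrite addrC phaseD mulrA.
  rewrite cabsM cabs_phaseE mul1r sqr_cabs /=.
  have q0 : 0 <= q by exact: weight_ge0.
  have mq : `|m| <= q.
    apply: le_trans (ler_norm_sum _ _ _) _; apply: ler_sum => i _.
    rewrite normrM (ger0_norm (sqr_ge0 _)).
    by case: (s1 i) => ->; rewrite ?normrN normr1 mul1r.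
  have md : `|m| <= delta by exact: m_le.
  have [q00|qn] := eqVneq q 0.
    by rewrite q00 invr0 mul0r mulr0 add0r; apply: le_trans md.
  have qp : 0 < q by rewrite lt_def qn.
  rewrite mulrC ler_pdivrMr//.
  have h1 : (sin theta * m) ^+ 2 <= `|m| * q.
    rewrite exprMn -[m ^+ 2]real_normK ?num_real//.
    have s2 : sin theta ^+ 2 <= 1 by rewrite sin2cos2 gerBl sqr_ge0.
    apply: le_trans (_ : 1 * `|m| ^+ 2 <= _); first by rewrite ler_wpM2r ?sqr_ge0.
    by rewrite mul1r expr2 ler_wpM2l.
  have h2 : `|m| * q <= delta * q by rewrite ler_wpM2r.
  have -> : (cos theta ^+ 2 * q + delta) * q = (cos theta * q) ^+ 2 + delta * q by ring.
  by rewrite lerD2l; apply: le_trans h1 h2.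
rewrite big_split /= sumr_const card_ord -mulr_sumr mulr_natl lerD2r.
by rewrite ler_piMr ?sqr_ge0.
Qed.

End Evaluation.

(** * The calibrating overlap *)

Section ArcCosine.
Variable R : realType.
Implicit Types u x : R.

Lemma acos_le_of_cos u x : -1 <= u <= 1 -> 0 <= x <= pi -> cos x <= u -> acos u <= x.
Proof.
move=> u1 xpi xu; have [a1 a2] := acos_def u1.
rewrite leNgt; apply/negP => xa.
have := @ltr_cos R x (acos u); rewrite !in_itv /= => /(_ xpi a1).
by rewrite a2 xa => h; move: xu; rewrite leNgt h.
Qed.

Lemma acos_ge_of_cos u x : -1 <= u <= 1 -> 0 <= x <= pi -> u <= cos x -> x <= acos u.
Proof.
move=> u1 xpi xu; have [a1 a2] := acos_def u1.
rewrite leNgt; apply/negP => xa.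
have := @ltr_cos R (acos u) x; rewrite !in_itv /= => /(_ a1 xpi).
by rewrite a2 xa => h; move: xu; rewrite leNgt h.
Qed.

Lemma cos_lt_of_lt x u : 0 <= x -> x < u -> u <= pi -> cos u < cos x.
Proof.
move=> x0 xu upi; have u0 := le_trans x0 (ltW xu); have xpi := le_trans (ltW xu) upi.
by rewrite ltr_cos// in_itv /= ?x0 ?u0 ?xpi ?upi.
Qed.

End ArcCosine.

Section Calibration.
Variables (R : realType) (H : completeNormedModType R[i]).
Variable dot : {dot H for (@conjC R[i])}.
Hypothesis dot_norm : forall x : H, dot x x = `|x| ^+ 2.
Variable e : nat -> H.
Hypothesis he : orthonormal_basis dot e.
Local Notation ip := (redot dot).
Local Notation Pr := (Pr dot_norm he).

Lemma unitary_conj_refl b : unitary_conj dot b b.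
Proof. by exists 1, 1; split; rewrite ?mulr1 ?mul1r. Qed.

Lemma eigenvalues_cvg0 b (lam : nat -> R) : compact_op b -> is_Diag e (fun k => (lam k)%:C) b ->
  forall eps : R, 0 < eps -> exists N, forall i, (N <= i)%N -> `|lam i| <= eps.
Proof.
move=> bc bd eps e0; have [N NP] := compact_tail dot_norm he bc e0.
exists N => i Ni; have := opnorm_bound ((1 - Pr i) * b) (e i).
rewrite (rnorm_e dot_norm he) mulr1 bopE_M bd bopZ bopE_B bopE_1 Pr_e ltnn subr0.
by rewrite rnormZr (rnorm_e dot_norm he) mulr1 => h; apply: le_trans h (NP i Ni).
Qed.

(** |V x - i s v x|^2 = |V x|^2 - 2 v (s qim V x) + v^2. *)
Lemma near_eigen V (eps v : R) (s : R) x : antihermitian_op dot V ->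
  v = `|V| -> s = 1 \/ s = -1 -> rnorm x = 1 -> v - eps <= s * qim dot V x ->
  rnorm (V x - (0 +i* (s * v)) *: x) ^+ 2 <= 2 * v * eps.
Proof.
move=> VA vE s1 x1 sx.
have v0 : 0 <= v by rewrite vE.
rewrite -(ip_norm dot_norm) !(ipBl, ipBr) !(ip_norm dot_norm).
rewrite [ip (_ *: x) (V x)]ipC.
have -> : ip (V x) ((0 +i* (s * v)) *: x) = v * (s * qim dot V x).
  have -> : (0 +i* (s * v)) = (s * v)%:C * 'i :> R[i].
    by apply: complex_eq; rewrite ?(Re_mul,Im_mul) /=; ring.
  by rewrite -scalerA ipZr /qim; ring.
have -> : rnorm ((0 +i* (s * v)) *: x) ^+ 2 = v ^+ 2.
  rewrite cnormZ x1 mulr1 sqr_cabs /= expr0n add0r exprMn.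
  by case: s1 => ->; rewrite ?sqrrN expr1n mul1r.
have h1 : rnorm (V x) ^+ 2 <= v ^+ 2.
  apply: lerXn2r; rewrite ?nnegrE ?rnorm_ge0//.
  by have := opnorm_bound V x; rewrite x1 mulr1 -vE.
have h2 : v * (v - eps) <= v * (s * qim dot V x) by rewrite ler_wpM2l.
by lra.
Qed.

Variables (V : bop H) (mu : R).
Let v := `|V|.
Let Y := V - bop_scale (0 +i* mu) 1.
Hypothesis VA : antihermitian_op dot V.
Hypothesis V0 : 0 < v.
Hypothesis Vmin : forall D, DBah dot e D -> `|V| <= `|V + D|.
Hypothesis YK : Kah dot Y.
Variables (b : bop H) (lam : nat -> R).
Hypothesis b_Diag : is_Diag e (fun k => (lam k)%:C) b.
Hypothesis lam_inj : forall i j, i <> j -> lam i <> lam j.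
Hypothesis lam0 : forall eps : R, 0 < eps -> exists N, forall i, (N <= i)%N -> `|lam i| <= eps.
Variables (t0 : R).
Hypothesis t00 : 0 < t0.
Let E := bexp (t0 *: Y).
Let E' := bexp (- (t0 *: Y)).

Lemma Y_near (s : R) x : Y x - (0 +i* (s * v - mu)) *: x = V x - (0 +i* (s * v)) *: x.
Proof.
rewrite /Y bopE_B bopE_S bopE_1 -addrA -opprD -scalerDl; congr (_ - _ *: _).
by apply: complex_eq; rewrite ?(Re_add,Im_add) /=; ring.
Qed.

(** The overlap built on an extremal family. The extremal vectors of one sign, the
    one with |s v - mu| >= v, are nearly eigenvectors of the compact operator Y for
    an eigenvalue away from 0, so they are uniformly concentrated on the first n
    basis vectors; balancing of the total signed mass and of the first n coordinates
    transfers this to the other sign. Hence the family may be truncated, where the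
    overlap is computed exactly. *)
Lemma calibrating_overlap (eps1 : R) : 0 < eps1 ->
  exists (n : nat) (psi : nat -> {poly R}) (I : Type) (r : seq I) (k : I -> nat -> R[i]) (zeta : I -> H),
  [/\ forall i j, (j < n)%N -> 0 <= (psi j).[lam i],
      forall i, \sum_(j < n) (psi j).[lam i] <= 1,
      famdot dot r zeta zeta = 1,
      overlap dot n psi r k zeta b <= cos (t0 * v) ^+ 2 + eps1 &
      1 - eps1 <= overlap dot n psi r k zeta (E * b * E')].
Proof.
move=> e10.
(* sg bounds the distances in the sum of copies of H: replacing zeta and xi by
   their truncations moves them by at most sg, and the overlap by 2 sg + sg^2.
   The defect del of the eigenvector equations is such that the concentration on
   n coordinates (del / v) and the flow up to time t0 (t0 del) stay below sg. *)
pose sg := Num.min 1 (eps1 / 4).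
have sg0 : 0 < sg by rewrite lt_min ltr01 divr_gt0.
have sg1 : sg <= 1 by rewrite ge_min lexx.
have sge : sg <= eps1 / 4 by rewrite ge_min lexx orbT.
pose del := Num.min (sg * v / 16) (sg / (4 * t0)).
have del0 : 0 < del by rewrite lt_min !divr_gt0// mulr_gt0.
have del1 : del <= sg * v / 16 by rewrite ge_min lexx.
have del2 : t0 * del <= sg / 4.
  have : del <= sg / (4 * t0) by rewrite ge_min lexx orbT.
  rewrite ler_pdivlMr ?mulr_gt0// => h; lra.
pose eps := del ^+ 2 / (2 * v).
have eps0 : 0 < eps by rewrite divr_gt0 ?exprn_gt0// mulr_gt0.
have epsE : 2 * v * eps = del ^+ 2.
  by rewrite /eps; field; rewrite gt_eqF.
have epsv : eps < v.
  have sgv : sg * v <= v by rewrite ler_piMl// ltW.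
  have dv : del <= v by lra.
  rewrite /eps ltr_pdivrMr ?mulr_gt0//.
  apply: le_lt_trans (_ : v ^+ 2 < _).
    by apply: lerXn2r; rewrite ?nnegrE// ltW.
  by have : 0 < v ^+ 2 by [rewrite exprn_gt0]; lra.
have [n /(_ _ (leqnn n)) tailY] := compact_tail dot_norm he YK.1 del0.
(* The n + 1 balancing errors add up to at most (n + 1) del3. *)
pose del3 := Num.min (sg ^+ 2 / 16) (eps1 / 4) / n.+1%:R.
have n0 : 0 < n.+1%:R :> R by rewrite ltr0n.
have min0 : 0 < Num.min (sg ^+ 2 / 16) (eps1 / 4).
  by rewrite lt_min !divr_gt0// exprn_gt0.
have del30 : 0 < del3 by rewrite divr_gt0.
have del3E : n.+1%:R * del3 = Num.min (sg ^+ 2 / 16) (eps1 / 4).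
  by rewrite /del3 mulrC divfK// gt_eqF.
have nS : n.+1%:R = n%:R + 1 :> R by rewrite natr1.
have d31 : (n%:R + 1) * del3 <= sg ^+ 2 / 16 by rewrite -nS del3E ge_min lexx.
have d32 : n%:R * del3 <= eps1 / 4.
  have : (n%:R + 1) * del3 <= eps1 / 4 by rewrite -nS del3E ge_min lexx orbT.
  lra.
have [r [r1 rm rs]] := extremal_family dot_norm he VA Vmin n eps0 epsv del30.
have [psi [psi_d psi0 psi1]] := spectral_partition lam_inj lam0 n.
pose T := {p : R * H | extremal dot V eps p}.
pose I : Type := (R * T)%type.
pose a (i : I) := i.1; pose s (i : I) := (sval i.2).1; pose x (i : I) := (sval i.2).2.
have s1 (i : I) : s i = 1 \/ s i = -1 by case: (svalP i.2).
have x1 (i : I) : rnorm (x i) = 1 by case: (svalP i.2).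
have sx (i : I) : v - eps <= s i * qim dot V (x i) by case: (svalP i.2).
have nearY (i : I) : rnorm (Y (x i) - (0 +i* (s i * v - mu)) *: x i) <= del.
  rewrite -(@ler_pXn2r _ 2)// ?nnegrE ?rnorm_ge0// ?(ltW del0)// Y_near -epsE.
  exact: near_eigen.
pose xi (i : I) := (a i)%:C *: x i.
pose k (i : I) j := dot (xi i) (e j).
have kE i j : cabs (k i j) ^+ 2 = a i ^+ 2 * cabs (dot (x i) (e j)) ^+ 2.
  by rewrite /k /xi dotZl cabsM cabs_real exprMn real_normK ?num_real.
have m_le j : (j < n)%N -> `|\sum_(i <- r) s i * cabs (k i j) ^+ 2| <= del3.
  move=> jn; have := rm j jn; congr (`|_| <= _); apply: eq_bigr => i _.
  by rewrite kE mulrCA.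
pose tl (i : I) := rnorm (x i - Pr n (x i)) ^+ 2.
have tl0 i : 0 <= tl i by exact: sqr_ge0.
have tlE i : tl i = 1 - \sum_(j < n) cabs (dot (x i) (e j)) ^+ 2.
  have := Pr_pythagoras dot_norm he n (x i).
  by rewrite x1 expr1n (sqr_rnorm_Pr dot_norm he) -/(tl i) => ->; ring.
pose s0 : R := if mu <= 0 then 1 else -1.
have s0v : v <= `|s0 * v - mu|.
  rewrite /s0; case: (leP mu 0) => hmu.
    by rewrite mul1r ger0_norm; lra.
  by rewrite mulN1r ltr0_norm; lra.
have s01 : s0 = 1 \/ s0 = -1 by rewrite /s0; case: ifP; [left|right].
have tls i : s i = s0 -> tl i <= sg ^+ 2 / 64.
  move=> si; have := nearY i; rewrite si => nY.
  have h1 : rnorm ((1 - Pr n) (Y (x i))) <= del.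
    have := opnorm_bound ((1 - Pr n) * Y) (x i); rewrite x1 mulr1 bopE_M => h.
    exact: le_trans h tailY.
  have h2 : rnorm ((1 - Pr n) (Y (x i) - (0 +i* (s0 * v - mu)) *: x i)) <= del.
    by rewrite bopE_B bopE_1; apply: le_trans (rnorm_PrC dot_norm he n _) nY.
  have h3 : `|s0 * v - mu| * rnorm (x i - Pr n (x i)) <= del + del.
    have -> : `|s0 * v - mu| * rnorm (x i - Pr n (x i)) =
        rnorm ((1 - Pr n) ((0 +i* (s0 * v - mu)) *: x i)).
      rewrite bopZ cnormZ bopE_B bopE_1; congr (_ * _).
      by rewrite /cabs normc_def /= expr0n add0r sqrtr_sqr.
    have -> : (0 +i* (s0 * v - mu)) *: x i =
      Y (x i) - (Y (x i) - (0 +i* (s0 * v - mu)) *: x i) by rewrite subKr.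
    by rewrite bopB; apply: le_trans (rnormD _ _) _; rewrite rnormN lerD.
  have h4 : v * rnorm (x i - Pr n (x i)) <= v * (sg / 8).
    apply: le_trans (_ : `|s0 * v - mu| * rnorm (x i - Pr n (x i)) <= _).
      by rewrite ler_wpM2r ?rnorm_ge0.
    by apply: le_trans h3 _; lra.
  rewrite ler_pM2l// in h4.
  rewrite /tl; apply: le_trans (_ : (sg / 8) ^+ 2 <= _).
    by apply: lerXn2r; rewrite ?nnegrE ?rnorm_ge0// divr_ge0// ltW.
  by rewrite exprMn; lra.
pose tau := \sum_(i <- r) a i ^+ 2 * tl i.
have tau0 : 0 <= tau by apply: sumr_ge0 => i _; rewrite mulr_ge0// sqr_ge0.
have tau_le : tau <= sg ^+ 2 / 8.
  (* the factor 1 + s0 s i removes the sign for which the tails are not yet known *)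
  have -> : tau = - s0 * (\sum_(i <- r) a i ^+ 2 * s i * tl i) +
     \sum_(i <- r) a i ^+ 2 * ((1 + s0 * s i) * tl i).
    rewrite /tau mulr_sumr -big_split /=; apply: eq_bigr => i _; ring.
  have h1 : `|\sum_(i <- r) a i ^+ 2 * s i * tl i| <= sg ^+ 2 / 16.
    apply: le_trans d31.
    have -> : \sum_(i <- r) a i ^+ 2 * s i * tl i = \sum_(i <- r) a i ^+ 2 * s i -
       \sum_(j < n) \sum_(i <- r) s i * cabs (k i j) ^+ 2.
      rewrite exchange_big -sumrB; apply: eq_bigr => i _ /=.
      rewrite tlE mulrBr mulr1 mulr_sumr; congr (_ - _); apply: eq_bigr => j _.
      by rewrite kE; ring.
    apply: le_trans (ler_normB _ _) _; rewrite mulrDl mul1r addrC; apply: lerD; last exact: rs.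
    apply: le_trans (ler_norm_sum _ _ _) _.
    apply: le_trans (_ : \sum_(j < n) del3 <= _).
      by apply: ler_sum => j _; exact: m_le.
    by rewrite sumr_const card_ord mulr_natl.
  have h2 : \sum_(i <- r) a i ^+ 2 * ((1 + s0 * s i) * tl i) <= sg ^+ 2 / 32.
    rewrite -[leRHS]mulr1 -[X in _ <= _ * X]r1 mulr_sumr; apply: ler_sum => i _.
    rewrite mulrC ler_wpM2r ?sqr_ge0//.
    have [si|si] := eqVneq (s i) s0.
      have ss : s0 * s i = 1 by rewrite si; case: s01 => ->; rewrite ?mulr1// mulrNN mulr1.
      by have := tls i si; rewrite ss; lra.
    have ss : s0 * s i = -1.
      move: si; case: (s1 i) => ->; case: s01 => ->; rewrite ?eqxx// ?mulr1 ?mul1r//.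
    by rewrite ss subrr mul0r divr_ge0// sqr_ge0.
  have : - s0 * (\sum_(i <- r) a i ^+ 2 * s i * tl i) <= sg ^+ 2 / 16.
    apply: le_trans (ler_norm _) _; rewrite normrM normrN.
    by case: s01 => ->; rewrite ?normrN normr1 mul1r.
  by have := sqr_ge0 sg; lra.
have fam_xi : famdot dot r xi xi = 1.
  rewrite -r1; apply: eq_bigr => i _.
  by rewrite (ip_norm dot_norm) /xi rnormZr x1 mulr1 real_normK ?num_real.
pose zeta (i : I) := E (xi i).
have fam_zeta : famdot dot r zeta zeta = 1.
  rewrite -fam_xi; apply: eq_bigr => i _; rewrite /zeta /redot.
  by rewrite (bexp_dot dot_norm YK.2).
have w_eq : \sum_(j < n) weight r k j = 1 - tau.
  rewrite (sum_weight dot_norm he) /tau -[X in X - _]r1 -sumrB; apply: eq_bigr => i _.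
  rewrite bopZ rnormZr exprMn real_normK ?num_real// /tl.
  have -> : rnorm (Pr n (x i)) ^+ 2 = 1 - rnorm (x i - Pr n (x i)) ^+ 2.
    by have := Pr_pythagoras dot_norm he n (x i); rewrite x1 expr1n; lra.
  by rewrite -/(a i); ring.
have w_le : \sum_(j < n) weight r k j <= 1 by rewrite w_eq gerBl.
have bb := unitary_conj_refl b.
have Qsym j u w : ip (peval (psi j) b u) w = ip u (peval (psi j) b w).
  exact: (spectral_sym dot_norm he b_Diag psi bb).
have Qpos j u : (j < n)%N -> 0 <= ip (peval (psi j) b u) u.
  by move=> jn; exact: (spectral_ge0 dot_norm he b_Diag psi0 bb).
have Qsum u : \sum_(j < n) ip (peval (psi j) b u) u <= ip u u.
  exact: (spectral_le1 dot_norm he b_Diag psi1 bb).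
exists n, psi, I, r, k, zeta; split=> //.
  (* the start: E x is close to a phase times the truncation of x *)
  pose ph (i : I) := phase (s i * (t0 * v) + (- (t0 * mu))).
  pose y (i : I) := ph i *: Pr n (xi i).
  have y1 : famdot dot r y y <= 1.
    rewrite -fam_xi; apply: ler_sum => i _; rewrite !(ip_norm dot_norm) /y.
    rewrite cnormZ cabs_phaseE mul1r; apply: lerXn2r; rewrite ?nnegrE ?rnorm_ge0//.
    exact: rnorm_Pr.
  have dy : famdot dot r (fun i => zeta i - y i) (fun i => zeta i - y i) <= sg ^+ 2.
    apply: le_trans (_ : \sum_(i <- r) a i ^+ 2 * (sg ^+ 2 / 8 + 2 * tl i) <= _).
      apply: ler_sum => i _; rewrite (ip_norm dot_norm).
      have -> : zeta i - y i = (a i)%:C *: ((E (x i) - ph i *: x i) + ph i *: (x i - Pr n (x i))).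
        rewrite /zeta /y /xi !bopZ scalerBr addrA subrK scalerBr; congr (_ - _).
        by rewrite !scalerA mulrC.
      rewrite rnormZr exprMn real_normK ?num_real// ler_wpM2l ?sqr_ge0//.
      set p := E (x i) - _; set q := ph i *: _.
      have hp : rnorm p <= sg / 4.
        apply: le_trans del2; rewrite /p /ph.
        have -> : s i * (t0 * v) + - (t0 * mu) = t0 * (s i * v - mu) by ring.
        by apply: (bexp_near_eigen dot_norm YK.2); [exact: ltW|exact: nearY].
      have hq : rnorm q ^+ 2 = tl i by rewrite /q cnormZ cabs_phaseE mul1r.
      have hpq : rnorm (p + q) ^+ 2 <= 2 * rnorm p ^+ 2 + 2 * rnorm q ^+ 2.
        have : rnorm (p + q) ^+ 2 <= (rnorm p + rnorm q) ^+ 2.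
          by apply: lerXn2r; rewrite ?nnegrE ?addr_ge0 ?rnorm_ge0//; exact: rnormD.
        by have := sqr_ge0 (rnorm p - rnorm q); lra.
      have hp2 : rnorm p ^+ 2 <= (sg / 4) ^+ 2.
        by apply: lerXn2r; rewrite ?nnegrE ?rnorm_ge0// divr_ge0// ltW.
      by rewrite -hq; apply: le_trans hpq _; lra.
    have -> : \sum_(i <- r) a i ^+ 2 * (sg ^+ 2 / 8 + 2 * tl i) = sg ^+ 2 / 8 + 2 * tau.
      rewrite -[X in X + _]mulr1 -[X in _ * X + _]r1 /tau !mulr_sumr -big_split /=.
      by apply: eq_bigr => i _; rewrite -/(a i); ring.
    by have := sqr_ge0 sg; lra.
  have /andP[_ h] := cform_perturb k Qsym Qpos Qsum (ltW sg0) y1 dy.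
  apply: le_trans h _.
  have h2 := cform_trunc_phase dot_norm he b_Diag psi_d (xi := xi) (t0 * v) (- (t0 * mu)) s1 m_le w_le.
  apply: le_trans (_ : cos (t0 * v) ^+ 2 + n%:R * del3 + 2 * sg + sg ^+ 2 <= _).
    by rewrite !lerD2r.
  by nra.
(* the end: the flow cancels and the form is evaluated at xi itself *)
have -> : overlap dot n psi r k zeta (E * b * E') =
    cform dot r n k (fun j => peval (psi j) b) xi xi.
  apply: eq_bigr => j _; congr (_ * _).
  have E1 : E' * E = 1 by exact: bexpN.
  have E2 : E * E' = 1 by exact: bexpNr.
  rewrite peval_conj// kcontract_bop !bopE_M -[E' (E _)]bopE_M E1 bopE_1.
  by rewrite /redot (bexp_dot dot_norm YK.2).
pose y (i : I) := Pr n (xi i).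
have y1 : famdot dot r y y <= 1.
  rewrite -fam_xi; apply: ler_sum => i _; rewrite !(ip_norm dot_norm) /y.
  apply: lerXn2r; rewrite ?nnegrE ?rnorm_ge0//; exact: rnorm_Pr.
have dy : famdot dot r (fun i => xi i - y i) (fun i => xi i - y i) <= sg ^+ 2.
  have -> : famdot dot r (fun i => xi i - y i) (fun i => xi i - y i) = tau.
    apply: eq_bigr => i _; rewrite (ip_norm dot_norm) /y /xi bopZ -scalerBr.
    by rewrite rnormZr exprMn real_normK ?num_real.
  by have := sqr_ge0 sg; lra.
have /andP[h _] := cform_perturb k Qsym Qpos Qsum (ltW sg0) y1 dy.
apply: le_trans h; rewrite (cform_trunc1 dot_norm he b_Diag psi_d).
rewrite w_eq; nra.
Qed.

End Calibration.

(** * The theorem *)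

Section CosineSquare.
Variable R : realType.

(** cos is strictly decreasing on [0, pi], so a sufficiently small error in the
    squared cosines, and in the factor 1 - eps, costs at most kappa in each
    doubled angle. *)
Lemma angle_limit (z kappa : R) : 0 < kappa -> kappa <= z -> z <= pi ->
  exists eps : R, [/\ 0 < eps, eps < 1 & forall f0 f1 : R,
    0 <= f0 <= 1 -> 0 <= f1 <= 1 ->
    f0 <= cos (z / 2) ^+ 2 + eps -> 1 - eps <= f1 ->
    (z - 2 * kappa) / 2 <=
      (acos ((1 - eps) * (2 * f0 - 1)) - acos ((1 - eps) * (2 * f1 - 1))) / 2].
Proof.
move=> k0 kz zpi.
have g1 : cos kappa < 1.
  by rewrite -(cos0 R); apply: cos_lt_of_lt => //; exact: le_trans zpi.
have g0 : cos z < cos (z - kappa).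
  by apply: cos_lt_of_lt => //; rewrite ?subr_ge0// ltrBlDr ltrDl.
have cz : cos z = 2 * cos (z / 2) ^+ 2 - 1.
  have zE : z = (z / 2) *+ 2 by rewrite -mulr_natr divfK.
  by rewrite {1}zE cos_mulr2n -mulr_natr mulrC.
pose eps := Num.min (1 - cos kappa) (Num.min (cos (z - kappa) - cos z) 1) / 4.
have m0 : 0 < Num.min (1 - cos kappa) (Num.min (cos (z - kappa) - cos z) 1).
  by rewrite !lt_min !subr_gt0 g1 g0 ltr01.
have e0 : 0 < eps by rewrite divr_gt0.
have e1 : 4 * eps <= 1 - cos kappa.
  by rewrite mulrC divfK// ge_min lexx.
have e2 : 4 * eps <= cos (z - kappa) - cos z.
  by rewrite mulrC divfK// !ge_min lexx orbT.
have e3 : 4 * eps <= 1.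
  by rewrite mulrC divfK// !ge_min lexx !orbT.
exists eps; split=> //; first by lra.
move=> f0 f1 /andP[f00 f01] /andP[f10 f11] h0 h1.
have h2 : z - kappa <= acos ((1 - eps) * (2 * f0 - 1)).
  apply: acos_ge_of_cos.
  - by apply/andP; split; nra.
  - by rewrite subr_ge0 kz /=; lra.
  - by nra.
have h3 : acos ((1 - eps) * (2 * f1 - 1)) <= kappa.
  apply: acos_le_of_cos.
  - by apply/andP; split; nra.
  - by rewrite (ltW k0) (le_trans kz zpi).
  - by nra.
by lra.
Qed.

End CosineSquare.

Theorem proposition17 (R : realType) (H : completeNormedModType R[i])
    (dot : {dot H for (@conjC R[i])})
    (dot_norm : forall x : H, dot x x = `|x| ^+ 2)
    (e : nat -> H) (he : orthonormal_basis dot e)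
    (A u b : bop H) (lam : nat -> R)
    (A_compact : compact_op A) (A_herm : hermitian_op dot A)
    (u_Uc : Uc dot u)
    (b_Diag : is_Diag e (fun k => (lam k)%:C) b)
    (A_eq : A = u * b * adj dot u)
    (lam_inj : forall i j, i <> j -> lam i <> lam j)
    (Z : bop H) (Z_Kah : Kah dot Z)
    (D1 : bop H) (D1_diag : DBah dot e D1)
    (D1_min : quotient_norm dot e Z = `|Z + D1|)
    (D1_noncompact : ~ compact_op D1)
    (l : R[i]) (l_imaginary : complex.Re l = 0)
    (l_lim : entry dot e D1 j @[j --> \oo] --> (l : R[i]^o))
    (t0 : R)
    (t0_range : pi / (2 * `|Z|) <= t0 <= pi / (2 * quotient_norm dot e Z)) :
  let Y := Z + D1 - bop_scale l 1 in
  let chi := fun t : R => bexp (t *: Y) * b * bexp (- (t *: Y)) in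
  minimal_length dot (unitary_orbit dot A) b chi t0.
Proof.
move=> Y chi; set q := quotient_norm dot e Z in D1_min t0_range *.
have l_eq : l = 0 +i* complex.Im l by apply: complex_eq.
pose V := Z + D1; rewrite -/V in D1_min.
have [Zc ZA] := Z_Kah; have [DA [d Dd]] := D1_diag.
have VA : antihermitian_op dot V by exact: (antihermD dot_norm).
have D2 : DKah dot e (D1 - bop_scale l 1).
  exact: (diag_sub_limit dot_norm he).
have YE : Y = Z + (D1 - bop_scale l 1) by rewrite /Y addrA.
have YK : Kah dot Y.
  rewrite YE; split; first by apply: compactD => //; exact: D2.1.1.
  by apply: (antihermD dot_norm) => //; exact: D2.1.2.
have V0 : 0 < `|V|.
  rewrite normr_gt0; apply/eqP => V00; apply: D1_noncompact.
  have -> : D1 = - Z by apply/eqP; rewrite -addr_eq0 addrC; apply/eqP.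
  exact: compactN.
have Vmin D : DBah dot e D -> `|V| <= `|V + D|.
  move=> [DDA [d' Dd']]; rewrite -D1_min /V -addrA.
  apply: (quotient_norm_le dot_norm he) => //; split; first exact: (antihermD dot_norm).
  by exists (fun k => d k + d' k) => k; rewrite bopE_D Dd Dd' scalerDl.
have qZ : q <= `|Z|.
  rewrite -[Z in leRHS]addr0; apply: (quotient_norm_le dot_norm he) => //; split.
    by apply/(antihermP dot_norm) => x y; rewrite !bopE_0 linear0l linear0r oppr0.
  by exists (fun _ => 0) => k; rewrite bopE_0 scale0r.
have q0 : 0 < q by rewrite D1_min.
have Z0 : 0 < `|Z| by exact: lt_le_trans qZ.
case/andP: t0_range => t01 t02.
have t00 : 0 < t0.
  by apply: lt_le_trans t01; rewrite divr_gt0 ?pi_gt0// mulr_gt0.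
have t0q : 2 * (t0 * q) <= pi.
  by move: t02; rewrite ler_pdivlMr ?mulr_gt0// => h; rewrite mulrCA.
have b_compact : compact_op b.
  have e00 := e_neq0 dot_norm he 0.
  case: u_Uc => -[u1 u2] _.
  have -> : b = adj dot u * A * u.
    by rewrite A_eq !mulrA u1 mul1r -mulrA u1 mulr1.
  by apply: compactMr; exact: compactMl.
have lam0 := eigenvalues_cvg0 dot_norm he b_compact b_Diag.
move=> a1 a2 eta eta_s eta1 eta2.
apply/lee_addgt0Pr => eps eps0.
pose kappa := Num.min (eps / 2) (2 * (t0 * q)).
have z0 : 0 < 2 * (t0 * q) by rewrite !mulr_gt0.
have k0 : 0 < kappa by rewrite lt_min z0 divr_gt0.
have k1 : kappa <= eps / 2 by rewrite ge_min lexx.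
have k2 : kappa <= 2 * (t0 * q) by rewrite ge_min lexx orbT.
have [del [del0 del1 angle]] := angle_limit k0 k2 t0q.
have upper : (curve_length dot 0 t0 chi <= ((q + eps / (2 * t0)) * t0)%:E)%E.
  have hq : has_inf [set `|Z + D| | D in DKah dot e].
    split; last by exists 0 => _ [S _ <-].
    by exists `|Z + (D1 - bop_scale l 1)|; exists (D1 - bop_scale l 1).
  have et : 0 < eps / (2 * t0) by rewrite divr_gt0// mulr_gt0.
  have [_ [D DK <-] hD] := inf_adherent et hq.
  have DD2 : DKah dot e (D - (D1 - bop_scale l 1)) by exact: (DKahB dot_norm).
  apply: le_trans (chi_length_le dot_norm he b_Diag YK t00 DD2) _.
  rewrite lee_fin ler_wpM2r ?(ltW t00)//.
  have -> : Y + (D - (D1 - bop_scale l 1)) = Z + D.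
    by rewrite YE -addrA; congr (_ + _); rewrite addrC subrK.
  exact: ltW.
have lower : (((2 * (t0 * q) - 2 * kappa) / 2)%:E <= curve_length dot a1 a2 eta)%E.
  have YK' : Kah dot (V - bop_scale (0 +i* complex.Im l) 1) by rewrite -l_eq.
  have [n [psi [I [r [k [zeta [p0 p1 z1 h0 h1]]]]]]] :=
    calibrating_overlap dot_norm he VA V0 Vmin YK' b_Diag lam_inj lam0 t00 del0.
  rewrite -l_eq -/Y in h1.
  have bA c : unitary_orbit dot A c -> unitary_conj dot b c.
    by apply: (orbit_unitary_conj dot_norm he) u_Uc A_eq.
  have [a12 etaM _ _ _] := eta_s.
  have f0 := overlap01 dot_norm he b_Diag p0 p1 k z1 (bA _ (etaM a1 _)).
  have f1 := overlap01 dot_norm he b_Diag p0 p1 k z1 (bA _ (etaM a2 _)).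
  have := curve_length_ge dot_norm he b_Diag p0 p1 k z1 bA eta_s del0 del1.
  apply: le_trans; rewrite lee_fin; apply: angle.
  - by apply: f0; rewrite in_itv /= lexx ltW.
  - by apply: f1; rewrite in_itv /= lexx andbT ltW.
  - by rewrite eta1 D1_min; move: h0; congr (_ <= cos _ ^+ 2 + _); field.
  - by rewrite eta2.
apply: le_trans upper _; apply: le_trans (_ : ((2 * (t0 * q) - 2 * kappa) / 2)%:E + eps%:E <= _)%E.
  rewrite -EFinD lee_fin.
  have -> : (q + eps / (2 * t0)) * t0 = t0 * q + eps / 2 by field; rewrite gt_eqF.
  lra.
by rewrite leeD2r.
Qed.
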